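(* For every $N\in\{1,2,\ldots,+\infty\}$ there exists a weak-star closed shift invariant subspace $E_N\subset\mathcal{B}$ of the Bloch space such that $\operatorname{ind}(E_N)=N$.
   Context: Let $\mathbb{D}=\{z\in\mathbb{C}: |z|<1\}$. The Bloch space $\mathcal{B}$ is the Banach space of functions $f$ analytic in $\mathbb{D}$ with $\|f\|_{\mathcal{B}} = |f(0)|+\sup_{|z|<1}(1-|z|^2)|f'(z)|<+\infty$. Let $A^1$ be the Bergman space of analytic functions on $\mathbb{D}$ that are integrable with respect to area measure $dA$. The pairing $\langle g,f\rangle=\lim_{r\to1}\int_{\mathbb{D}}g(rz)\overline{f(rz)}\,dA(z)$, $g\in A^1$, $f\in\mathcal{B}$, is well defined and realizes the duality $(A^1)^*\cong\mathcal{B}$; the weak-star topology on $\mathcal{B}$ is the one inherited from its pre-dual $A^1$ in this way. The shift operator is $(M_zf)(z)=zf(z)$. A weak-star closed invariant subspace is a weak-star closed linear subspace $E\subset\mathcal{B}$ with $zE:=M_zE\subset E$; then $zE$ is also weak-star closed. Its index is $\operatorname{ind}(E)=\dim(E/zE)$, with $\operatorname{ind}(E)=+\infty$ meaning that $E/zE$ is infinite-dimensional. *)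

(* Defs.v *)
From HB Require Import structures.
From mathcomp Require Import all_boot all_order all_algebra.
From mathcomp Require Import complex.
From mathcomp Require Import all_classical all_reals all_analysis.

Set Implicit Arguments.
Unset Strict Implicit.
Unset Printing Implicit Defensive.

Import Order.TTheory GRing.Theory Num.Theory numFieldNormedType.Exports.

Local Open Scope classical_set_scope.
Local Open Scope ring_scope.
Local Open Scope complex_scope.

(* The regular module [R[i]^o], convertible to [R[i]], is the alias that carries
   the topology and the normed space structure of the complex plane. *)
Notation Cplx R := (R[i]^o) (only parsing).

Section quotient_dimension.
Context {K : fieldType} {V : lmodType K}.
Implicit Types E F : set V.

Definition linear_subspace E : Prop :=
  E 0 /\ forall (a : K) (x y : V), E x -> E y -> E (a *: x + y).

(* The cosets [e i + F] form a basis of the quotient E / F. *)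
Definition quotient_basis E F (n : nat) (e : 'I_n -> V) : Prop :=
  [/\ forall i, E (e i),
      forall c : 'I_n -> K,
        F (\sum_(i < n) c i *: e i) -> forall i, c i = 0
    & forall x, E x ->
        exists c : 'I_n -> K, F (x - \sum_(i < n) c i *: e i)].

(* dim (E / F) = N, where [None] stands for +oo. *)
Definition quotient_dim E F (N : option nat) : Prop :=
  match N with
  | Some n => exists e : 'I_n -> V, quotient_basis E F e
  | None => forall (n : nat) (e : 'I_n -> V), ~ quotient_basis E F e
  end.

End quotient_dimension.

Section bloch.
Context {R : realType}.
Local Notation C := (Cplx R).
Local Notation modulus := (@Normc.normc R).
Implicit Types f g : C -> C.

Definition disc : set C := [set z | modulus z < 1].

(* A function on the disc is represented by its extension by zero to the plane,
   so that equality of functions on the disc is Leibniz equality. As the disc is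
   open, the complex derivative at a point of the disc is not affected. *)
Definition analytic_disc f : Prop :=
  (forall z, disc z -> derivable f z 1) /\ (forall z, ~ disc z -> f z = 0).

Definition bloch_norm f : \bar R :=
  ((modulus (f 0))%:E +
   ereal_sup [set ((1 - modulus z ^+ 2) * modulus (derive1 f z))%:E
             | z in disc])%E.

Definition bloch : set (C -> C) :=
  [set f | analytic_disc f /\ (bloch_norm f < +oo)%E].

Definition area :
    {measure set (measurableTypeR R * measurableTypeR R) -> \bar R} :=
  (@lebesgue_measure R \x @lebesgue_measure R)%E.

Definition to_complex (p : R * R) : C := p.1 +i* p.2.

Definition area_integral (h : C -> C) : C :=
  Rintegral area (to_complex @^-1` disc) (fun p => complex.Re (h (to_complex p))) +i*
  Rintegral area (to_complex @^-1` disc) (fun p => complex.Im (h (to_complex p))).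

Definition bergman : set (C -> C) :=
  [set g | analytic_disc g /\
    area.-integrable (to_complex @^-1` disc)
      (fun p => (modulus (g (to_complex p)))%:E)].

Definition pairing g f : C :=
  lim ((fun r : R => area_integral (fun z => g (r%:C * z) * (f (r%:C * z))^*))
         @ 1^'-).

(* The initial topology for the functionals f |-> <g, f>, g in A^1. *)
Definition weak_star : topologicalType :=
  initial_topology
    (fun f : bloch => (fun g : bergman => pairing (val g) (val f))
                       : {ptws bergman -> C}).

Definition weak_star_closed (E : set (C -> C)) : Prop :=
  E `<=` bloch /\ closed ([set f : bloch | E (val f)] : set weak_star).

Definition shift_operator f : C -> C := fun z => z * f z.

Definition weak_star_closed_invariant_subspace (E : set (C -> C)) : Prop :=
  [/\ linear_subspace E, weak_star_closed E & shift_operator @` E `<=` E].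

Definition index_eq (E : set (C -> C)) (N : option nat) : Prop :=
  quotient_dim E (shift_operator @` E) N.

End bloch.

(* Main.v *)
Require Import Defs.
From HB Require Import structures.
From mathcomp Require Import all_boot all_order all_algebra.
From mathcomp Require Import complex.
From mathcomp Require Import all_classical all_reals all_analysis.
From mathcomp Require Import measurable_realfun.
From mathcomp Require Import zify ring lra.

Set Implicit Arguments.
Unset Strict Implicit.
Unset Printing Implicit Defensive.

Import Order.TTheory GRing.Theory Num.Theory numFieldNormedType.Exports.

Local Open Scope classical_set_scope.
Local Open Scope ring_scope.
Local Open Scope complex_scope.

(* Write L_a f = sum_n a_n conj(f_n) for f = sum_n f_n z^n in the Bloch space.
   Bloch functions have uniformly bounded l^2 norms over the blocks
   4^p - 1 <= n < 4^(p+1) - 1, and if the l^2 norms of a over these blocks are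
   summable, then sum_n (a_n / c_n) z^n with c_n = int |z|^(2n) dA lies in A^1
   and represents L_a; in particular L_a is weak-star continuous.

   The f_i are lacunary series with exponents 4^q - 1, q ranging over disjoint
   sets S_i.  For every j there is such a sequence a_j for which, with the
   backward shift B,  L_(B^n a_j) f_i = [i = j][n = 0],  and a_0 is the unit
   sequence at 0.  It is built in stages: a current error e is spread evenly over
   K new slots p of its class as K^-1 z^(4^p - 1) e.  Pairing with the f_i then
   removes e and leaves K^-1 times a sum of translates of e with mostly disjoint
   supports, so the total l^2 norm of the errors decreases by a fixed fraction of
   the norm of e.

   E_N is the set of Bloch functions annihilated by L_(B^n a_j) for all n >= 1 and
   j < N.  Then z E_N is the set of f in E_N with L_(a_j) f = 0 for all j < N (the
   case j = 0 says f(0) = 0, so that f can be divided by z), and the f_i with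
   i < N are biorthogonal to these functionals on E_N / z E_N. *)

(** * Area integrals over the disc *)

(** Spreading an error over K slots pays off because two norms are in play. The K pieces lie in K
    different blocks, so in the predual, an l^1 sum of block norms, a stage costs at most the l^2
    norm of its input, whatever K is. In its own class it leaves 1/K times fewer than K^2/2
    disjointly supported translates, hence at most 1/sqrt 2 of the input in l^2. The obstacle is
    that it also disturbs every class used before: each earlier slot leaves 1/K times K disjoint
    translates, of norm 1/sqrt K times the input. So K is chosen large against the number of earlier
    slots. The sum of all error bounds then controls the sum of the inputs, which places the
    sequence in the predual; since every class is treated infinitely often, every error tends to 0.

    The function theory rests on area integrals alone: moments come from dilations, orthogonality
    from a rotation of infinite order, and Taylor series from a Cauchy formula averaged over an
    annulus. *)

Section lebesgue_affine.
Context {R : realType}.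
Local Notation mu := (@lebesgue_measure R).

Lemma lebesgue_shift (t : R) (A : set (measurableTypeR R)) : measurable A ->
  pushforward mu ((fun x => x + t) : _ -> measurableTypeR R) A = mu A.
Proof.
move=> mA; apply/esym/lebesgue_measure_unique => //=.
  exact: (@measurable_funD _ (measurableTypeR R)).
move=> mf X /ocitvP[->|[[a b] /= ab ->]]; first by rewrite !measure0.
rewrite /pushforward.
have -> : (fun x : R => x + t) @^-1` `]a, b] = `]a - t, b - t]%classic.
  by apply/seteqP; split => x /=; rewrite !in_itv /= ltrBlDr lerBrDr.
rewrite !lebesgue_measure_itv /= !lte_fin ltrD2r ab -!EFinB.
by congr (_%:E); ring.
Qed.

Lemma lebesgue_scale (c : R) (A : set (measurableTypeR R)) :
  0 < c -> measurable A -> mu ((fun x => c * x) @^-1` A) = (c^-1%:E * mu A)%E.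
Proof.
move=> c0 mA.
suff -> : mu A = (c%:E * mu ((fun x => (c * x)%R) @^-1` A))%E.
  by rewrite muleA -EFinM mulVf ?gt_eqF// mul1e.
pose f := (fun x => c * x) : _ -> measurableTypeR R.
have mf : measurable_fun [set: measurableTypeR R] f by exact: mulrl_measurable.
apply: (@lebesgue_measure_unique R (mscale (NngNum (ltW c0)) (pushforward mu f))) => //=.
move=> X /ocitvP[->|[[a b] /= ab ->]]; first by rewrite !measure0.
rewrite /mscale /= /pushforward /=.
have -> : f @^-1` `]a, b] = `]a / c, b / c]%classic.
  by apply/seteqP; split => x /=; rewrite !in_itv /= ltr_pdivrMr // ler_pdivlMr // ![x * c]mulrC.
rewrite !lebesgue_measure_itv /= !lte_fin ltr_pM2r ?invr_gt0 // ab -!EFinB -EFinM.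
by congr (_%:E); field; rewrite gt_eqF.
Qed.

End lebesgue_affine.

(** * Shears, rotations and dilations of the plane *)

Section area_maps.
Context {R : realType}.
Local Notation mu := (@lebesgue_measure R).
Local Notation T := (measurableTypeR R * measurableTypeR R)%type.
Implicit Types (A : set T) (phi : T -> T).

Definition preserves_area phi :=
  measurable_fun [set: T] phi /\
  forall A, measurable A -> @area R (phi @^-1` A) = @area R A.

Lemma preserves_area_comp phi psi :
  preserves_area phi -> preserves_area psi -> preserves_area (phi \o psi).
Proof.
move=> [mphi pphi] [mpsi ppsi]; split; first exact: measurableT_comp.
move=> A mA; rewrite comp_preimage ppsi ?pphi//.
by rewrite -[X in measurable X]setTI; exact: mphi.
Qed.

Lemma measurable_fun_swap : measurable_fun [set: T] (fun p : T => (p.2, p.1) : T).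
Proof.
by apply: measurable_fun_pair; [exact: measurable_snd|exact: measurable_fst].
Qed.

Lemma preserves_area_swap : preserves_area (fun p : T => (p.2, p.1)).
Proof.
split; first exact: measurable_fun_swap.
move=> A mA; apply/esym; rewrite /area.
have mf := measurable_fun_swap.
apply: (@product_measure_unique _ _ _ _ _ mu mu
  (pushforward (@area R) (fun p : T => (p.2, p.1) : T))) => //=.
move=> B C mB mC; rewrite /pushforward.
have -> : (fun p : T => (p.2, p.1) : T) @^-1` (B `*` C) = C `*` B.
  by apply/seteqP; split => -[x y] /= [].
by rewrite /area product_measure1E// muleC.
Qed.

(** Rectangles suffice, by uniqueness of the product measure. The section at x of the preimage of B
    x C is empty or the translate of C by - t x, which has the measure of C. *)
Lemma preserves_area_shear (t : R) :
  preserves_area (fun p : T => (p.1, p.2 + t * p.1)).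
Proof.
have mf : measurable_fun [set: T] (fun p : T => (p.1, p.2 + t * p.1) : T).
  apply: measurable_fun_pair; first exact: measurable_fst.
  apply: measurable_funD; first exact: measurable_snd.
  by apply: measurableT_comp => //; exact: measurable_fst.
split=> // A mA; apply/esym; rewrite /area.
apply: (@product_measure_unique _ _ _ _ _ mu mu
  (pushforward (@area R) (fun p : T => (p.1, p.2 + t * p.1) : T))) => //=.
move=> B C mB mC; rewrite /pushforward /area /product_measure1/=.
rewrite /product_measure1.
rewrite (eq_integral (fun x => mu C * (\1_B x)%:E)%E); last first.
  move=> x _ /=.
  rewrite indicE; have [xB|xB] := boolP (x \in B); rewrite ?mule1 ?mule0.
    rewrite -(lebesgue_shift (t * x) mC); congr (mu _).
    apply/seteqP; split => y; rewrite /xsection/= inE /=; first by case.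
    by move=> Cy; split => //; exact: set_mem.
  rewrite (_ : xsection _ _ = set0) ?measure0//.
  apply/seteqP; split => y //; rewrite /xsection/= inE /= => -[Bx _].
  by move: xB; rewrite notin_setE.
rewrite ge0_integralZl//; last exact/measurable_EFinP/measurable_indic.
by rewrite integral_indic// setIT muleC.
Qed.

(* A rotation by an angle other than pi is a product of three shears. *)
Lemma preserves_area_rotation (c s : R) : c ^+ 2 + s ^+ 2 = 1 -> c != -1 ->
  preserves_area (fun p : T => (c * p.1 - s * p.2, s * p.1 + c * p.2)).
Proof.
move=> cs c1; have c10 : 1 + c != 0 by rewrite addrC addr_eq0.
have shx (a : R) : preserves_area (fun p : T => (p.1 + a * p.2, p.2)).
  exact: (preserves_area_comp preserves_area_swap
    (preserves_area_comp (preserves_area_shear a) preserves_area_swap)).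
(* For c = cos a and s = sin a this is tan (a / 2); the shear factors are - tau, s, - tau. *)
pose tau := s / (1 + c).
have st : s * tau = 1 - c.
  by rewrite /tau mulrA -expr2 -(addKr (c ^+ 2) (s ^+ 2)) cs; field.
have tc : tau * (1 + c) = s by rewrite /tau divfK.
have := preserves_area_comp (shx (- tau))
  (preserves_area_comp (preserves_area_shear s) (shx (- tau))).
congr preserves_area; apply/funext => -[x y] /=; congr pair.
  transitivity (x * (1 - s * tau) - y * (tau * (1 + (1 - s * tau)))); first by ring.
  by rewrite st subKr tc; ring.
transitivity (s * x + y * (1 - s * tau)); first by ring.
by rewrite st subKr; ring.
Qed.

Lemma area_scale (r : R) A : 0 < r -> measurable A ->
  @area R ((fun p : T => (r * p.1, r * p.2) : T) @^-1` A) =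
  ((r ^- 2)%:E * @area R A)%E.
Proof.
move=> r0 mA; have r20 : 0 < r ^+ 2 by rewrite exprn_gt0.
have mf : measurable_fun [set: T] (fun p : T => (r * p.1, r * p.2) : T).
  by apply: measurable_fun_pair; exact: measurableT_comp.
suff -> : @area R A =
    ((r ^+ 2)%:E * @area R ((fun p : T => ((r * p.1)%R, (r * p.2)%R) : T) @^-1` A))%E.
  by rewrite muleA -EFinM mulVf ?gt_eqF// mul1e.
apply: (@product_measure_unique _ _ _ _ _ mu mu
  (mscale (NngNum (ltW r20)) (pushforward (@area R) (fun p : T => (r * p.1, r * p.2) : T)))) => //=.
move=> B C mB mC; rewrite /mscale /= /pushforward /=.
have -> : (fun p : T => (r * p.1, r * p.2) : T) @^-1` (B `*` C) =
    ((fun x => r * x) @^-1` B) `*` ((fun x => r * x) @^-1` C) by [].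
rewrite /area product_measure1E//; last 2 first.
- by rewrite -[X in measurable X]setTI; exact: mulrl_measurable.
- by rewrite -[X in measurable X]setTI; exact: mulrl_measurable.
rewrite /= !lebesgue_scale// muleACA [LHS]muleA.
suff /= -> : ((r ^+ 2)%:E * (r^-1%:E * r^-1%:E) = 1 :> \bar R)%E by rewrite mul1e.
by rewrite -!EFinM; congr (_%:E); field; rewrite gt_eqF.
Qed.

End area_maps.

(** * The real-valued modulus *)

Section complex_modulus.
Context {R : realType}.
Local Notation C := (Cplx R).
Local Notation modulus := (@Normc.normc R).
Implicit Types (x y z : C).

Lemma normc_norm z : `|z| = (modulus z)%:C. Proof. by []. Qed.

Lemma normc_ge0 z : 0 <= modulus z.
Proof. by case: z => a b; exact: sqrtr_ge0. Qed.

Lemma normcD x y : modulus (x + y) <= modulus x + modulus y.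
Proof. by rewrite -lecR rmorphD /= -!normc_norm ler_normD. Qed.

Lemma normcN x : modulus (- x) = modulus x.
Proof. by case: x => a b /=; rewrite !sqrrN. Qed.

Lemma normcB x y : modulus (x - y) <= modulus x + modulus y.
Proof. by rewrite (le_trans (normcD _ _))// normcN. Qed.

Lemma normc_distC x y : modulus (x - y) = modulus (y - x).
Proof. by rewrite -opprB normcN. Qed.

Lemma normcX z n : modulus (z ^+ n) = modulus z ^+ n.
Proof.
by elim: n => [|n IH]; rewrite ?expr0 ?Normc.normc1// !exprS Normc.normcM IH.
Qed.

Lemma normc_conj z : modulus (conjc z) = modulus z.
Proof. by case: z => a b /=; rewrite sqrrN. Qed.

Lemma normc_real (a : R) : modulus a%:C = `|a|.
Proof. by rewrite /= expr0n /= addr0 sqrtr_sqr. Qed.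

Lemma normc_sq z : modulus z ^+ 2 = complex.Re z ^+ 2 + complex.Im z ^+ 2.
Proof. by case: z => a b /=; rewrite sqr_sqrtr// addr_ge0// sqr_ge0. Qed.

Lemma normr_Re_le z : `|complex.Re z| <= modulus z.
Proof.
rewrite -(@ler_pXn2r _ 2)// ?nnegrE ?normc_ge0//.
by rewrite normc_sq real_normK ?num_real// lerDl sqr_ge0.
Qed.

Lemma normr_Im_le z : `|complex.Im z| <= modulus z.
Proof.
rewrite -(@ler_pXn2r _ 2)// ?nnegrE ?normc_ge0//.
by rewrite normc_sq real_normK ?num_real// lerDr sqr_ge0.
Qed.

Lemma normc_le_ReIm z : modulus z <= `|complex.Re z| + `|complex.Im z|.
Proof.
rewrite -(@ler_pXn2r _ 2)// ?nnegrE ?normc_ge0//.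
rewrite normc_sq sqrrD !real_normK ?num_real//.
by rewrite lerD2r lerDl mulrn_wge0// mulr_ge0.
Qed.

Lemma normc_eq0 z : (modulus z == 0) = (z == 0).
Proof.
apply/eqP/eqP => [/Normc.eq0_normc//|->]; exact: Normc.normc0.
Qed.

Lemma normc_gt0 z : (0 < modulus z) = (z != 0).
Proof. by rewrite lt_neqAle normc_ge0 andbT eq_sym normc_eq0. Qed.

Lemma normc_sum (I : Type) (r : seq I) (P : pred I) (F : I -> C) :
  modulus (\sum_(i <- r | P i) F i) <= \sum_(i <- r | P i) modulus (F i).
Proof.
elim/big_rec2 : _ => [|i a z _ H]; first by rewrite Normc.normc0.
by rewrite (le_trans (normcD _ _))// lerD2l.
Qed.

Lemma mulcJ z : z * conjc z = (modulus z ^+ 2)%:C.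
Proof.
rewrite normc_sq; case: z => a b /=; simpc.
by congr (_ +i* _); ring.
Qed.

Lemma Re_mulc x y : complex.Re (x * y : C) =
  complex.Re x * complex.Re y - complex.Im x * complex.Im y.
Proof. by case: x; case: y. Qed.

Lemma Im_mulc x y : complex.Im (x * y : C) =
  complex.Re x * complex.Im y + complex.Im x * complex.Re y.
Proof. by case: x; case: y. Qed.

Lemma Re_addc x y : complex.Re (x + y : C) = complex.Re x + complex.Re y.
Proof. by case: x; case: y. Qed.

Lemma Im_addc x y : complex.Im (x + y : C) = complex.Im x + complex.Im y.
Proof. by case: x; case: y. Qed.

Lemma Re_oppc x : complex.Re (- x : C) = - complex.Re x.
Proof. by case: x. Qed.

Lemma Im_oppc x : complex.Im (- x : C) = - complex.Im x.
Proof. by case: x. Qed.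

Lemma Re_conjc x : complex.Re (conjc x) = complex.Re x. Proof. by case: x. Qed.
Lemma Im_conjc x : complex.Im (conjc x) = - complex.Im x. Proof. by case: x. Qed.

Lemma normcBr_ge x y : modulus x - modulus y <= modulus (x - y).
Proof. by rewrite lerBlDr -{1}(subrK y x) normcD. Qed.

End complex_modulus.

Section area_integral.
Context {R : realType}.
Local Notation T := (measurableTypeR R * measurableTypeR R)%type.

(** Measurability refers to the product sigma-algebra, so openness is exploited through countably
    many sets: U is the union of the boxes with rational centre and radius 1/(n+1) that it
    contains. *)
Lemma open_box_measurable (U : set T) :
  (forall p, U p -> exists2 e : R, 0 < e &
     forall q : T, `|q.1 - p.1| < e -> `|q.2 - p.2| < e -> U q) ->
  measurable U.
Proof.
move=> Uo.
pose box (i : rat * rat * nat) : set T :=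
  [set q | `|q.1 - ratr i.1.1| < i.2.+1%:R^-1] `&` [set q | `|q.2 - ratr i.1.2| < i.2.+1%:R^-1].
pose F i := if pselect (box i `<=` U) then box i else set0.
have mball (c e : R) : measurable ([set x | `|x - c| < e] : set (measurableTypeR R)).
  rewrite (_ : [set x | _] = ball c e); first exact: measurable_ball.
  by apply/seteqP; split => x /=; rewrite /ball/= distrC.
have mbox i : measurable (box i).
  apply: measurableI.
    rewrite -[X in measurable X]setTI.
    exact: (measurable_fst measurableT _ (mball (ratr i.1.1) i.2.+1%:R^-1)).
  rewrite -[X in measurable X]setTI.
  exact: (measurable_snd measurableT _ (mball (ratr i.1.2) i.2.+1%:R^-1)).
suff -> : U = \bigcup_i F i.
  apply: countable_bigcupT_measurable => // i.
  by rewrite /F; case: pselect => _ /=; [exact: mbox|exact: measurable0].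
apply/seteqP; split => [p Up|p [i _]]; last first.
  by rewrite /F; case: pselect => [sU|_] /=; [exact: sU|case: p].
have [e e0 eU] := Uo _ Up.
have [n] : exists n : nat, n.+1%:R^-1 < e / 2.
  have := @near_infty_natSinv_lt R (PosNum (divr_gt0 e0 (ltr0n R 2))).
  by case=> n _ /(_ n (leqnn n)) /= ?; exists n.
move=> ne; have n0 : 0 < n.+1%:R^-1 :> R by rewrite invr_gt0.
have rt (x : R) : exists q : rat, `|x - ratr q| < n.+1%:R^-1.
  have /rat_in_itvoo[q] : x < x + n.+1%:R^-1 by rewrite ltrDl.
  rewrite in_itv /= => /andP[xq qx]; exists q.
  by rewrite distrC gtr0_norm ?subr_gt0// ltrBlDl.
have [q1 h1] := rt p.1; have [q2 h2] := rt p.2.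
exists (q1, q2, n) => //; rewrite /F; case: pselect => [sU|nU]; first by split.
case: nU => q [/= g1 g2]; apply: eU.
- rewrite -(subrK (ratr q1) q.1) -addrA (le_lt_trans (ler_normD _ _))//.
  by rewrite distrC in h1; rewrite (splitr e) ltrD// (lt_trans _ ne)//.
- rewrite -(subrK (ratr q2) q.2) -addrA (le_lt_trans (ler_normD _ _))//.
  by rewrite distrC in h2; rewrite (splitr e) ltrD// (lt_trans _ ne)//.
Qed.
End area_integral.

Lemma cvg0_le_normD {R : realType} (u v w : nat -> R) :
  (forall n, 0 <= w n <= `|u n| + `|v n|) ->
  u n @[n --> \oo] --> 0 -> v n @[n --> \oo] --> 0 -> w n @[n --> \oo] --> 0.
Proof.
move=> H u0 v0; apply: (@squeeze_cvgr _ _ _ _ (fun=> 0) (fun n => `|u n| + `|v n|)).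
- exact: nearW.
- exact: cvg_cst.
- by have := cvgD (cvg_norm u0) (cvg_norm v0); rewrite normr0 addr0; exact.
Qed.

(** * The complex area integral on bounded measurable functions *)

Section area_integral.
Context {R : realType}.
Local Notation C := (Cplx R).
Local Notation modulus := (@Normc.normc R).
Local Notation T := (measurableTypeR R * measurableTypeR R)%type.
Local Notation Dm := (@to_complex R @^-1` disc : set T).
Local Notation area := (@area R).
Local Notation I := (@area_integral R).

Lemma to_complex_box (p q : T) (e : R) : 0 < e ->
  `|q.1 - p.1| < e / 2 -> `|q.2 - p.2| < e / 2 ->
  modulus (to_complex q - to_complex p) < e.
Proof.
move=> e0 h1 h2; rewrite (le_lt_trans (normc_le_ReIm _))//.
by rewrite (splitr e) ltrD.
Qed.

Lemma disc_nbhs (z : C) : disc z ->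
  exists2 d : R, 0 < d & forall w : C, modulus (w - z) < d -> disc w.
Proof.
rewrite /disc /= => z1; exists (1 - modulus z); first by rewrite subr_gt0.
by move=> w; rewrite ltrBrDr => h; rewrite /disc/= -(subrK z w) (le_lt_trans (normcD _ _)).
Qed.

Lemma measurable_cont_disc (k : C -> R) (a : R) :
  (forall z, disc z -> forall e : R, 0 < e -> exists2 d : R, 0 < d &
     forall w, disc w -> modulus (w - z) < d -> `|k w - k z| < e) ->
  measurable (Dm `&` [set p | a < k (to_complex p)]).
Proof.
move=> kc; apply: open_box_measurable => p [Dp /= ap].
have [d1 d10 H1] := disc_nbhs Dp.
have [|d d0 H] := kc _ Dp (k (to_complex p) - a); first by rewrite subr_gt0.
exists (Num.min d d1 / 2); first by rewrite divr_gt0// lt_min d0.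
move=> q h1 h2.
have m0 : 0 < Num.min d d1 by rewrite lt_min d0.
have := to_complex_box m0 h1 h2; rewrite lt_min => /andP[hd hd1].
split; first exact: H1.
have := H _ (H1 _ hd1) hd; rewrite ltr_norml => /andP[+ _] /=.
by rewrite opprB ltrBDr subrK.
Qed.

Lemma measurable_Dm : measurable Dm.
Proof.
have := @measurable_cont_disc (fun=> 1) 0; rewrite (_ : _ `&` _ = Dm).
  by apply => z _ e e0; exists 1 => // w _ _; rewrite subrr normr0.
by apply/seteqP; split => [p []|p]//= Dp; split.
Qed.

Lemma measurable_fun_cont_disc (k : C -> R) :
  (forall z, disc z -> forall e : R, 0 < e -> exists2 d : R, 0 < d &
     forall w, disc w -> modulus (w - z) < d -> `|k w - k z| < e) ->
  measurable_fun Dm (fun p : T => k (to_complex p)).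
Proof.
move=> kc mD; apply: (measurability _ (RGenOInfty.measurableE R)) => //.
move=> /= _ [_ [a ->] <-]; rewrite preimage_itvoy.
exact: measurable_cont_disc.
Qed.

Lemma area_Dm_lty : (area Dm < +oo)%E.
Proof.
apply: (@le_lt_trans _ _ (area (`[-1, 1]%classic `*` `[-1, 1]%classic))).
  apply: le_measure; rewrite ?inE; [exact: measurable_Dm| exact: measurableX|].
  move=> [x y] /= h; rewrite !in_itv /= -!ler_norml; split.
    by rewrite (le_trans _ (ltW h))// (normr_Re_le (x +i* y)).
  by rewrite (le_trans _ (ltW h))// (normr_Im_le (x +i* y)).
have -> : area (`[-1, 1]%classic `*` `[-1, 1]%classic) =
    (lebesgue_measure (`[-1, 1]%classic : set R)%R * lebesgue_measure (`[-1, 1]%classic : set R)%R)%E.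
  exact: product_measure1E.
by rewrite !lebesgue_measure_itv/= lte_fin -EFinD; case: ifP; rewrite ?mule0 ?ltry// -EFinM ltry.
Qed.

Definition area0 : R := fine (area Dm).

Lemma area0_ge0 : 0 <= area0. Proof. exact: fine_ge0. Qed.

(** The working class of integrands. Unlike integrability, boundedness is stable under products, and
    the finite area of the disc turns it into integrability. *)
Definition bmr (h : T -> R) :=
  measurable_fun Dm h /\ exists M, forall p, Dm p -> `|h p| <= M.

Lemma bmr_cst (a : R) : bmr (fun=> a).
Proof. by split; [exact: measurable_cst|exists `|a|]. Qed.

Lemma bmrD h k : bmr h -> bmr k -> bmr (fun p => h p + k p).
Proof.
move=> [mh [M hM]] [mk [N kN]]; split; first exact: measurable_funD.
by exists (M + N) => p Dp; rewrite (le_trans (ler_normD _ _))// lerD ?hM ?kN.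
Qed.

Lemma bmrM h k : bmr h -> bmr k -> bmr (fun p => h p * k p).
Proof.
move=> [mh [M hM]] [mk [N kN]]; split; first exact: measurable_funM.
by exists (M * N) => p Dp; rewrite normrM ler_pM ?hM ?kN.
Qed.

Lemma bmrN h : bmr h -> bmr (fun p => - h p).
Proof.
move=> bh; have := bmrM (bmr_cst (-1)) bh.
by congr bmr; apply/funext => p; rewrite mulN1r.
Qed.

Lemma bmr_integrable h : bmr h -> area.-integrable Dm (EFin \o h).
Proof.
move=> [mh [M hM]]; apply: (@le_integrable _ _ _ _ _ measurable_Dm _ (EFin \o cst `|M|)).
- exact/measurable_EFinP.
- by move=> p Dp /=; rewrite lee_fin normr_id (le_trans (hM _ Dp))// ler_norm.
- apply/integrableP; split; first exact/measurable_EFinP/measurable_cst.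
  rewrite /= integral_cst; last exact: measurable_Dm.
  by rewrite lte_mul_pinfty// ?area_Dm_lty// abse_ge0.
Qed.

Lemma Rintegral_preserves (phi : T -> T) h : preserves_area phi ->
  phi @^-1` Dm = Dm -> bmr h ->
  Rintegral area Dm (h \o phi) = Rintegral area Dm h.
Proof.
move=> [mphi pphi] phiD [mh [M hM]].
(* h is measurable on the disc only; its extension by zero is measurable on the whole plane, as the
   change of variables requires. *)
pose g := (h \_ Dm).
have mg : measurable_fun setT g by apply/(measurable_restrictT _ measurable_Dm).
have bg : bmr (g \o phi).
  split; first by apply: measurable_funTS; exact: measurableT_comp.
  exists (Num.max M 0) => p Dp /=; rewrite /g /patch; case: ifPn => [/set_mem|_].
    by move=> Dphi; rewrite le_max hM.
  by rewrite normr0 le_max lexx orbT.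
transitivity (Rintegral area Dm (g \o phi)).
  apply: eq_Rintegral => p /set_mem Dp /=; rewrite /g /patch ifT// inE.
  by rewrite -[Dm _]/((phi @^-1` Dm) p) phiD.
transitivity (Rintegral area Dm g); last first.
  by apply: eq_Rintegral => p pD; rewrite /g /patch pD.
rewrite /Rintegral; congr fine.
have mEg : measurable_fun setT (EFin \o g) by exact/measurable_EFinP.
have ig : area.-integrable (phi @^-1` Dm) ((EFin \o g) \o phi).
  by rewrite phiD; exact: bmr_integrable.
have := integral_pushforward mphi mEg ig measurable_Dm.
rewrite phiD => <-.
by apply: eq_measure_integral => A mA _; exact: pphi.
Qed.

Lemma Rintegral_dominated_cvg0 (h : nat -> T -> R) (M : R) :
  (forall n, measurable_fun Dm (h n)) ->
  (forall n p, Dm p -> `|h n p| <= M) ->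
  (forall p, Dm p -> h n p @[n --> \oo] --> 0) ->
  Rintegral area Dm (h n) @[n --> \oo] --> 0.
Proof.
move=> mh hM h0.
have [] := @dominated_convergence _ _ _ area Dm measurable_Dm
  (fun n => EFin \o h n) (cst 0%E) (EFin \o cst M).
- by move=> n; exact/measurable_EFinP.
- exact: measurable_cst.
- by apply: aeW => p Dp; apply: cvg_EFin; [exact: nearW|exact: h0].
- exact: (bmr_integrable (bmr_cst M)).
- by apply: aeW => p /= n Dp; rewrite lee_fin; exact: hM.
move=> _ _; rewrite integral_cst ?mul0e; last exact: measurable_Dm.
by move=> /fine_cvg.
Qed.

Definition bm (h : C -> C) :=
  bmr (fun p => complex.Re (h (to_complex p))) /\
  bmr (fun p => complex.Im (h (to_complex p))).

Lemma bmE h : bm h <->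
  [/\ measurable_fun Dm (fun p : T => complex.Re (h (to_complex p))),
      measurable_fun Dm (fun p : T => complex.Im (h (to_complex p)))
    & exists M, forall z, disc z -> modulus (h z) <= M].
Proof.
split=> [[[m1 [M1 H1]] [m2 [M2 H2]]]|[m1 m2 [M HM]]].
  split=> //; exists (M1 + M2) => -[x y] Dz.
  by rewrite (le_trans (normc_le_ReIm _))// lerD// ?(H1 (x, y))// (H2 (x, y)).
by split; split=> //; exists M => p Dp;
  rewrite (le_trans _ (HM _ Dp))// ?normr_Re_le// normr_Im_le.
Qed.

Lemma bm_cst (a : C) : bm (fun=> a).
Proof. by split; exact: bmr_cst. Qed.

Lemma bmD h k : bm h -> bm k -> bm (fun z => h z + k z).
Proof.
move=> [h1 h2] [k1 k2]; split.
  by have := bmrD h1 k1; congr bmr; apply/funext => p; rewrite Re_addc.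
by have := bmrD h2 k2; congr bmr; apply/funext => p; rewrite Im_addc.
Qed.

Lemma bmM h k : bm h -> bm k -> bm (fun z => h z * k z).
Proof.
move=> [h1 h2] [k1 k2]; split.
  have := bmrD (bmrM h1 k1) (bmrN (bmrM h2 k2)).
  by congr bmr; apply/funext => p; rewrite Re_mulc.
have := bmrD (bmrM h1 k2) (bmrM h2 k1).
by congr bmr; apply/funext => p; rewrite Im_mulc.
Qed.

Lemma bmN h : bm h -> bm (fun z => - h z).
Proof.
move=> bh; have := bmM (bm_cst (-1)) bh.
by congr bm; apply/funext => p; rewrite mulN1r.
Qed.

Lemma bmB h k : bm h -> bm k -> bm (fun z => h z - k z).
Proof. by move=> bh bk; apply: bmD => //; exact: bmN. Qed.

Lemma bm_conj h : bm h -> bm (fun z => conjc (h z)).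
Proof.
move=> [h1 h2]; split.
  by move: h1; congr bmr; apply/funext => p; rewrite Re_conjc.
by have := bmrN h2; congr bmr; apply/funext => p; rewrite Im_conjc.
Qed.

Lemma bm_sum (J : Type) (r : seq J) (P : pred J) (F : J -> C -> C) :
  (forall i, bm (F i)) -> bm (fun z => \sum_(i <- r | P i) F i z).
Proof.
move=> bF; elim: r => [|i r IH].
  by have := bm_cst 0; congr bm; apply/funext => z; rewrite big_nil.
have := IH; case: (boolP (P i)) => Pi.
  move=> /(bmD (bF i)); congr bm; apply/funext => z; by rewrite big_cons Pi.
by congr bm; apply/funext => z; rewrite big_cons (negbTE Pi).
Qed.

Lemma bm_cont (h : C -> C) (M : R) :
  (forall z, disc z -> forall e : R, 0 < e -> exists2 d : R, 0 < d &
     forall w, disc w -> modulus (w - z) < d -> modulus (h w - h z) < e) ->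
  (forall z, disc z -> modulus (h z) <= M) -> bm h.
Proof.
move=> hc hM; apply/bmE; split; last by exists M.
- apply: (@measurable_fun_cont_disc (fun z : C => complex.Re (h z))) => z Dz e e0.
  have [d d0 H] := hc _ Dz _ e0; exists d => // w Dw wz /=.
  by rewrite -Re_oppc -Re_addc (le_lt_trans (normr_Re_le _))// H.
- apply: (@measurable_fun_cont_disc (fun z : C => complex.Im (h z))) => z Dz e e0.
  have [d d0 H] := hc _ Dz _ e0; exists d => // w Dw wz /=.
  by rewrite -Im_oppc -Im_addc (le_lt_trans (normr_Im_le _))// H.
Qed.

Lemma bm_id : bm id.
Proof.
apply: (@bm_cont _ 1) => [z Dz e e0|z /ltW//].
by exists e.
Qed.

Lemma bmX h n : bm h -> bm (fun z => h z ^+ n).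
Proof.
move=> bh; elim: n => [|n IH].
  by have := bm_cst 1; congr bm; apply/funext => z; rewrite expr0.
by have := bmM bh IH; congr bm; apply/funext => z; rewrite exprS.
Qed.

Lemma eq_aint h k : (forall z, disc z -> h z = k z) -> I h = I k.
Proof.
move=> hk; rewrite /area_integral; congr (_ +i* _);
  by apply: eq_Rintegral => p /set_mem Dp; rewrite hk.
Qed.

Lemma aintD h k : bm h -> bm k -> I (fun z => h z + k z) = I h + I k.
Proof.
move=> [h1 h2] [k1 k2]; rewrite /area_integral; simpc.
congr (_ +i* _).
  rewrite -RintegralD; first by apply: eq_Rintegral => p _; rewrite Re_addc.
  - exact: measurable_Dm.
  - exact: bmr_integrable.
  - exact: bmr_integrable.
rewrite -RintegralD; first by apply: eq_Rintegral => p _; rewrite Im_addc.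
- exact: measurable_Dm.
- exact: bmr_integrable.
- exact: bmr_integrable.
Qed.

Lemma aintZ (a : C) h : bm h -> I (fun z => a * h z) = a * I h.
Proof.
move=> [h1 h2]; rewrite /area_integral; case: a => a b; simpc.
have mD := measurable_Dm.
congr (_ +i* _).
  rewrite -!RintegralZl//; try exact: bmr_integrable.
  rewrite -RintegralB//; first by apply: eq_Rintegral => p _; rewrite Re_mulc.
  - by have /bmr_integrable := bmrM (bmr_cst a) h1.
  - by have /bmr_integrable := bmrM (bmr_cst b) h2.
rewrite -!RintegralZl//; try exact: bmr_integrable.
rewrite -RintegralD//; first by apply: eq_Rintegral => p _; rewrite Im_mulc.
- by have /bmr_integrable := bmrM (bmr_cst a) h2.
- by have /bmr_integrable := bmrM (bmr_cst b) h1.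
Qed.

Lemma aintN h : bm h -> I (fun z => - h z) = - I h.
Proof.
move=> bh; rewrite -[RHS]mulN1r -aintZ//.
by apply: eq_aint => z _; rewrite mulN1r.
Qed.

Lemma aintB h k : bm h -> bm k -> I (fun z => h z - k z) = I h - I k.
Proof. by move=> bh bk; rewrite aintD ?aintN//; exact: bmN. Qed.

Lemma aint0 : I (fun=> 0) = 0.
Proof.
rewrite -[RHS](mul0r (I (fun=> 0))) -aintZ; last exact: bm_cst.
by apply: eq_aint => z _; rewrite mul0r.
Qed.

Lemma aint_sum (J : Type) (r : seq J) (P : pred J) (F : J -> C -> C) :
  (forall i, bm (F i)) ->
  I (fun z => \sum_(i <- r | P i) F i z) = \sum_(i <- r | P i) I (F i).
Proof.
move=> bF; elim: r => [|i r IH].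
  by rewrite big_nil -[RHS]aint0; apply: eq_aint => z _; rewrite big_nil.
rewrite big_cons; case: (boolP (P i)) => Pi.
  rewrite -IH -aintD//; last exact: bm_sum.
  by apply: eq_aint => z _; rewrite big_cons Pi.
by rewrite -IH; apply: eq_aint => z _; rewrite big_cons (negbTE Pi).
Qed.

Lemma le_normr_Rint_cst (k : T -> R) M : bmr k ->
  (forall p, Dm p -> `|k p| <= M) -> `|Rintegral area Dm k| <= M * area0.
Proof.
move=> bk kM; have ik := bmr_integrable bk.
rewrite (le_trans (le_normr_Rintegral measurable_Dm ik))//.
rewrite -(Rintegral_cst area measurable_Dm).
apply: le_Rintegral => //; [exact: measurable_Dm| |exact: bmr_integrable (bmr_cst M)].
apply: (@bmr_integrable (fun p => `|k p|)); case: bk => mk _; split.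
  exact: measurableT_comp.
by exists M => p Dp; rewrite normr_id kM.
Qed.

(** The factor 2 pays for bounding the real and the imaginary part separately. *)
Lemma aint_bound h M : bm h -> (forall z, disc z -> modulus (h z) <= M) ->
  modulus (I h) <= 2 * M * area0.
Proof.
move=> [h1 h2] hM; rewrite (le_trans (normc_le_ReIm _))//= -mulrA mulr_natl mulr2n.
by apply: lerD; apply: le_normr_Rint_cst => // p Dp;
  rewrite (le_trans _ (hM _ Dp))// ?normr_Re_le ?normr_Im_le.
Qed.

Lemma aint_dominated_cvg0 (h : nat -> C -> C) (M : R) :
  (forall n, bm (h n)) ->
  (forall n z, disc z -> modulus (h n z) <= M) ->
  (forall z, disc z -> modulus (h n z) @[n --> \oo] --> 0) ->
  modulus (I (h n)) @[n --> \oo] --> 0.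
Proof.
move=> bh hM h0.
have R0 : Rintegral area Dm (fun p => complex.Re (h n (to_complex p))) @[n --> \oo] --> 0.
  apply: (@Rintegral_dominated_cvg0 _ M).
  - by move=> n; case: (bh n) => -[].
  - by move=> n p Dp; rewrite (le_trans (normr_Re_le _))// hM.
  - move=> p Dp; apply: norm_cvg0.
    apply: (squeeze_cvgr _ (cvg_cst 0) (h0 _ Dp)).
    by apply: nearW => n; rewrite normr_ge0 normr_Re_le.
have I0 : Rintegral area Dm (fun p => complex.Im (h n (to_complex p))) @[n --> \oo] --> 0.
  apply: (@Rintegral_dominated_cvg0 _ M).
  - by move=> n; case: (bh n) => _ [].
  - by move=> n p Dp; rewrite (le_trans (normr_Im_le _))// hM.
  - move=> p Dp; apply: norm_cvg0.
    apply: (squeeze_cvgr _ (cvg_cst 0) (h0 _ Dp)).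
    by apply: nearW => n; rewrite normr_ge0 normr_Im_le.
apply: (cvg0_le_normD _ R0 I0) => n.
by rewrite normc_ge0 normc_le_ReIm.
Qed.

(** The exclusion of -1 is inherited from the factorization into shears, where the tangent of the
    half angle would be infinite. *)
Lemma rotation_exists (u : C) : modulus u = 1 -> u != -1 ->
  exists phi : T -> T, [/\ preserves_area phi,
    forall p, to_complex (phi p) = u * to_complex p & phi @^-1` Dm = Dm].
Proof.
move=> u1 uN1; case: u u1 uN1 => c s u1 uN1.
pose phi (p : T) : T := (c * p.1 - s * p.2, s * p.1 + c * p.2).
have E p : to_complex (phi p) = (c +i* s) * to_complex p.
  by rewrite /to_complex /phi /=; simpc; rewrite [s * _ + _]addrC.
exists phi; split => //.
- have cs : c ^+ 2 + s ^+ 2 = 1.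
    by have := normc_sq (c +i* s); rewrite u1 expr1n /= => <-.
  apply: preserves_area_rotation => //; apply: contra uN1 => /eqP c1.
  have : s ^+ 2 = 0 by move: cs; rewrite c1 sqrrN expr1n; lra.
  move/eqP; rewrite sqrf_eq0 => /eqP s0; rewrite c1 s0.
  by apply/eqP; simpc.
- apply/funext => p; suff : disc (to_complex (phi p)) = disc (to_complex p) by [].
  by rewrite /disc /mkset E Normc.normcM u1 mul1r.
Qed.

Lemma aint_rot (u : C) h : modulus u = 1 -> u != -1 -> bm h ->
  I (fun z => h (u * z)) = I h.
Proof.
move=> u1 uN1 [h1 h2]; have [phi [pphi E phiD]] := rotation_exists u1 uN1.
rewrite /area_integral; congr (_ +i* _).
  rewrite -(Rintegral_preserves pphi phiD h1).
  by apply: eq_Rintegral => p _ /=; rewrite E.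
rewrite -(Rintegral_preserves pphi phiD h2).
by apply: eq_Rintegral => p _ /=; rewrite E.
Qed.

(** A rotation invariant cut-off that keeps z^-1 and (z - w)^-1, |w| < r, bounded on the disc. *)
Definition annulus (r : R) (z : C) : C := if r <= modulus z then 1 else 0.

Lemma annulusM (r : R) (u z : C) : modulus u = 1 -> annulus r (u * z) = annulus r z.
Proof. by move=> u1; rewrite /annulus Normc.normcM u1 mul1r. Qed.

Lemma measurable_outer (r : R) : measurable (Dm `&` [set p : T | r <= modulus (to_complex p)]).
Proof.
have mL : measurable (Dm `&` [set p | - r < - modulus (to_complex p)]).
  apply: (@measurable_cont_disc (fun z => - modulus z)) => z Dz e e0.
  exists e => // w _; apply: le_lt_trans; rewrite opprK addrC.
  by rewrite ler_norml lerNl opprB normcBr_ge /= normc_distC normcBr_ge.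
rewrite (_ : _ `&` _ = Dm `\` (Dm `&` [set p | - r < - modulus (to_complex p)])).
  by apply: measurableD => //; exact: measurable_Dm.
apply/seteqP; split => p /=.
  by move=> [Dp rp]; split => // -[_]; rewrite ltrN2 ltNge rp.
by move=> [Dp h]; split => //; rewrite leNgt; apply/negP => h'; apply: h; rewrite ltrN2.
Qed.

Lemma bm_annulus (r : R) : bm (annulus r).
Proof.
apply/bmE; split.
- apply: (@eq_measurable_fun _ _ _ _ _ (\1_(Dm `&` [set p : T | r <= modulus (to_complex p)]) : T -> R)).
    move=> p /set_mem Dp; rewrite /annulus indicE.
    have -> : (p \in Dm `&` [set p : T | r <= modulus (to_complex p)]) = (r <= modulus (to_complex p)).
      by apply/idP/idP => [/set_mem[]//|rp]; exact/mem_set.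
    by case: (_ <= _).
  by apply: measurable_indic; exact: measurable_outer.
- apply: (@eq_measurable_fun _ _ T R _ (fun=> 0)); last exact: measurable_cst.
  by move=> p _; rewrite /annulus; case: (_ <= _).
- by exists 1 => z _; rewrite /annulus; case: ifP => _; rewrite ?Normc.normc1 ?Normc.normc0.
Qed.

End area_integral.

(** * Moments of the disc and orthogonality of the monomials *)

Section moments.
Context {R : realType}.
Local Notation C := (Cplx R).
Local Notation modulus := (@Normc.normc R).
Local Notation T := (measurableTypeR R * measurableTypeR R)%type.
Local Notation Dm := (@to_complex R @^-1` disc : set T).
Local Notation area := (@area R).
Local Notation I := (@area_integral R).
Local Notation area0 := (@area0 R).
Local Notation N := (fun p : T => modulus (to_complex p)).

Definition moment (n : nat) : R := Rintegral area Dm (fun p => N p ^+ (2 * n)).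

Definition small_disc (r : R) : set T := [set p : T | N p < r].

Lemma bmr_modX n : bmr (fun p : T => N p ^+ n).
Proof.
have mN : measurable_fun Dm N.
  apply: (@measurable_fun_cont_disc _ modulus) => z Dz e e0; exists e => // w _.
  apply: le_lt_trans; rewrite ler_norml lerNl opprB normc_distC normcBr_ge /=.
  by rewrite normc_distC normcBr_ge.
split; first exact: measurable_funX.
by exists 1 => p Dp; rewrite normrX exprn_ile1// ger0_norm ?normc_ge0// ltW.
Qed.

Lemma small_discE r : r <= 1 -> small_disc r = Dm `\` (Dm `&` [set p : T | r <= N p]).
Proof.
move=> r1; apply/seteqP; split => p /=.
  move=> pr; split; first by rewrite /disc/=; exact: lt_le_trans pr r1.
  by case=> _; rewrite leNgt pr.
by move=> [Dp h]; rewrite /small_disc /= ltNge; apply/negP => h'; apply: h.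
Qed.

Lemma measurable_small_disc r : r <= 1 -> measurable (small_disc r).
Proof.
move=> r1; rewrite small_discE//; apply: measurableD; first exact: measurable_Dm.
exact: measurable_outer.
Qed.

(** Substituting r p for p, the area contributes r^2 and the integrand r^(2n), whence the exponent
    2(n+1). *)
Lemma small_disc_moment (r : R) n : 0 < r -> r < 1 ->
  Rintegral area (small_disc r) (fun p => N p ^+ (2 * n)) = r ^+ (2 * n.+1) * moment n.
Proof.
move=> r0 r1; have r20 : 0 < r ^+ 2 by rewrite exprn_gt0.
have alg (S m : R) : r ^- 2 * S = r ^+ (2 * n) * m -> S = r ^+ (2 * n.+1) * m.
  by rewrite mulnS exprD -mulrA => <-; rewrite mulrA mulfV ?mul1r// gt_eqF.
have mS := measurable_small_disc (ltW r1).
pose s (p : T) : T := (r * p.1, r * p.2).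
have Ns p : N (s p) = r * N p.
  have -> : to_complex (s p) = r%:C * to_complex p.
    by case: p => x y; rewrite /s /to_complex /=; simpc.
  by rewrite Normc.normcM normc_real gtr0_norm.
have ms : measurable_fun setT s.
  by apply: measurable_fun_pair; exact: measurableT_comp.
have sD : s @^-1` (small_disc r) = Dm.
  apply/funext => p; suff : (N (s p) < r) = (N p < 1) :> Prop by [].
  by rewrite Ns gtr_pMr.
pose f (p : T) : \bar R := (N p ^+ (2 * n))%:E.
have mf : measurable_fun (small_disc r) f.
  apply/measurable_EFinP; case: (bmr_modX (2 * n)) => + _.
  apply: measurable_funS; first exact: measurable_Dm.
  by move=> p /= pr; rewrite /disc/=; exact: lt_trans pr r1.
have f0 p : (0 <= f p)%E by rewrite lee_fin exprn_ge0// normc_ge0.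
have r2i : 0 <= r ^- 2 by rewrite invr_ge0 ltW.
have E1 : (\int[pushforward area s]_(p in small_disc r) f p =
          (r ^- 2)%:E * \int[area]_(p in small_disc r) f p)%E.
  have -> : ((r ^- 2)%:E * \int[area]_(p in small_disc r) f p)%E =
      (\int[mscale (NngNum r2i) area]_(p in small_disc r) f p)%E.
    by rewrite (ge0_integral_mscale area mS (NngNum r2i) mf).
  apply: eq_measure_integral => A mA _.
  by rewrite /mscale/= /pushforward area_scale.
have E2 : (\int[pushforward area s]_(p in small_disc r) f p =
   \int[area]_(p in Dm) (f \o s) p)%E.
  by rewrite (ge0_integral_pushforward ms area mS mf)// sD.
have E3 : Rintegral area Dm (fun p => N (s p) ^+ (2 * n)) = r ^+ (2 * n) * moment n.
  rewrite /moment -RintegralZl; last 2 first.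
    exact: measurable_Dm.
    exact: bmr_integrable (bmr_modX _).
  by apply: eq_Rintegral => p _; rewrite Ns exprMn.
have E4 : Rintegral area Dm (fun p => N (s p) ^+ (2 * n)) =
    r ^- 2 * Rintegral area (small_disc r) (fun p => N p ^+ (2 * n)).
  rewrite {1}/Rintegral -[X in fine X]/(\int[area]_(p in Dm) (f \o s) p)%E -E2 E1.
  have fin : area.-integrable (small_disc r) f.
    apply: (integrableS measurable_Dm mS) (bmr_integrable (bmr_modX (2 * n))).
    by move=> p /= pr; rewrite /disc/=; exact: lt_trans pr r1.
  have fi := integrable_fin_num mS fin.
  exact: (@fineM _ (r ^- 2)%:E _ isT fi).
have E34 := etrans (esym E4) E3.
exact: alg E34.
Qed.

Lemma moment0 : moment 0 = area0.
Proof.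
rewrite /moment /area0 /= /Rintegral.
rewrite (eq_integral (fun=> 1%:E)); last by move=> p _; rewrite muln0 expr0.
by rewrite integral_cst ?mul1e//; exact: measurable_Dm.
Qed.

Lemma moment_split (r : R) n : 0 < r -> r < 1 ->
  Rintegral area (Dm `&` [set p : T | r <= N p]) (fun p => N p ^+ (2 * n)) =
  (1 - r ^+ (2 * n.+1)) * moment n.
Proof.
move=> r0 r1.
have mS := measurable_small_disc (ltW r1).
have U : small_disc r `|` (Dm `&` [set p : T | r <= N p]) = Dm.
  by rewrite small_discE ?ltW// setUC setDUK//; exact: subIsetl.
have : moment n = Rintegral area (small_disc r) (fun p => N p ^+ (2 * n)) +
   Rintegral area (Dm `&` [set p : T | r <= N p]) (fun p => N p ^+ (2 * n)).
  rewrite -Rintegral_setU//.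
  - by rewrite U.
  - exact: measurable_outer.
  - by rewrite U; exact: bmr_integrable (bmr_modX _).
  - apply/disj_setPS => p [/= h1 [_ h2]].
    by move: h1; rewrite /small_disc /= ltNge h2.
by rewrite small_disc_moment// => h; rewrite mulrBl mul1r {1}h; ring.
Qed.

(* Scaling determines the integral over the outer annulus in terms of the moment
   itself; there |z|^(2n) lies between r^(2n) and 1, and r tends to 1 below. *)
Lemma moment_bounds (r : R) n : 0 < r -> r < 1 ->
  r ^+ (2 * n) * ((1 - r ^+ 2) * area0) <= (1 - r ^+ (2 * n.+1)) * moment n
    <= (1 - r ^+ 2) * area0.
Proof.
move=> r0 r1.
have mO := measurable_outer r.
have sO : Dm `&` [set p : T | r <= N p] `<=` Dm by exact: subIsetl.
have io k : area.-integrable (Dm `&` [set p : T | r <= N p]) (EFin \o (fun p => N p ^+ k)).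
  exact: (integrableS measurable_Dm mO sO (bmr_integrable (bmr_modX k))).
have := moment_split 0 r0 r1; rewrite muln0 muln1 moment0 => A.
rewrite -moment_split// -A; apply/andP; split.
  rewrite -RintegralZl; last 2 first. - exact: mO.
  - exact: (io 0%N).
  apply: le_Rintegral => //.
    have := integrableZl mO (r ^+ (2 * n)) (io 0%N).
    by congr integrable; apply/funext => p.
  move=> p [Dp rp]; rewrite expr0 mulr1.
  by rewrite lerXn2r // ?nnegrE ?normc_ge0 // ltW.
apply: le_Rintegral => //.
by move=> p [Dp rp]; rewrite expr0 exprn_ile1 ?normc_ge0 // ltW.
Qed.

(** Dividing [moment_bounds] by 1 - r^2 and writing x = r^2 and A for the area gives x^n A <= (1 + x
    + ... + x^n) moment n <= A. The sum lies between (n+1) x^n and n+1, and x -> 1 yields both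
    inequalities. The area itself stays a symbol. *)
Lemma momentE n : n.+1%:R * moment n = area0.
Proof.
have A0 := @area0_ge0 R.
have m0 : 0 <= moment n by apply: Rintegral_ge0 => p _; rewrite exprn_ge0// normc_ge0.
have fac (r : R) : 1 - r ^+ (2 * n.+1) = (1 - r ^+ 2) * \sum_(i < n.+1) (r ^+ 2) ^+ i.
  by rewrite exprM -{1}(expr1n R n.+1) subrXX; under eq_bigr do rewrite expr1n mul1r.
have key (x : R) : 0 < x -> x < 1 ->
    x ^+ n * area0 <= (\sum_(i < n.+1) x ^+ i) * moment n <= area0.
  move=> x0 x1.
  have s0 : 0 < Num.sqrt x by rewrite sqrtr_gt0.
  have s1 : Num.sqrt x < 1 by rewrite -sqrtr1 ltr_sqrt.
  have := moment_bounds n s0 s1; rewrite fac exprM sqr_sqrtr ?(ltW x0)//.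
  have x1' : 0 < 1 - x by rewrite subr_gt0.
  by rewrite mulrCA -mulrA !ler_pM2l.
have key1 (x : R) : 0 < x -> x < 1 -> x ^+ n * area0 <= n.+1%:R * moment n.
  move=> x0 x1; have /andP[h _] := key x x0 x1; apply: (le_trans h).
  apply: ler_wpM2r => //; rewrite -[n.+1 in leRHS]card_ord -sumr_const.
  by apply: ler_sum => i _; rewrite exprn_ile1// ltW.
have key2 (x : R) : 0 < x -> x < 1 -> x ^+ n * (n.+1%:R * moment n) <= area0.
  move=> x0 x1; have /andP[_ h] := key x x0 x1; apply: (le_trans _ h).
  rewrite mulrA; apply: ler_wpM2r => //.
  rewrite mulr_natr -[n.+1 in leLHS]card_ord -sumr_const.
  by apply: ler_sum => i _; rewrite ler_wiXn2l ?(ltW x0) ?(ltW x1)// -ltnS.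
have lim (a b : R) : (forall x : R, 0 < x -> x < 1 -> x ^+ n * a <= b) -> a <= b.
  move=> H.
  have c1 : x ^+ n * a @[x --> 1^'-] --> 1 ^+ n * a.
    apply: cvg_at_left_filter; apply: cvgM; last exact: cvg_cst.
    exact: exprn_continuous.
  rewrite expr1n mul1r in c1.
  apply: (ler_cvg_to c1 (cvg_cst b)); near=> x.
  by apply: H; near: x; [apply: nbhs_left_gt|apply: nbhs_left_lt].
by apply/eqP; rewrite eq_le !lim.
Unshelve. all: by end_near. Qed.

Lemma area0_gt0 : 0 < area0.
Proof.
rewrite /area0 fine_gt0// area_Dm_lty andbT.
apply: (@lt_le_trans _ _ (area (`[0%R, 2^-1%R]%classic `*` `[0%R, 2^-1%R]%classic))).
  have -> : area (`[0%R, 2^-1%R]%classic `*` `[0%R, 2^-1%R]%classic) =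
    (lebesgue_measure (`[0, 2^-1]%classic : set R)%R * lebesgue_measure (`[0, 2^-1]%classic : set R)%R)%E.
    exact: product_measure1E.
  rewrite !lebesgue_measure_itv/= lte_fin invr_gt0 ltr0n -EFinD -EFinM lte_fin.
  by rewrite subr0 mulr_gt0.
apply: le_measure; rewrite ?inE; [exact: measurableX|exact: measurable_Dm|].
move=> [x y] /= []; rewrite !in_itv /= => /andP[x0 x1] /andP[y0 y1].
rewrite /disc /= -[ltRHS]sqrtr1 ltr_sqrt//.
have : x ^+ 2 <= 2^-1 ^+ 2 by rewrite ler_pXn2r// nnegrE.
have : y ^+ 2 <= 2^-1 ^+ 2 by rewrite ler_pXn2r// nnegrE.
by rewrite /to_complex /=; lra.
Qed.

Lemma moment_eq n : moment n = area0 / n.+1%:R.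
Proof. by rewrite -(momentE n) mulrC mulKf. Qed.

Lemma moment_gt0 n : 0 < moment n.
Proof. by rewrite moment_eq divr_gt0// area0_gt0. Qed.

(* (3 + 4i)^k is congruent to 3 + 4i modulo 5, so (3 + 4i)/5 is a point of the
   unit circle which is not a root of unity. *)
Lemma pythagorean_powE k : exists a b : int,
  ((3%:R +i* 4%:R : C) ^+ k.+1 = (3 + 5 * a)%:~R +i* (4 + 5 * b)%:~R).
Proof.
elim: k => [|k [a [b IH]]].
  by exists 0, 0; rewrite expr1 mulr0 !addr0.
exists (3 * a - 4 * b - 2), (4 * a + 3 * b + 4).
rewrite exprS IH; simpc; congr (_ +i* _); rewrite !(rmorphD, rmorphB, rmorphM) /=;
  by ring.
Qed.

Lemma unit_not_root_of_unity :
  exists u : C, [/\ modulus u = 1, u != -1 & forall k, u ^+ k.+1 != 1].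
Proof.
pose u : C := (5%:R : R)^-1%:C * (3%:R +i* 4%:R).
have uk k : u ^+ k.+1 != 1.
  apply/eqP => uk1; have [a [b E]] := pythagorean_powE k.
  (* If u^(k+1) = 1, this power of 3 + 4i is the real number 5^(k+1), whereas its imaginary part is
     4 modulo 5. *)
  have : complex.Im ((3%:R +i* 4%:R : C) ^+ k.+1) = 0.
    have -> : (3%:R +i* 4%:R : C) = (5%:R : R)%:C * u.
      by rewrite /u mulrA -rmorphM mulfV ?mul1r.
    by rewrite exprMn uk1 mulr1 -rmorphXn.
  rewrite E /= => /eqP; rewrite intr_eq0 => /eqP; lia.
exists u; split => //.
  rewrite /u Normc.normcM normc_real ger0_norm//=.
  have -> : (3%:R ^+ 2 + 4%:R ^+ 2 : R) = 5%:R ^+ 2 by ring.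
  by rewrite sqrtr_sqr ger0_norm// mulVf.
apply: contra (uk 1) => /eqP ->; by rewrite sqrrN expr1n.
Qed.

Lemma bm_monomial n m : bm (fun z : C => z ^+ n * (conjc z) ^+ m).
Proof. by apply: bmM; apply: bmX; [exact: bm_id|apply: bm_conj; exact: bm_id]. Qed.

(** Rotation by the u of [unit_not_root_of_unity] multiplies the integral by u^(n-m), which differs
    from 1 unless n = m. This takes the place of polar coordinates. *)
Lemma aint_monomial n m :
  I (fun z => z ^+ n * (conjc z) ^+ m) = if n == m then (moment n)%:C else 0.
Proof.
have [u [u1 uN1 uk]] := unit_not_root_of_unity.
have uJ : u * conjc u = 1 by rewrite mulcJ u1 expr1n.
have H : I (fun z => z ^+ n * (conjc z) ^+ m) =
    u ^+ n * (conjc u) ^+ m * I (fun z => z ^+ n * (conjc z) ^+ m).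
  rewrite -{1}(aint_rot u1 uN1 (bm_monomial n m)) -aintZ; last exact: bm_monomial.
  by apply: eq_aint => z _; rewrite rmorphM !exprMn mulrACA.
case: eqP => [->|/eqP nm].
  rewrite /area_integral /moment; congr (_ +i* _).
    by apply: eq_Rintegral => p _; rewrite -exprMn mulcJ -rmorphXn -exprM.
  rewrite (_ : (fun p => _) = fun=> 0) ?Rintegral_cst ?mul0r//; last first.
    by apply/funext => p; rewrite -exprMn mulcJ -rmorphXn.
  exact: measurable_Dm.
have u0 : u != 0 by rewrite -normc_eq0 u1 oner_eq0.
suff un1 : u ^+ n * (conjc u) ^+ m != 1.
  have /eqP : (1 - u ^+ n * (conjc u) ^+ m) * I (fun z => z ^+ n * (conjc z) ^+ m) = 0.
    by rewrite mulrBl mul1r -H subrr.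
  by rewrite mulf_eq0 subr_eq0 eq_sym (negbTE un1) => /eqP.
have uV : conjc u = u^-1 by rewrite -[LHS]mul1r -(mulVf u0) -mulrA uJ mulr1.
rewrite uV exprVn; apply/eqP => un; have E : u ^+ n = u ^+ m.
  by rewrite -[LHS]mulr1 -(mulVf (expf_neq0 m u0)) mulrA un mul1r.
case: (ltngtP n m) nm => // lt_nm _.
  have /eqP := uk (m - n).-1; apply; apply: (mulfI (expf_neq0 n u0)).
  by rewrite mulr1 -exprD prednK ?subn_gt0// subnKC ?(ltnW lt_nm)// E.
have /eqP := uk (n - m).-1; apply; apply: (mulfI (expf_neq0 m u0)).
by rewrite mulr1 -exprD prednK ?subn_gt0// subnKC ?(ltnW lt_nm)// E.
Qed.

End moments.

(** * Complex derivatives and power series *)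

Section complex_derivative.
Context {R : realType}.
Local Notation C := (Cplx R).
Local Notation modulus := (@Normc.normc R).

(** First order expansion with real radii and without division, so that h = 0 is allowed; [cderivP]
    identifies it with differentiability in the sense of [analytic_disc]. *)
Definition cderiv (f : C -> C) (z d : C) : Prop :=
  forall e : R, 0 < e -> exists2 dl : R, 0 < dl &
    forall h : C, modulus h < dl ->
      modulus (f (z + h) - f z - h * d) <= e * modulus h.

Lemma gt0_complexP (e : R[i]) : 0 < e -> exists2 r : R, 0 < r & e = r%:C.
Proof.
by case: e => a b; rewrite ltcE /= => /andP[/eqP -> a0]; exists a.
Qed.

(** Balls in [R[i]] have complex radii; a positive one is real by [gt0_complexP]. *)
Lemma nbhs_modulusP (z : C) (A : set C) :
  nbhs z A <-> exists2 e : R, 0 < e & forall w, modulus (w - z) < e -> A w.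
Proof.
split.
  move=> /nbhs_ballP[e /= /gt0_complexP[r r0 ->] H]; exists r => // w wz.
  by apply: H; rewrite /ball/= normc_norm normc_distC ltcR.
move=> [e e0 H]; apply/nbhs_ballP; exists e%:C; first by rewrite /= ltcR.
move=> w; rewrite /ball /= => wz; apply: H; rewrite -ltcR normc_distC.
by rewrite -normc_norm.
Qed.

Lemma cderiv_cvg (f : C -> C) (z d : C) : cderiv f z d <->
  h^-1 *: (f (h *: 1 + z) - f z) @[h --> (0 : C)^'] --> d.
Proof.
split=> [fd|].
  move=> A /nbhs_modulusP[e e0 eA].
  have e20 : 0 < e / 2 by rewrite divr_gt0.
  have [dl dl0 H] := fd _ e20.
  suff : nbhs (0 : C)  (fun h => h != 0 -> A (h^-1 *: (f (h *: 1 + z) - f z))) by [].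
  apply/nbhs_modulusP; exists dl => // h; rewrite subr0 => hdl h0.
  apply: eA; have := H _ hdl.
  have hm : 0 < modulus h by rewrite normc_gt0.
  have -> : h^-1 *: (f (h *: 1 + z) - f z) - d = h^-1 * (f (z + h) - f z - h * d).
    rewrite -[_ *: _]/(h^-1 * _) -[h *: 1]/(h * 1) mulr1 [h + z]addrC.
    by rewrite [RHS]mulrBr mulrA mulVf// mul1r.
  rewrite Normc.normcM Normc.normcV => le1.
  rewrite mulrC ltr_pdivrMr// (le_lt_trans le1)// ltr_pM2r//.
  by rewrite ltr_pdivrMr// ltr_pMr// ltr1n.
move=> fd e e0.
have : nbhs d [set w : C | modulus (w - d) < e] by apply/nbhs_modulusP; exists e.
move=> /fd.
rewrite -[X in X -> _]/(nbhs (0 : C) (fun h => h != 0 ->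
   modulus (h^-1 *: (f (h *: 1 + z) - f z) - d) < e)).
move=> /nbhs_modulusP[dl dl0 H]; exists dl => // h hdl.
have [->|h0] := eqVneq h 0; first by rewrite addr0 subrr mul0r subr0 Normc.normc0 mulr0.
have := H h; rewrite subr0 => /(_ hdl h0).
have hm : 0 < modulus h by rewrite normc_gt0.
have -> : h^-1 *: (f (h *: 1 + z) - f z) - d = h^-1 * (f (z + h) - f z - h * d).
  rewrite -[_ *: _]/(h^-1 * _) -[h *: 1]/(h * 1) mulr1 [h + z]addrC.
  by rewrite [RHS]mulrBr mulrA mulVf// mul1r.
rewrite Normc.normcM Normc.normcV => /ltW le1.
by rewrite mulrC ler_pdivrMr// in le1.
Qed.

Lemma cderivP (f : C -> C) (z d : C) : cderiv f z d <->
  derivable f z 1 /\ derive1 f z = d.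
Proof.
rewrite cderiv_cvg; split.
  move=> fd; have dv : derivable f z 1 by apply/cvg_ex; exists d.
  split; first exact: dv.
  have hC : hausdorff_space C by exact: norm_hausdorff.
  rewrite derive1E.
  exact: (cvg_lim hC fd).
move=> [dv]. rewrite derive1E => <-. exact: dv.
Qed.

End complex_derivative.

(** * Complex series *)

Section complex_series.
Context {R : realType}.
Local Notation C := (Cplx R).
Local Notation modulus := (@Normc.normc R).
Implicit Types (u v : nat -> C) (s t : C).

Definition csum_to u s : Prop :=
  forall e : R, 0 < e -> exists n0, forall n, (n0 <= n)%N ->
    modulus (\sum_(k < n) u k - s) <= e.

Definition asum u (B : R) : Prop := forall n, \sum_(k < n) modulus (u k) <= B.

Lemma real_abs_series_cvg (v : nat -> R) (B : R) :
  (forall n, \sum_(k < n) `|v k| <= B) ->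
  exists s : R, forall e : R, 0 < e -> exists n0, forall n, (n0 <= n)%N ->
    `|\sum_(k < n) v k - s| <= e.
Proof.
move=> vB; have : cvgn (series v).
  apply: normed_cvg; apply: nondecreasing_is_cvgn.
    apply/nondecreasing_seqP => n; rewrite /normed_series_of /= /series /=.
    by rewrite big_nat_recr//= lerDl.
  exists B => _ [n _ <-]; suff : \sum_(0 <= k < n) `|v k| <= B by [].
  by rewrite big_mkord; exact: vB.
move=> /cvg_ex[s /cvgrPdist_le sv]; exists s => e e0.
have [n0 _ H] := sv _ e0; exists n0 => n nn; have := H _ nn.
by rewrite /= /series /= big_mkord distrC.
Qed.

Lemma csum_to_ex u B : asum u B -> exists s, csum_to u s.
Proof.
move=> uB.
have [|a Ha] := @real_abs_series_cvg (fun k => complex.Re (u k)) B.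
  by move=> n; rewrite (le_trans _ (uB n))// ler_sum// => i _; exact: normr_Re_le.
have [|b Hb] := @real_abs_series_cvg (fun k => complex.Im (u k)) B.
  by move=> n; rewrite (le_trans _ (uB n))// ler_sum// => i _; exact: normr_Im_le.
have E n : \sum_(k < n) u k =
    (\sum_(k < n) complex.Re (u k)) +i* (\sum_(k < n) complex.Im (u k)).
  elim: n => [|n IH]; first by rewrite !big_ord0.
  by rewrite !big_ord_recr /= IH; case: (u n) => x y; simpc.
exists (a +i* b) => e e0; have e20 : 0 < e / 2 by rewrite divr_gt0.
have [n1 H1] := Ha _ e20; have [n2 H2] := Hb _ e20.
exists (maxn n1 n2) => n; rewrite geq_max => /andP[nn1 nn2].
rewrite E (le_trans (normc_le_ReIm _))//= (splitr e) lerD ?H1 ?H2//.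
Qed.

Lemma le0_of_all_le (x : R) : (forall e : R, 0 < e -> x <= e) -> x <= 0.
Proof. by move=> H; apply/ler_addgt0Pr => e e0; rewrite add0r H. Qed.

Lemma csum_to_unique u s t : csum_to u s -> csum_to u t -> s = t.
Proof.
move=> us ut; apply/eqP; rewrite -subr_eq0 -normc_eq0 eq_le normc_ge0 andbT.
apply: le0_of_all_le => e e0; have e20 : 0 < e / 2 by rewrite divr_gt0.
have [n1 H1] := us _ e20; have [n2 H2] := ut _ e20.
have {}H1 := H1 _ (leq_maxl n1 n2); have {}H2 := H2 _ (leq_maxr n1 n2).
set S := \sum_(k < _) _ in H1 H2.
rewrite -(subrK S s) -addrA (le_trans (normcD _ _))// (splitr e).
by rewrite lerD// normc_distC.
Qed.

Lemma csum_toD u v s t : csum_to u s -> csum_to v t ->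
  csum_to (fun k => u k + v k) (s + t).
Proof.
move=> us vt e e0; have e20 : 0 < e / 2 by rewrite divr_gt0.
have [n1 H1] := us _ e20; have [n2 H2] := vt _ e20.
exists (maxn n1 n2) => n; rewrite geq_max => /andP[nn1 nn2].
rewrite big_split /= opprD addrACA (le_trans (normcD _ _))// (splitr e).
by rewrite lerD ?H1 ?H2.
Qed.

Lemma csum_toZ (c : C) u s : csum_to u s -> csum_to (fun k => c * u k) (c * s).
Proof.
move=> us e e0; have c1 : 0 < modulus c + 1 by rewrite ltr_wpDl// normc_ge0.
have [n0 H] := us _ (divr_gt0 e0 c1); exists n0 => n /H.
rewrite -mulr_sumr -mulrBr Normc.normcM ler_pdivlMr// => h.
rewrite (le_trans _ h)// mulrC; apply: ler_wpM2l; first exact: normc_ge0.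
by rewrite lerDl.
Qed.

Lemma csum_toN u s : csum_to u s -> csum_to (fun k => - u k) (- s).
Proof.
move=> /(csum_toZ (-1)); rewrite mulN1r.
by congr csum_to; apply/funext => k; rewrite mulN1r.
Qed.

Lemma csum_toB u v s t : csum_to u s -> csum_to v t ->
  csum_to (fun k => u k - v k) (s - t).
Proof. by move=> us /csum_toN; exact: csum_toD. Qed.

Lemma csum_to_tail u s B n : csum_to u s ->
  (forall m, \sum_(n <= k < m) modulus (u k) <= B) ->
  modulus (s - \sum_(k < n) u k) <= B.
Proof.
move=> us uB; apply/ler_addgt0Pr => e e0; have [n0 H] := us _ e0.
have {}H := H _ (leq_maxl n0 n); set m := maxn n0 n in H.
have nm : (n <= m)%N by rewrite leq_maxr.
have E : \sum_(k < m) u k = \sum_(k < n) u k + \sum_(n <= k < m) u k.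
  by rewrite -!(big_mkord xpredT u) (big_cat_nat (leq0n n) nm).
rewrite -(subrK (\sum_(k < m) u k) s) -addrA (le_trans (normcD _ _))// [leLHS]addrC lerD//.
  by rewrite E addrAC subrr add0r (le_trans (normc_sum _ _ _))// uB.
by rewrite normc_distC.
Qed.

Lemma csum_to_le u s B : csum_to u s -> asum u B -> modulus s <= B.
Proof.
move=> us uB; have := @csum_to_tail u s B 0 us.
by rewrite big_ord0 subr0; apply => m; rewrite big_mkord.
Qed.

Lemma csum_toS u s : csum_to (fun k => u k.+1) s -> csum_to u (u 0%N + s).
Proof.
move=> us e e0; have [n0 H] := us _ e0; exists n0.+1 => -[//|n] nn.
by rewrite big_ord_recl /= opprD addrACA subrr add0r; apply: H.
Qed.

Lemma csum_toS_inv u s : csum_to u s -> csum_to (fun k => u k.+1) (s - u 0%N).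
Proof.
move=> us e e0; have [n0 H] := us _ e0; exists n0 => n nn.
have := H n.+1; rewrite big_ord_recl /= opprB addrCA addrA; apply.
exact: leqW.
Qed.

Lemma csum_to_fin u (m : nat) : (forall k, (m <= k)%N -> u k = 0) ->
  csum_to u (\sum_(k < m) u k).
Proof.
move=> u0 e e0; exists m => n mn.
rewrite -!(big_mkord xpredT u) (big_cat_nat (leq0n m) mn)//= addrAC subrr add0r.
rewrite big_nat big1 ?Normc.normc0 ?ltW//.
by move=> k /andP[mk _]; exact: u0.
Qed.

End complex_series.

(** * Power series on the disc and their derivatives *)

Section power_series.
Context {R : realType}.
Local Notation C := (Cplx R).
Local Notation modulus := (@Normc.normc R).
Implicit Types (a b : nat -> C) (z : C).

(* The radius of convergence of sum_n a_n z^n is at least 1. *)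
Definition tame a : Prop :=
  forall r : R, 0 <= r -> r < 1 -> exists M, forall n, modulus (a n) * r ^+ n <= M.

Lemma geometric_sum_le (q : R) n : 0 <= q -> q < 1 ->
  \sum_(k < n) q ^+ k <= (1 - q)^-1.
Proof.
move=> q0 q1; have q1' : 0 < 1 - q by rewrite subr_gt0.
rewrite -[leRHS]mul1r ler_pdivlMr// mulrC.
have : 1 - q ^+ n = (1 - q) * \sum_(k < n) q ^+ k.
  by rewrite -{1}(expr1n R n) subrXX; under eq_bigr do rewrite expr1n mul1r.
by move=> <-; rewrite lerBlDr lerDl exprn_ge0.
Qed.

Lemma natmul_geometric_le (q : R) n : 0 <= q -> q < 1 ->
  n%:R * q ^+ n <= (1 - q)^-1.
Proof.
move=> q0 q1; apply: le_trans (geometric_sum_le n q0 q1).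
rewrite mulrC mulr_natr -[X in _ *+ X]card_ord -sumr_const.
by apply: ler_sum => i _; rewrite ler_wiXn2l ?(ltW q1)// ltnW.
Qed.

(** The terms are bounded at the midpoint r' of r and 1, hence dominated at r by a geometric series
    of ratio r / r'. The same midpoint serves in the lemmas on [tame] below. *)
Lemma tame_sum_le a (r : R) : tame a -> 0 <= r -> r < 1 ->
  exists B, forall n, \sum_(k < n) modulus (a k) * r ^+ k <= B.
Proof.
move=> ta r0 r1; pose r' := (1 + r) / 2.
have rr' : r < r' by rewrite /r'; lra.
have r'0 : 0 < r' by exact: le_lt_trans rr'.
have r'1 : r' < 1 by rewrite /r'; lra.
have [M HM] := ta r' (ltW r'0) r'1.
have q0 : 0 <= r / r' by rewrite divr_ge0// ltW.
have q1 : r / r' < 1 by rewrite ltr_pdivrMr// mul1r.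
have M0 : 0 <= M by apply: le_trans (HM 0%N); rewrite mulr_ge0// normc_ge0.
exists (M * (1 - r / r')^-1) => n.
apply: (@le_trans _ _ (M * \sum_(k < n) (r / r') ^+ k)); last first.
  by rewrite ler_wpM2l// geometric_sum_le.
rewrite mulr_sumr; apply: ler_sum => i _.
have -> : modulus (a i) * r ^+ i = (modulus (a i) * r' ^+ i) * (r / r') ^+ i.
  by rewrite -mulrA -exprMn mulrCA mulfV ?mulr1// gt_eqF.
by rewrite ler_wpM2r// exprn_ge0.
Qed.

Lemma tame_natmul a : tame a -> tame (fun n => n%:R * a n).
Proof.
move=> ta r r0 r1; pose r' := (1 + r) / 2.
have rr' : r < r' by rewrite /r'; lra.
have r'0 : 0 < r' by exact: le_lt_trans rr'.
have r'1 : r' < 1 by rewrite /r'; lra.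
have [M HM] := ta r' (ltW r'0) r'1.
have q0 : 0 <= r / r' by rewrite divr_ge0// ltW.
have q1 : r / r' < 1 by rewrite ltr_pdivrMr// mul1r.
exists (M * (1 - r / r')^-1) => n.
have -> : modulus (n%:R * a n) * r ^+ n =
    (modulus (a n) * r' ^+ n) * (n%:R * (r / r') ^+ n).
  have -> : modulus (n%:R * a n) = n%:R * modulus (a n).
    rewrite Normc.normcM -(rmorph_nat (real_complex R)) normc_real.
    by rewrite ger0_norm.
  have -> : r ^+ n = r' ^+ n * (r / r') ^+ n.
    by rewrite -exprMn mulrCA mulfV ?mulr1// gt_eqF.
  by ring.
rewrite ler_pM ?mulr_ge0 ?normc_ge0 ?exprn_ge0 ?(ltW r'0)//.
exact: natmul_geometric_le.
Qed.

Lemma modulus_nat n : modulus (n%:R : C) = n%:R.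
Proof. by rewrite -(rmorph_nat (real_complex R)) normc_real ger0_norm. Qed.

Lemma tameD a b : tame a -> tame b -> tame (fun n => a n + b n).
Proof.
move=> ta tb r r0 r1; have [M HM] := ta r r0 r1; have [N HN] := tb r r0 r1.
exists (M + N) => n; rewrite (le_trans _ (lerD (HM n) (HN n)))// -mulrDl.
by rewrite ler_wpM2r ?exprn_ge0// normcD.
Qed.

Lemma tameZ (c : C) a : tame a -> tame (fun n => c * a n).
Proof.
move=> ta r r0 r1; have [M HM] := ta r r0 r1.
exists (modulus c * M) => n; rewrite Normc.normcM -mulrA ler_wpM2l ?normc_ge0//.
Qed.

Lemma tame_bounded a (M : R) : (forall n, modulus (a n) <= M) -> tame a.
Proof.
move=> aM r r0 r1; exists M => n; rewrite -[leRHS]mulr1.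
by rewrite ler_pM ?normc_ge0 ?exprn_ge0// exprn_ile1// ltW.
Qed.

Lemma tame_shift a m : tame a -> tame (fun n => a (n + m)%N).
Proof.
move=> ta r r0 r1; pose r' := (1 + r) / 2.
have rr' : r < r' by rewrite /r'; lra.
have r'0 : 0 < r' by exact: le_lt_trans rr'.
have r'1 : r' < 1 by rewrite /r'; lra.
have [M HM] := ta r' (ltW r'0) r'1.
exists (M / r' ^+ m) => n; rewrite ler_pdivlMr ?exprn_gt0//.
apply: le_trans (HM (n + m)%N); rewrite -mulrA ler_wpM2l ?normc_ge0// exprD.
by rewrite ler_wpM2r ?exprn_ge0 ?(ltW r'0)// lerXn2r ?nnegrE ?(ltW r'0) ?(ltW rr').
Qed.

Lemma tame_cons (c : C) a : tame a -> tame (fun n => if n is m.+1 then a m else c).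
Proof.
move=> ta r r0 r1; have [M HM] := ta r r0 r1.
exists (Num.max (modulus c) M) => -[|n]; first by rewrite expr0 mulr1 le_max lexx.
rewrite le_max; apply/orP; right; apply: le_trans (HM n).
by rewrite exprS mulrCA ler_piMl ?(ltW r1)// mulr_ge0 ?normc_ge0// exprn_ge0.
Qed.

(* Extended by zero off the disc, as required by [analytic_disc]. *)
Definition psum a z : C :=
  if modulus z < 1 then xget 0 [set s | csum_to (fun n => a n * z ^+ n) s] else 0.

Lemma psum_out a z : ~ disc z -> psum a z = 0.
Proof. by rewrite /disc /= /psum; case: ifP. Qed.

Lemma tame_asum a z : tame a -> disc z -> exists B, asum (fun n => a n * z ^+ n) B.
Proof.
move=> ta z1; have [B HB] := tame_sum_le ta (normc_ge0 z) z1; exists B => n.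
by rewrite (le_trans _ (HB n))//; apply: ler_sum => k _; rewrite Normc.normcM normcX.
Qed.

Lemma psumP a z : tame a -> disc z -> csum_to (fun n => a n * z ^+ n) (psum a z).
Proof.
move=> ta z1; have [B HB] := tame_asum ta z1.
have [s Hs] := csum_to_ex HB.
by rewrite /psum ifT//; apply: (@xgetPex _ 0 [set s | csum_to (fun n => a n * z ^+ n) s]); exists s.
Qed.

Lemma psumE a z s : disc z -> csum_to (fun n => a n * z ^+ n) s -> psum a z = s.
Proof.
move=> z1 Hs; apply: (@csum_to_unique _ (fun n => a n * z ^+ n)) => //.
by rewrite /psum ifT//; apply: (@xgetPex _ 0 [set s | csum_to (fun n => a n * z ^+ n) s]); exists s.
Qed.

Lemma psum_le a z B : tame a -> disc z ->
  (forall n, \sum_(k < n) modulus (a k) * modulus z ^+ k <= B) -> modulus (psum a z) <= B.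
Proof.
move=> ta z1 HB; apply: (csum_to_le (psumP ta z1)) => n.
by rewrite (le_trans _ (HB n))//; apply: ler_sum => k _; rewrite Normc.normcM normcX.
Qed.

Lemma psumD a b z : tame a -> tame b ->
  psum (fun n => a n + b n) z = psum a z + psum b z.
Proof.
move=> ta tb; have [z1|z1] := pselect (disc z); last by rewrite !psum_out// addr0.
apply: psumE => //; have := csum_toD (psumP ta z1) (psumP tb z1).
by congr csum_to; apply/funext => n; rewrite mulrDl.
Qed.

Lemma psumZ (c : C) a z : tame a -> psum (fun n => c * a n) z = c * psum a z.
Proof.
move=> ta; have [z1|z1] := pselect (disc z); last by rewrite !psum_out// mulr0.
apply: psumE => //; have := csum_toZ c (psumP ta z1).
by congr csum_to; apply/funext => n; rewrite mulrA.
Qed.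

Lemma psum_cons (c : C) a z : tame a -> disc z ->
  psum (fun n => if n is m.+1 then a m else c) z = c + z * psum a z.
Proof.
move=> ta z1; apply: psumE => //.
have := csum_toS (u := fun n => (if n is m.+1 then a m else c) * z ^+ n)
  (s := z * psum a z); rewrite expr0 mulr1; apply.
have := csum_toZ z (psumP ta z1); congr csum_to; apply/funext => n.
by rewrite exprS mulrCA.
Qed.

(** Induction on n: the remainder for n+1 is (z + h) times the remainder for n, plus n h^2 z^(n-1).
    The bound is n^2 r^(n-2) |h|^2, with r^n / r^2 in place of a truncated exponent. *)
Lemma expr_taylor_le (z h : C) (r : R) n : 0 < r -> modulus z <= r -> modulus (z + h) <= r ->
  modulus ((z + h) ^+ n - z ^+ n - h * (n%:R * z ^+ n.-1)) <=
  modulus h ^+ 2 * (n%:R * (n%:R * r ^+ n)) / r ^+ 2.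
Proof.
move=> r0 zr zhr; have r20 : 0 < r ^+ 2 by rewrite exprn_gt0.
have h0 : 0 <= modulus h by exact: normc_ge0.
rewrite ler_pdivlMr//; elim: n => [|n IH].
  by rewrite !expr0 subrr !mul0r mulr0 subrr Normc.normc0 mul0r mulr0.
have -> : (z + h) ^+ n.+1 - z ^+ n.+1 - h * (n.+1%:R * z ^+ n.+1.-1) =
   (z + h) * ((z + h) ^+ n - z ^+ n - h * (n%:R * z ^+ n.-1)) + h ^+ 2 * (n%:R * z ^+ n.-1).
  case: n {IH} => [|n]; first by rewrite !expr1 !expr0; ring.
  by rewrite /= !exprS -!natr1; ring.
apply: (@le_trans _ _ (r * (modulus h ^+ 2 * (n%:R * (n%:R * r ^+ n))) +
   modulus h ^+ 2 * (n%:R * r ^+ n.+1))).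
  rewrite (le_trans (ler_wpM2r (ltW r20) (normcD _ _)))// mulrDl lerD//.
    by rewrite Normc.normcM -mulrA ler_pM ?normc_ge0// mulr_ge0 ?normc_ge0// ltW.
  rewrite Normc.normcM normcX -mulrA ler_wpM2l ?exprn_ge0// Normc.normcM modulus_nat -mulrA.
  case: n {IH} => [|n]; first by rewrite !mul0r.
  rewrite ler_wpM2l// normcX /= [r ^+ n.+2](_ : _ = r ^+ n * r ^+ 2); last by rewrite -exprD addn2.
  by rewrite ler_wpM2r ?(ltW r20)// lerXn2r ?nnegrE ?normc_ge0// ltW.
rewrite ![r ^+ n.+1]exprS -!natr1.
have : 0 <= modulus h ^+ 2 * (r * r ^+ n) * (n%:R + 1).
  by rewrite !mulr_ge0 ?exprn_ge0 ?(ltW r0)// addr_ge0.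
move: (modulus h) (r ^+ n) (n%:R : R) => x y t; lra.
Qed.

Definition dcoef a : nat -> C := fun n => n.+1%:R * a n.+1.

Lemma tame_dcoef a : tame a -> tame (dcoef a).
Proof.
move=> ta; have := tame_shift 1 (tame_natmul ta).
by congr tame; apply/funext => n; rewrite addn1.
Qed.

(** Summing [expr_taylor_le] at a radius r between |z| and 1 bounds the remainder by K |h|^2, where
    K r^2 bounds the sum of n^2 |a_n| r^n. *)
Lemma psum_cderiv a z : tame a -> disc z -> cderiv (psum a) z (psum (dcoef a) z).
Proof.
move=> ta z1; pose r := (1 + modulus z) / 2.
have zr : modulus z < r by rewrite /r; move: z1; rewrite /disc /=; lra.
have r0 : 0 < r by rewrite (le_lt_trans _ zr)// normc_ge0.
have r1 : r < 1 by rewrite /r; move: z1; rewrite /disc /=; lra.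
have [B HB] := tame_sum_le (tame_natmul (tame_natmul ta)) (ltW r0) r1.
pose K := B / r ^+ 2.
have K0 : 0 <= K.
  by rewrite divr_ge0// ?sqr_ge0//; have := HB 0%N; rewrite big_ord0.
have D : csum_to (fun n => a n * (n%:R * z ^+ n.-1)) (psum (dcoef a) z).
  have := csum_toS (u := fun n => a n * (n%:R * z ^+ n.-1)) (s := psum (dcoef a) z).
  rewrite mul0r mulr0 add0r; apply.
  have := psumP (tame_dcoef ta) z1; congr csum_to; apply/funext => n.
  by rewrite /dcoef /= mulrAC mulrC mulrA.
move=> e e0; exists (Num.min (r - modulus z) (e / (K + 1))).
  by rewrite lt_min subr_gt0 zr divr_gt0// ltr_wpDl.
move=> h; rewrite lt_min => /andP[hr he].
have zhr : modulus (z + h) <= r.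
  by rewrite (le_trans (normcD _ _))// -lerBrDl ltW.
have zh1 : disc (z + h) by exact: le_lt_trans zhr r1.
have S := csum_toB (csum_toB (psumP ta zh1) (psumP ta z1)) (csum_toZ h D).
have : modulus (psum a (z + h) - psum a z - h * psum (dcoef a) z) <= modulus h ^+ 2 * K.
  apply: (csum_to_le S) => n.
  apply: (@le_trans _ _ (\sum_(k < n) modulus (k%:R * (k%:R * a k)) * r ^+ k * (modulus h ^+ 2 / r ^+ 2))).
    apply: ler_sum => k _.
    have -> : a k * (z + h) ^+ k - a k * z ^+ k - h * (a k * (k%:R * z ^+ k.-1)) =
      a k * ((z + h) ^+ k - z ^+ k - h * (k%:R * z ^+ k.-1)) by ring.
    rewrite Normc.normcM.
    apply: (le_trans (ler_wpM2l (normc_ge0 _) (expr_taylor_le k r0 (ltW zr) zhr))).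
    rewrite !Normc.normcM !modulus_nat le_eqVlt; apply/orP; left; apply/eqP; ring.
  by rewrite -mulr_suml /K [leRHS]mulrCA ler_wpM2r ?divr_ge0 ?sqr_ge0.
move=> H; apply: (le_trans H); rewrite expr2 -mulrA mulrC ler_wpM2r ?normc_ge0//.
rewrite ltr_pdivlMr ?ltr_wpDl// in he.
apply: le_trans (ltW he); rewrite ler_wpM2l ?normc_ge0// lerDl ler01//.
Qed.

End power_series.

(** * The pairing in terms of Taylor coefficients *)

Section pairing_series.
Context {R : realType}.
Local Notation C := (Cplx R).
Local Notation modulus := (@Normc.normc R).
Local Notation I := (@area_integral R).
Local Notation area0 := (@area0 R).
Implicit Types (a b u v : nat -> C) (z : C).

Lemma asum_tail u (B : R) : asum u B -> forall e : R, 0 < e -> exists n0, forall n m,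
  (n0 <= n)%N -> \sum_(n <= k < m) modulus (u k) <= e.
Proof.
move=> uB e e0.
have [|s Hs] := @real_abs_series_cvg _ (fun k => modulus (u k)) B.
  move=> n; apply: le_trans (uB n); apply: ler_sum => k _.
  by rewrite ger0_norm ?normc_ge0.
have e20 : 0 < e / 2 by rewrite divr_gt0.
have [n0 H] := Hs _ e20; exists n0 => n m nn.
have [mn|nm] := leqP m n; first by rewrite big_geq// ltW.
have H1 := H _ nn; have H2 := H _ (leq_trans nn (ltnW nm)).
have -> : \sum_(n <= k < m) modulus (u k) =
    (\sum_(k < m) modulus (u k) - s) - (\sum_(k < n) modulus (u k) - s).
  rewrite -!(big_mkord xpredT (fun k => modulus (u k))).
  by rewrite (big_cat_nat (leq0n n) (ltnW nm))/=; ring.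
rewrite (le_trans (ler_norm _))// (le_trans (ler_normB _ _))// (splitr e).
exact: lerD.
Qed.

Lemma asum_tame u (B : R) : asum u B -> tame u.
Proof.
move=> uB; apply: (@tame_bounded _ _ B) => n; apply: le_trans (uB n.+1).
by rewrite big_ord_recr /= lerDr sumr_ge0// => k _; exact: normc_ge0.
Qed.

Lemma asum_expr u (B : R) z : asum u B -> disc z -> asum (fun n => u n * z ^+ n) B.
Proof.
move=> uB z1 n; apply: le_trans (uB n); apply: ler_sum => k _.
by rewrite Normc.normcM normcX ler_piMr ?normc_ge0// exprn_ile1 ?normc_ge0// ltW.
Qed.

Lemma cderiv_continuous (f : C -> C) z d : cderiv f z d ->
  forall e : R, 0 < e -> exists2 dl : R, 0 < dl &
     forall w, modulus (w - z) < dl -> modulus (f w - f z) < e.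
Proof.
move=> fd e e0; have [dl dl0 H] := fd _ ltr01.
have K0 : 0 < 1 + modulus d by rewrite ltr_pwDl// normc_ge0.
exists (Num.min dl (e / (1 + modulus d))); first by rewrite lt_min dl0 divr_gt0.
move=> w; rewrite lt_min ltr_pdivlMr// => /andP[/H h1 h2].
rewrite (addrC z) subrK mul1r in h1.
apply: le_lt_trans h2; rewrite mulrDr mulr1 -Normc.normcM.
by rewrite -{1}(subrK ((w - z) * d) (f w - f z)) (le_trans (normcD _ _))// lerD2r.
Qed.

Lemma bm_psum u (B : R) : asum u B -> bm (psum u).
Proof.
move=> uB; have tu := asum_tame uB; apply: (@bm_cont _ _ B).
  move=> z z1 e e0; have [dl dl0 H] := cderiv_continuous (psum_cderiv tu z1) e0.
  by exists dl => // w _; exact: H.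
by move=> z z1; apply: csum_to_le (psumP tu z1) (asum_expr uB z1).
Qed.

Lemma bm_poly u n : bm (fun z : C => \sum_(k < n) u k * z ^+ k).
Proof.
apply: (@bm_sum _ 'I_n _ _ (fun (k : 'I_n) z => u k * z ^+ k)) => k.
by apply: bmM; [exact: bm_cst|apply: bmX; exact: bm_id].
Qed.

Lemma aint_poly u v n :
  I (fun z => (\sum_(k < n) u k * z ^+ k) * conjc (\sum_(k < n) v k * z ^+ k)) =
  \sum_(k < n) u k * conjc (v k) * (moment k)%:C.
Proof.
have bmt (c : C) i j : bm (fun z : C => c * (z ^+ i * (conjc z) ^+ j)).
  by apply: bmM; [exact: bm_cst|exact: bm_monomial].
transitivity (I (fun z => \sum_(i < n) \sum_(j < n)
    (u i * conjc (v j)) * (z ^+ i * (conjc z) ^+ j))).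
  apply: eq_aint => z _; rewrite rmorph_sum /= mulr_suml; apply: eq_bigr => i _.
  rewrite mulr_sumr; apply: eq_bigr => j _.
  by rewrite rmorphM /= rmorphXn mulrACA.
rewrite (aint_sum _ _ (F := fun (i : 'I_n) z =>
    \sum_(j < n) (u i * conjc (v j)) * (z ^+ i * (conjc z) ^+ j))).
  apply: eq_bigr => i _.
  rewrite (aint_sum _ _ (F := fun (j : 'I_n) z => (u i * conjc (v j)) * (z ^+ i * (conjc z) ^+ j)))//.
  rewrite (bigD1 i)//= big1 ?addr0.
    by rewrite aintZ ?aint_monomial ?eqxx//; exact: bm_monomial.
  move=> j ji; rewrite aintZ ?aint_monomial; last exact: bm_monomial.
  by rewrite ifF ?mulr0//; apply: contraNF ji => /eqP ij; apply/eqP/val_inj.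
by move=> i; apply: bm_sum.
Qed.

(** With absolutely summable coefficients the Taylor polynomials converge uniformly on the disc, so
    [aint_poly] passes to the limit. *)
Lemma aint_psum u v (A B : R) : asum u A -> asum v B ->
  csum_to (fun n => u n * conjc (v n) * (moment n)%:C)
    (I (fun z => psum u z * conjc (psum v z))).
Proof.
move=> uA vB e e0.
have A0 : 0 <= A by have := uA 0%N; rewrite big_ord0.
have B0 : 0 <= B by have := vB 0%N; rewrite big_ord0.
have a0 := @area0_gt0 R.
pose d := e / (2 * (A + B + 1) * area0).
have AB1 : 0 < A + B + 1 by rewrite ltr_wpDl// addr_ge0.
have d0 : 0 < d by rewrite divr_gt0// mulr_gt0// mulr_gt0.
have [n1 H1] := asum_tail uA d0; have [n2 H2] := asum_tail vB d0.
exists (maxn n1 n2) => n; rewrite geq_max => /andP[nn1 nn2].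
rewrite -aint_poly.
have bU := bm_psum uA; have bV := bm_psum vB.
have bUn := bm_poly u n; have bVn := bm_poly v n.
have bp := bmM bUn (bm_conj bVn); have bq := bmM bU (bm_conj bV).
rewrite -aintB//.
have E : e = 2 * ((A + B + 1) * d) * area0.
  by rewrite /d; field; rewrite !gt_eqF.
rewrite [leRHS]E; apply: aint_bound; first exact: bmB.
move=> z z1.
have tu := asum_tame uA; have tv := asum_tame vB.
set Un := \sum_(k < n) _; set Vn := \sum_(k < n) _.
have hU : modulus (psum u z) <= A by exact: csum_to_le (psumP tu z1) (asum_expr uA z1).
have hVn : modulus Vn <= B.
  by apply: le_trans (normc_sum _ _ _) _; exact: (asum_expr vB z1).
have tl w k m : modulus z < 1 -> \sum_(k <= i < m) modulus (w i * z ^+ i) <= \sum_(k <= i < m) modulus (w i).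
  move=> _; apply: ler_sum => i _.
  by rewrite Normc.normcM normcX ler_piMr ?normc_ge0// exprn_ile1 ?normc_ge0// ltW.
have dU : modulus (psum u z - Un) <= d.
  by apply: (csum_to_tail (psumP tu z1)) => m; apply: le_trans (tl _ _ _ z1) (H1 _ _ nn1).
have dV : modulus (psum v z - Vn) <= d.
  by apply: (csum_to_tail (psumP tv z1)) => m; apply: le_trans (tl _ _ _ z1) (H2 _ _ nn2).
have -> : Un * conjc Vn - psum u z * conjc (psum v z) =
   (Un - psum u z) * conjc Vn + psum u z * conjc (Vn - psum v z).
  by rewrite rmorphB mulrBl mulrBr addrA subrK.
rewrite (le_trans (normcD _ _))// !Normc.normcM !normc_conj.
rewrite normc_distC [X in _ + _ * X]normc_distC.
apply: (@le_trans _ _ (d * B + A * d)).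
  by rewrite lerD// ler_pM ?normc_ge0.
by have := d0; lra.
Qed.

(** Abel's theorem for an absolutely convergent series. From n on, the tail is at most e/2; before
    n, Bernoulli's inequality bounds the change by B * 2n * (1 - r), which determines d. *)
Lemma abel_limit b (B : R) S : asum b B -> csum_to b S ->
  forall e : R, 0 < e -> exists2 d : R, 0 < d & forall r : R, 0 < r -> r < 1 -> 1 - d < r ->
    forall s, csum_to (fun n => b n * (r ^+ (2 * n))%:C) s -> modulus (s - S) <= e.
Proof.
move=> bB bS e e0.
have B0 : 0 <= B by have := bB 0%N; rewrite big_ord0.
have e20 : 0 < e / 2 by rewrite divr_gt0.
have [n Hn] := asum_tail bB e20.
pose K := B * (2 * n)%:R.
have K0 : 0 <= K by rewrite mulr_ge0.
exists (e / 2 / (K + 1)); first by rewrite divr_gt0// ltr_wpDl.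
move=> r r0 r1 rd s Hs.
apply: (csum_to_le (csum_toB Hs bS)) => m.
have bern k : 1 - r ^+ k <= k%:R * (1 - r).
  elim: k => [|k IH]; first by rewrite expr0 subrr mul0r.
  have -> : 1 - r ^+ k.+1 = (1 - r ^+ k) + r ^+ k * (1 - r) by rewrite exprS; ring.
  rewrite -natr1 mulrDl mul1r lerD// ler_piMl ?subr_ge0 ?(ltW r1)//.
  by rewrite exprn_ile1// ltW.
have rk01 k : 0 <= 1 - r ^+ k <= 1.
  by rewrite subr_ge0 exprn_ile1 ?(ltW r0) ?(ltW r1)//= lerBlDl lerDr exprn_ge0// ltW.
have tE k : modulus (b k * (r ^+ (2 * k))%:C - b k) = modulus (b k) * (1 - r ^+ (2 * k)).
  have -> : b k * (r ^+ (2 * k))%:C - b k = - (b k * (1 - r ^+ (2 * k))%:C).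
    by rewrite rmorphB mulrBr mulr1 opprB.
  by rewrite normcN Normc.normcM normc_real ger0_norm//; have /andP[] := rk01 (2 * k)%N.
under eq_bigr => k _ do rewrite tE.
have key : \sum_(k < maxn n m) modulus (b k) * (1 - r ^+ (2 * k)) <= e.
  rewrite -(big_mkord xpredT (fun k => modulus (b k) * (1 - r ^+ (2 * k)))).
  rewrite (big_cat_nat (leq0n n) (leq_maxl n m))/= (splitr e) lerD//.
    apply: (@le_trans _ _ (\sum_(0 <= k < n) modulus (b k) * ((2 * n)%:R * (1 - r)))).
      rewrite big_nat [leRHS]big_nat; apply: ler_sum => k /andP[_ kn].
      rewrite ler_wpM2l ?normc_ge0// (le_trans (bern _))// ler_wpM2r ?subr_ge0 ?(ltW r1)//.
      by rewrite ler_nat leq_mul2l ltnW.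
    rewrite -mulr_suml big_mkord.
    apply: (@le_trans _ _ (B * ((2 * n)%:R * (1 - r)))).
      by rewrite ler_wpM2r// mulr_ge0// subr_ge0 ltW.
    rewrite mulrA -/K; have : 1 - r <= e / 2 / (K + 1) by lra.
    rewrite ler_pdivlMr ?ltr_wpDl// => h; apply: le_trans h.
    by rewrite mulrC ler_wpM2l ?subr_ge0 ?(ltW r1)// lerDl.
  apply: le_trans (Hn n (maxn n m) (leqnn n)); apply: ler_sum => k _.
  by rewrite ler_piMr ?normc_ge0//; have /andP[] := rk01 (2 * k)%N.
apply: le_trans key.
rewrite -!(big_mkord xpredT (fun k => modulus (b k) * (1 - r ^+ (2 * k)))).
rewrite [leRHS](big_cat_nat (leq0n m) (leq_maxr n m))/= lerDl sumr_ge0// => k _.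
by rewrite mulr_ge0 ?normc_ge0//; have /andP[] := rk01 (2 * k)%N.
Qed.

(** For fixed r < 1 the dilated functions have the absolutely summable coefficients a_n r^n and b_n
    r^n, so [aint_psum] applies; [abel_limit] then removes the factor r^(2n). *)
Lemma pairing_psum a b (B : R) S : tame a -> tame b ->
  asum (fun n => a n * conjc (b n) * (moment n)%:C) B ->
  csum_to (fun n => a n * conjc (b n) * (moment n)%:C) S ->
  pairing (psum a) (psum b) = S.
Proof.
move=> ta tb sB hS.
have hr (r : R) : 0 < r -> r < 1 ->
    csum_to (fun n => a n * conjc (b n) * (moment n)%:C * (r ^+ (2 * n))%:C)
     (I (fun z => psum a (r%:C * z) * conjc (psum b (r%:C * z)))).
  move=> r0 r1.
  have ex c : tame c -> exists A : R, asum (fun n => c n * (r ^+ n)%:C) A.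
    move=> tc; have [A HA] := tame_sum_le tc (ltW r0) r1; exists A => n.
    apply: le_trans (HA n); apply: ler_sum => k _.
    by rewrite Normc.normcM normc_real ger0_norm// exprn_ge0// ltW.
  have [A1 hA1] := ex _ ta; have [A2 hA2] := ex _ tb.
  have sc c A z : tame c -> asum (fun n => c n * (r ^+ n)%:C) A -> disc z ->
      psum c (r%:C * z) = psum (fun n => c n * (r ^+ n)%:C) z.
    move=> tc sc z1; apply: psumE.
      rewrite /disc /= Normc.normcM normc_real gtr0_norm//.
      by rewrite (le_lt_trans _ z1)// ler_piMl ?normc_ge0// ltW.
    have -> : (fun n => c n * (r%:C * z) ^+ n) = (fun n => c n * (r ^+ n)%:C * z ^+ n).
      by apply/funext => n; rewrite exprMn rmorphXn mulrA.
    exact: psumP (asum_tame sc) z1.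
  have -> : I (fun z => psum a (r%:C * z) * conjc (psum b (r%:C * z))) =
     I (fun z => psum (fun n => a n * (r ^+ n)%:C) z * conjc (psum (fun n => b n * (r ^+ n)%:C) z)).
    by apply: eq_aint => z z1; rewrite (sc _ _ _ ta hA1 z1) (sc _ _ _ tb hA2 z1).
  have := aint_psum hA1 hA2; congr csum_to; apply/funext => n.
  have -> : conjc (b n * (r ^+ n)%:C) = conjc (b n) * (r ^+ n)%:C.
    by case: (b n) => x y; simpc.
  have -> : (r ^+ (2 * n))%:C = (r ^+ n)%:C * (r ^+ n)%:C.
    by rewrite -rmorphM -exprD addnn mul2n.
  by rewrite mulrACA -!mulrA; congr (_ * (_ * _)); rewrite mulrA mulrC.
rewrite /pairing; apply: cvg_lim; first exact: norm_hausdorff.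
move=> U /nbhs_modulusP[e e0 eU].
have e20 : 0 < e / 2 by rewrite divr_gt0.
have [d d0 Hd] := abel_limit sB hS e20.
suff H : \forall r \near (1 : R)^'-,
    U (I (fun z => psum a (r%:C * z) * conjc (psum b (r%:C * z)))) by exact: H.
near=> r; apply: eU; apply: (@le_lt_trans _ _ (e / 2)); last by rewrite ltr_pdivrMr// ltr_pMr// ltr1n.
have r0 : 0 < r by near: r; apply: nbhs_left_gt; exact: ltr01.
have r1 : r < 1 by near: r; exact: nbhs_left_lt.
apply: (Hd r r0 r1) (hr r r0 r1).
by near: r; apply: nbhs_left_gt; rewrite ltrBlDr ltrDl.
Unshelve. all: by end_near. Qed.

End pairing_series.

(** * Mean value inequality and Lipschitz bounds for Bloch functions *)

Section bloch_calculus.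
Context {R : realType}.
Local Notation C := (Cplx R).
Local Notation modulus := (@Normc.normc R).
Implicit Types (f : C -> C) (z w : C).

(** For each e > 0, consider the t with |phi t - phi a| <= (L + e)(t - a). The local hypothesis at
    the supremum c of these t shows that c is one of them, and that a point beyond c would be
    another if c < b. *)
Lemma mean_value_ineq (phi : R -> C) (a b L : R) : a <= b -> 0 <= L ->
  (forall t, a <= t <= b -> forall e : R, 0 < e -> exists2 d : R, 0 < d &
     forall h, `|h| < d -> a <= t + h <= b ->
       modulus (phi (t + h) - phi t) <= (L + e) * `|h|) ->
  modulus (phi b - phi a) <= L * (b - a).
Proof.
move=> ab L0 H.
suff K (e : R) : 0 < e -> modulus (phi b - phi a) <= (L + e) * (b - a).
  apply/ler_addgt0Pr => e e0; have ba : 0 < b - a + 1 by rewrite ltr_wpDl// subr_ge0.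
  apply: (le_trans (K _ (divr_gt0 e0 ba))); rewrite mulrDl lerD2l.
  by rewrite mulrAC ler_pdivrMr// ler_wpM2l ?(ltW e0)// lerDl.
move=> e0.
pose S : set R := [set t | a <= t <= b /\ modulus (phi t - phi a) <= (L + e) * (t - a)].
have Sa : S a by split; rewrite ?lexx ?ab// !subrr Normc.normc0 mulr0.
have ubS : ubound S b by move=> t [/andP[_ tb] _].
have hS : has_sup S by split; [exists a|exists b].
pose c := sup S.
have ac : a <= c by apply: ub_le_sup => //; exists b.
have cb : c <= b by apply: sup_le_ub => //; exists a.
have Le0 : 0 <= L + e by rewrite addr_ge0// ltW.
have [|d d0 Hd] := H c _ _ e0; first by rewrite ac.
have Sc : modulus (phi c - phi a) <= (L + e) * (c - a).
  have [t [/andP[at_ tb] St] ct] := sup_adherent d0 hS.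
  have tc : t <= c by apply: ub_le_sup; [exists b|split => //; rewrite at_].
  have nt : `|t - c| = c - t by rewrite distrC ger0_norm ?subr_ge0.
  have h1 := Hd (t - c); rewrite (addrC c) subrK at_ tb nt in h1.
  rewrite -(subrK (phi t) (phi c)) -addrA (le_trans (normcD _ _))//.
  have -> : (L + e) * (c - a) = (L + e) * (c - t) + (L + e) * (t - a) by ring.
  apply: lerD => //; rewrite normc_distC; apply: h1 => //.
  by rewrite ltrBlDr addrC -ltrBlDr.
have [bc|] := leP b c; first by have <- : c = b by apply/le_anti; rewrite cb.
move=> cltb; exfalso.
pose h := Num.min (d / 2) (b - c).
have h0 : 0 < h by rewrite lt_min divr_gt0//= subr_gt0.
have hd : h < d by rewrite gt_min; apply/orP; left; rewrite ltr_pdivrMr// ltr_pMr// ltr1n.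
have hbc : h <= b - c by rewrite ge_min lexx orbT.
have : S (c + h).
  split; first by apply/andP; split; lra.
  have := Hd h; rewrite gtr0_norm// => /(_ hd) h1.
  rewrite -(subrK (phi c) (phi (c + h))) -addrA (le_trans (normcD _ _))//.
  have -> : (L + e) * (c + h - a) = (L + e) * h + (L + e) * (c - a) by ring.
  by apply: lerD => //; apply: h1; apply/andP; split; lra.
move=> Sch; have : c + h <= c by apply: ub_le_sup => //; exists b.
lra.
Qed.

Lemma cderiv_mean_value f (f' : C -> C) x y (L : R) : 0 <= L ->
  (forall t : R, 0 <= t <= 1 -> cderiv f (x + t%:C * (y - x)) (f' (x + t%:C * (y - x))) /\
      modulus (f' (x + t%:C * (y - x))) <= L) ->
  modulus (f y - f x) <= L * modulus (y - x).
Proof.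
move=> L0 H; set m := modulus (y - x).
have m0 : 0 <= m by exact: normc_ge0.
have := @mean_value_ineq (fun t => f (x + t%:C * (y - x))) 0 1 (L * m) ler01.
rewrite rmorph0 rmorph1 mul0r mul1r addr0 (addrC x) subrK subr0 mulr1; apply.
  by rewrite mulr_ge0.
move=> t t01 e e0; have [fd fL] := H t t01.
have m1 : 0 < m + 1 by rewrite ltr_wpDl.
have [d d0 Hd] := fd _ (divr_gt0 e0 m1).
exists (d / (m + 1)); first by rewrite divr_gt0.
move=> h hd _; set z := x + t%:C * (y - x) in fd fL Hd *.
have -> : x + (t + h)%:C * (y - x) = z + h%:C * (y - x).
  by rewrite /z rmorphD mulrDl addrA.
have hm : modulus (h%:C * (y - x)) = `|h| * m by rewrite Normc.normcM normc_real.
have {}Hd : modulus (f (z + h%:C * (y - x)) - f z - h%:C * (y - x) * f' z) <= e / (m + 1) * (`|h| * m).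
  rewrite -hm; apply: Hd; rewrite hm; rewrite ltr_pdivlMr// in hd.
  by apply: le_lt_trans hd; rewrite ler_wpM2l// lerDl.
rewrite -(subrK (h%:C * (y - x) * f' z) (f _ - f z)) (le_trans (normcD _ _))//.
rewrite mulrDl addrC lerD//.
  rewrite Normc.normcM hm -[leRHS]mulrA [m * _]mulrC [leLHS]mulrC.
  by rewrite ler_wpM2r ?mulr_ge0.
apply: (le_trans Hd); rewrite mulrAC ler_pdivrMr// -[leRHS]mulrA ler_wpM2l ?(ltW e0)//.
by rewrite ler_wpM2l// lerDl.
Qed.

Lemma disc0 : disc (0 : C).
Proof. by rewrite /disc /mkset Normc.normc0. Qed.

(** Trades the extended real supremum and [derive1] for a real bound and a derivative given as a
    witness; the Bloch condition is used in this form from here on. *)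
Lemma bloch_iff f : bloch f <-> (forall z, ~ disc z -> f z = 0) /\
  exists (f' : C -> C) (M : R), forall z, disc z ->
    cderiv f z (f' z) /\ (1 - modulus z ^+ 2) * modulus (f' z) <= M.
Proof.
split.
  move=> [[df f0] nf]; split=> //.
  set S := [set ((1 - modulus z ^+ 2) * modulus (derive1 f z))%:E | z in disc] in nf.
  have S0 : S ((1 - modulus 0 ^+ 2) * modulus (derive1 f 0))%:E.
    by exists 0 => //; exact: disc0.
  have supS : (ereal_sup S < +oo)%E.
    rewrite ltey; apply/eqP => Soo; move: nf; rewrite /bloch_norm -/S Soo.
    by rewrite addey// ltxx.
  have sfin : ereal_sup S \is a fin_num.
    rewrite fin_numElt supS andbT; apply: lt_le_trans (ereal_sup_ubound S0).
    exact: ltNyr.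
  exists (derive1 f); exists (fine (ereal_sup S)); move=> z z1; split.
    by apply/cderivP; split=> //; exact: df.
  rewrite -lee_fin fineK//; apply: ereal_sup_ubound; by exists z.
move=> [f0 [f' [M H]]]; split.
  split=> // z z1; have [+ _] := H z z1; by move=> /cderivP[].
rewrite /bloch_norm; apply: (@le_lt_trans _ _ ((modulus (f 0))%:E + M%:E)%E).
  rewrite leeD2l//; apply: ge_ereal_sup => _ [z z1 <-]; rewrite lee_fin.
  have [+ h] := H z z1; by move=> /cderivP[_ ->].
by rewrite -EFinD ltry.
Qed.

Lemma one_sub_sqr_modulus_ge (r : R) z : modulus z <= r -> 1 - r ^+ 2 <= 1 - modulus z ^+ 2.
Proof.
by move=> zr; rewrite lerD2l lerN2 lerXn2r ?nnegrE ?normc_ge0// (le_trans _ zr)// normc_ge0.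
Qed.

Lemma bloch_lipschitz f (f' : C -> C) (M : R) (r : R) :
  (forall z, disc z -> cderiv f z (f' z) /\ (1 - modulus z ^+ 2) * modulus (f' z) <= M) ->
  0 <= r -> r < 1 -> forall x y, modulus x <= r -> modulus y <= r ->
  modulus (f y - f x) <= M / (1 - r ^+ 2) * modulus (y - x).
Proof.
move=> H r0 r1 x y xr yr.
have r2 : 0 < 1 - r ^+ 2 by rewrite subr_gt0 exprn_ilt1.
have M0 : 0 <= M.
  have [_] := H 0 disc0.
  by rewrite Normc.normc0 expr0n /= subr0 mul1r; apply: le_trans; exact: normc_ge0.
apply: (@cderiv_mean_value f f'); first by rewrite divr_ge0// ltW.
move=> t /andP[t0 t1]; set z := x + t%:C * (y - x).
have zr : modulus z <= r.
  have -> : z = (1 - t)%:C * x + t%:C * y by rewrite /z rmorphB rmorph1; ring.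
  rewrite (le_trans (normcD _ _))// !Normc.normcM !normc_real !ger0_norm ?subr_ge0//.
  have -> : r = (1 - t) * r + t * r by ring.
  by rewrite lerD// ler_wpM2l// subr_ge0.
have z1 : disc z by exact: le_lt_trans zr r1.
have [fd fM] := H z z1; split=> //.
rewrite ler_pdivlMr// mulrC (le_trans _ fM)// ler_wpM2r ?normc_ge0//.
exact: one_sub_sqr_modulus_ge.
Qed.

End bloch_calculus.

Lemma cvg0P {R : realType} (x : nat -> R) :
  (forall e : R, 0 < e -> exists N, forall n, (N <= n)%N -> `|x n| <= e) <->
  x n @[n --> \oo] --> 0.
Proof.
split=> [H|H].
  apply/cvgr0Pnorm_le => e e0; have [N HN] := H _ e0; by exists N.
move=> e e0; have /cvgr0Pnorm_le /(_ _ e0)[N _ HN] := H; by exists N => n /HN.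
Qed.

(** * Taylor expansion of Bloch functions *)

Section area_cauchy_formula.
Context {R : realType}.
Local Notation C := (Cplx R).
Local Notation modulus := (@Normc.normc R).
Local Notation T := (measurableTypeR R * measurableTypeR R)%type.
Local Notation Dm := (@to_complex R @^-1` disc : set T).
Local Notation I := (@area_integral R).
Local Notation area0 := (@area0 R).
Implicit Types (f : C -> C) (z w : C).

Lemma bm_annulus_inv (r d : R) (h : C -> C) : bm h -> 0 < d ->
  (forall z, disc z -> r <= modulus z -> d <= modulus (h z)) ->
  bm (fun z => annulus r z * (h z)^-1).
Proof.
move=> /bmE[m1 m2 _] d0 hd; have /bmE[a1 a2 _] := bm_annulus r.
(* This is |h|^-2, written as a real power for the sake of measurability. Since 0 has inverse 0 and
   (-1)-st power 0, the formula for 1/h also holds at the zeros of h. *)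
pose n (p : T) : R := (complex.Re (h (to_complex p)) ^+ 2 + complex.Im (h (to_complex p)) ^+ 2) `^ (-1).
have mn : measurable_fun Dm n.
  apply: (@measurableT_comp _ _ _ _ _ _ (fun x : R => x `^ (-1))).
    exact: measurable_powR.
  by apply: measurable_funD; exact: measurable_funX.
have E p : (h (to_complex p))^-1 =
    (complex.Re (h (to_complex p)) * n p) +i* (- (complex.Im (h (to_complex p)) * n p)).
  rewrite /n powR_inv1 ?addr_ge0 ?sqr_ge0//.
  by case: (h (to_complex p)).
apply/bmE; split.
- under eq_fun do rewrite Re_mulc E /=.
  apply: measurable_funB; apply: measurable_funM => //.
    exact: measurable_funM.
  by apply: measurable_funN; exact: measurable_funM.
- under eq_fun do rewrite Im_mulc E /=.
  apply: measurable_funD; apply: measurable_funM => //.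
    by apply: measurable_funN; exact: measurable_funM.
  exact: measurable_funM.
- exists d^-1 => z z1; rewrite Normc.normcM Normc.normcV /annulus.
  case: ifP => [rz|_].
    by rewrite Normc.normc1 mul1r lef_pV2 ?posrE ?hd// (lt_le_trans d0)// hd.
  by rewrite Normc.normc0 mul0r invr_ge0 ltW.
Qed.

(** The Cayley transform of 1/(k+1): explicit unimodular numbers, different from 1 and -1, that tend
    to 1. They serve as infinitesimal rotations. *)
Definition cayley (k : nat) : C := (1 +i* k.+1%:R^-1) / (1 -i* k.+1%:R^-1).

Lemma cayleyP k : [/\ modulus (cayley k) = 1, cayley k != -1, cayley k != 1
  & modulus (cayley k - 1) <= 2 * k.+1%:R^-1].
Proof.
set t : R := k.+1%:R^-1; have t0 : 0 < t by rewrite invr_gt0.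
have D0 : (1 -i* t : C) != 0 by rewrite eq_complex /= oner_eq0.
have Dm1 : 1 <= modulus (1 -i* t : C).
  rewrite /= -[leLHS]sqrtr1 ler_sqrt ?addr_ge0 ?sqr_ge0// expr1n lerDl sqr_ge0//.
split.
- rewrite /cayley Normc.normcM Normc.normcV -/t.
  have -> : modulus (1 +i* t : C) = modulus (1 -i* t : C) by rewrite /= sqrrN.
  by rewrite mulfV// normc_eq0.
- apply/eqP => E; have : cayley k * (1 -i* t) = (1 +i* t) by rewrite /cayley divfK.
  rewrite E mulN1r => -[]; lra.
- apply/eqP => E; have : cayley k * (1 -i* t) = (1 +i* t) by rewrite /cayley divfK.
  rewrite E mul1r => -[]; lra.
- have -> : cayley k - 1 = (0 +i* (2 * t)) / (1 -i* t).
    rewrite /cayley -/t -[X in _ - X](mulfV D0) -mulrBl; congr (_ / _).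
    by simpc; congr (_ +i* _); ring.
  rewrite Normc.normcM Normc.normcV ler_pdivrMr ?(lt_le_trans _ Dm1)//.
  have -> : modulus (0 +i* (2 * t) : C) = 2 * t.
    by rewrite /= expr0n /= add0r sqrtr_sqr ger0_norm// mulr_ge0// ltW.
  by rewrite ler_peMr// mulr_ge0// ltW.
Qed.

Section cauchy.
Variables (F F' : C -> C) (B L : R).
Hypothesis L0 : 0 <= L.
Hypothesis FF' : forall z, disc z -> cderiv F z (F' z).
Hypothesis FB : forall z, disc z -> modulus (F z) <= B.
Hypothesis FL : forall x y, disc x -> disc y -> modulus (F y - F x) <= L * modulus (y - x).
Variables (r : R) (w : C).
Hypotheses (wr : modulus w < r) (r1 : r < 1).

Let r0 : 0 < r. Proof. exact: le_lt_trans (normc_ge0 w) wr. Qed.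
Let w1 : disc w. Proof. exact: lt_trans wr r1. Qed.

Let K z : C := annulus r z * (z - w)^-1.

Lemma bm_cauchy_kernel : bm K.
Proof.
apply: (@bm_annulus_inv r (r - modulus w) (fun z => z - w)).
- by apply: bmB; [exact: bm_id|exact: bm_cst].
- by rewrite subr_gt0.
- by move=> z _ rz; apply: le_trans (normcBr_ge _ _); rewrite lerD2r.
Qed.

Lemma bm_comp_affine (p q : C) : (forall z, disc z -> disc (p + q * z)) ->
  bm (fun z => F (p + q * z)).
Proof.
move=> pq; apply: (@bm_cont _ _ B); last by move=> z z1; exact/FB/pq.
move=> z z1 e e0; pose m := L * modulus q + 1.
have m0 : 0 < m by rewrite ltr_wpDl// mulr_ge0// normc_ge0.
exists (e / m); first by rewrite divr_gt0.
move=> y y1; rewrite ltr_pdivlMr// => yz.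
apply: le_lt_trans (FL (pq _ z1) (pq _ y1)) _.
have -> : p + q * y - (p + q * z) = q * (y - z) by ring.
apply: le_lt_trans yz; rewrite Normc.normcM mulrA mulrC ler_wpM2l ?normc_ge0//.
by rewrite lerDl.
Qed.

Let pt (t : R) (u z : C) : C := (1 - t)%:C * w + (t%:C * u) * z.

Lemma disc_pt (t : R) u z : 0 <= t <= 1 -> modulus u = 1 -> disc z -> disc (pt t u z).
Proof.
move=> /andP[t0 t1] u1 z1; rewrite /disc /mkset /pt.
rewrite (le_lt_trans (normcD _ _))// !Normc.normcM !normc_real u1 mulr1.
rewrite !ger0_norm ?subr_ge0//.
have [->|tn0] := eqVneq t 0; first by rewrite subr0 mul1r mul0r addr0.
have tp : 0 < t by rewrite lt_neqAle eq_sym tn0.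
rewrite [ltRHS](_ : 1 = (1 - t) * 1 + t * 1); last by ring.
by rewrite ler_ltD// ?ler_wpM2l ?subr_ge0 ?(ltW w1)// ltr_pM2l.
Qed.

(** The argument of F is contracted from z at t = 1 to w at t = 0, while the kernel stays fixed. *)
Let phi (t : R) : C := I (fun z => F (pt t 1 z) * (K z * z)).

(** The point [pt t u z] is [pt t 1 (u * z)], and the annulus is rotation invariant. *)
Lemma rotation_average (t : R) u : 0 <= t <= 1 -> modulus u = 1 -> u != -1 ->
  I (fun z => annulus r z * F (pt t u z)) = I (fun z => annulus r z * F (pt t 1 z)).
Proof.
move=> t01 u1 uN1.
have bh : bm (fun z => annulus r z * F (pt t 1 z)).
  apply: bmM; first exact: bm_annulus.
  by apply: bm_comp_affine => z; apply: disc_pt; rewrite ?Normc.normc1.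
rewrite -(aint_rot u1 uN1 bh); apply: eq_aint => z _.
by rewrite annulusM// /pt mulr1 mulrA.
Qed.

(* The integrand of [phi] has t-derivative z F'(pt t 1 z) on the annulus.  As the
   average of F (pt t u z) over the annulus does not depend on the unimodular u,
   this derivative integrates to 0; hence [phi] is constant. *)
Lemma phi_difference_quotient (t : R) (h : nat -> R) : 0 < t -> t <= 1 ->
  (forall k, h k != 0) -> (forall k, `|h k| <= k.+1%:R^-1) ->
  (forall k, 0 <= t + h k <= 1) ->
  modulus ((h k)%:C^-1 * (phi (t + h k) - phi t)) @[k --> \oo] --> 0.
Proof.
move=> t0 t1 h0 hk th.
have t01 : 0 <= t <= 1 by rewrite (ltW t0).
pose u := cayley.
have u1 k : modulus (u k) = 1 by case: (cayleyP k).
have uN1 k : u k != -1 by case: (cayleyP k).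
have un1 k : u k - 1 != 0 by rewrite subr_eq0; case: (cayleyP k).
have uk k : modulus (u k - 1) <= 2 * k.+1%:R^-1 by case: (cayleyP k).
have tC0 : t%:C != 0 :> C by rewrite eq_complex /= gt_eqF.
have hC0 k : (h k)%:C != 0 :> C by rewrite eq_complex /= (negbTE (h0 k)).
have m1 : modulus (1 : C) = 1 by exact: Normc.normc1.
have bK : bm (fun z => K z * z) by apply: bmM; [exact: bm_cauchy_kernel|exact: bm_id].
have bF s v : 0 <= s <= 1 -> modulus v = 1 -> bm (fun z => F (pt s v z)).
  by move=> s01 v1; apply: bm_comp_affine => z; exact: disc_pt.
have b1 s : 0 <= s <= 1 -> bm (fun z => F (pt s 1 z) * (K z * z)).
  by move=> s01; apply: bmM => //; exact: bF.
have b2 v : modulus v = 1 -> bm (fun z => annulus r z * F (pt t v z)).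
  by move=> v1; apply: bmM; [exact: bm_annulus|exact: bF].
(* From the quotient in t, a quotient with rotation step t (u_k - 1) is subtracted. The latter has
   integral 0 by [rotation_average], and on the annulus both tend to z F'(pt t 1 z): in the first,
   the factor z - w of the increment cancels the kernel. *)
pose D k z := (h k)%:C^-1 * (F (pt (t + h k) 1 z) * (K z * z) - F (pt t 1 z) * (K z * z)) -
  (t%:C * (u k - 1))^-1 * (annulus r z * F (pt t (u k) z) - annulus r z * F (pt t 1 z)).
have bD1 k : bm (fun z => (h k)%:C^-1 *
    (F (pt (t + h k) 1 z) * (K z * z) - F (pt t 1 z) * (K z * z))).
  by apply: bmM; [exact: bm_cst|apply: bmB; exact: b1].
have bD2 k : bm (fun z => (t%:C * (u k - 1))^-1 *
    (annulus r z * F (pt t (u k) z) - annulus r z * F (pt t 1 z))).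
  by apply: bmM; [exact: bm_cst|apply: bmB; exact: b2].
have bD k : bm (D k) by exact: bmB.
have ID k : I (D k) = (h k)%:C^-1 * (phi (t + h k) - phi t).
  rewrite aintB// aintZ; last by apply: bmB; exact: b1.
  rewrite aintZ; last by apply: bmB; exact: b2.
  rewrite aintB; [|exact: b1|exact: b1]; rewrite aintB; [|exact: b2|exact: b2].
  by rewrite (rotation_average t01 (u1 k) (uN1 k)) subrr mulr0 subr0.
under eq_fun do rewrite -ID.
have Dout k z : ~~ (r <= modulus z) -> D k z = 0.
  by move=> rz; rewrite /D /K /annulus (negbTE rz) !mul0r !mulr0 !subrr !mulr0 subrr.
have Din k z : r <= modulus z -> D k z =
   z * ((h k)%:C * (z - w))^-1 * (F (pt t 1 z + (h k)%:C * (z - w)) - F (pt t 1 z)) -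
   z * (t%:C * (u k - 1) * z)^-1 * (F (pt t 1 z + t%:C * (u k - 1) * z) - F (pt t 1 z)).
  move=> rz; rewrite /D /K /annulus rz !mul1r.
  have z0 : z != 0 by rewrite -normc_gt0; exact: lt_le_trans r0 rz.
  have -> : pt (t + h k) 1 z = pt t 1 z + (h k)%:C * (z - w).
    by rewrite /pt !(rmorphD, rmorphB) /= !mulr1; ring.
  have -> : pt t (u k) z = pt t 1 z + t%:C * (u k - 1) * z by rewrite /pt; ring.
  congr (_ - _).
    by rewrite -mulrBl [((h k)%:C * _)^-1]invfM; ring.
  by rewrite [(_ * z)^-1]invfM [z * (_ / z)]mulrCA mulfV// mulr1.
have zw z : r <= modulus z -> z - w != 0.
  move=> rz; rewrite -normc_gt0; apply: lt_le_trans (normcBr_ge _ _).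
  by rewrite subr_gt0 (lt_le_trans wr).
have pin k z : disc z -> disc (pt t 1 z + (h k)%:C * (z - w)).
  move=> z1; have -> : pt t 1 z + (h k)%:C * (z - w) = pt (t + h k) 1 z.
    by rewrite /pt !(rmorphD, rmorphB) /= !mulr1; ring.
  exact: disc_pt.
have qin k z : disc z -> disc (pt t 1 z + t%:C * (u k - 1) * z).
  move=> z1; have -> : pt t 1 z + t%:C * (u k - 1) * z = pt t (u k) z by rewrite /pt; ring.
  exact: disc_pt.
have dq_bound z x y : disc z -> disc x -> disc (x + y) -> y != 0 ->
    modulus (z * y^-1 * (F (x + y) - F x)) <= L.
  move=> z1 x1 xy1 y0; rewrite -mulrA mulrC !Normc.normcM.
  have my : 0 < modulus y by rewrite normc_gt0.
  apply: (@le_trans _ _ (L * 1)); last by rewrite mulr1.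
  rewrite ler_pM ?mulr_ge0 ?normc_ge0//; last exact: ltW.
  rewrite Normc.normcV mulrC ler_pdivrMr//.
  by apply: le_trans (FL x1 xy1) _; rewrite addrC addKr.
have dq_lim z x y e d : disc z -> disc x -> 0 < e -> y != 0 -> modulus y < d ->
    (forall y, modulus y < d -> modulus (F (x + y) - F x - y * F' x) <= e * modulus y) ->
    modulus (z * y^-1 * (F (x + y) - F x) - z * F' x) <= e.
  move=> z1 x1 e0 y0 yd /(_ _ yd) H.
  have my : 0 < modulus y by rewrite normc_gt0.
  have -> : z * y^-1 * (F (x + y) - F x) - z * F' x = z * (y^-1 * (F (x + y) - F x - y * F' x)).
    by rewrite [in RHS]mulrBr [y^-1 * (y * F' x)]mulrA mulVf// mul1r [RHS]mulrBr mulrA.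
  rewrite Normc.normcM; apply: (@le_trans _ _ (1 * e)); last by rewrite mul1r.
  rewrite ler_pM ?normc_ge0//; first exact: ltW.
  by rewrite Normc.normcM Normc.normcV mulrC ler_pdivrMr.
have hy k z : r <= modulus z -> (h k)%:C * (z - w) != 0.
  by move=> rz; rewrite mulf_neq0// zw.
have uy k z : r <= modulus z -> t%:C * (u k - 1) * z != 0.
  move=> rz; rewrite !mulf_neq0//.
  by rewrite -normc_gt0; exact: lt_le_trans r0 rz.
(* Each of the two quotients is at most L in modulus, by the Lipschitz bound and |z| < 1. *)
apply: (@aint_dominated_cvg0 _ _ (L + L)) => //.
  move=> k z z1; have [rz|rz] := boolP (r <= modulus z); last first.
    by rewrite Dout// Normc.normc0 addr_ge0.
  have x1 : disc (pt t 1 z) by exact: disc_pt.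
  rewrite Din// (le_trans (normcB _ _))// lerD//; apply: dq_bound => //.
  - exact: pin.
  - exact: hy.
  - exact: qin.
  - exact: uy.
move=> z z1; apply/cvg0P => e e0.
have [rz|rz] := boolP (r <= modulus z); last first.
  by exists 0%N => n _; rewrite Dout// Normc.normc0 normr0 ltW.
have x1 : disc (pt t 1 z) by exact: disc_pt.
have e20 : 0 < e / 2 by rewrite divr_gt0.
have [d d0 Hd] := FF' x1 e20.
have [N HN] : exists N : nat, forall n, (N <= n)%N -> 2 * n.+1%:R^-1 < d.
  have := @near_infty_natSinv_lt R (PosNum (divr_gt0 d0 (ltr0n R 2))).
  move=> [N _ H]; exists N => n Nn; have := H n Nn => /= {}H.
  by rewrite mulrC -ltr_pdivlMr.
exists N => n Nn; rewrite ger0_norm ?normc_ge0//.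
have nd := HN n Nn; set x := pt t 1 z in Hd x1 *.
rewrite Din// -/x.
set A := z * _ * _; set A' := z * _ * _.
have -> : A - A' = (A - z * F' x) - (A' - z * F' x) by ring.
rewrite (le_trans (normcB _ _))// (splitr e) lerD//.
  apply: (dq_lim _ _ _ _ d) => //; first exact: hy.
  rewrite Normc.normcM normc_real; apply: le_lt_trans nd.
  rewrite mulrC ler_pM ?normc_ge0// (le_trans (normcB _ _))//.
  have -> : 2 = 1 + 1 :> R by [].
  by apply: lerD; exact: ltW.
apply: (dq_lim _ _ _ _ d) => //; first exact: uy.
rewrite !Normc.normcM normc_real ger0_norm ?(ltW t0)//; apply: le_lt_trans nd.
rewrite -[leRHS]mulr1 ler_pM ?mulr_ge0 ?normc_ge0 ?(ltW t0) ?(ltW z1)//.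
by rewrite -[leRHS]mul1r ler_pM ?normc_ge0 ?(ltW t0).
Qed.

Lemma modulus_cauchy_kernel_le z : modulus (K z) * modulus (z - w) <= 1.
Proof.
rewrite /K /annulus; case: ifP => rz; last by rewrite mul0r Normc.normc0 mul0r.
rewrite mul1r Normc.normcV mulVf// normc_eq0 -normc_gt0.
by apply: lt_le_trans (normcBr_ge _ _); rewrite subr_gt0 (lt_le_trans wr).
Qed.

Lemma bm_phi (s : R) : 0 <= s <= 1 -> bm (fun z => F (pt s 1 z) * (K z * z)).
Proof.
move=> s01; apply: bmM.
  by apply: bm_comp_affine => z; apply: disc_pt; rewrite ?Normc.normc1.
by apply: bmM; [exact: bm_cauchy_kernel|exact: bm_id].
Qed.

(** The argument of F moves by (s - t)(z - w), and the factor z - w cancels the kernel. *)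
Lemma phi_lipschitz (s t : R) : 0 <= s <= 1 -> 0 <= t <= 1 ->
  modulus (phi s - phi t) <= 2 * (L * `|s - t|) * area0.
Proof.
move=> s01 t01; rewrite -aintB; [|exact: bm_phi|exact: bm_phi]; apply: aint_bound.
  by apply: bmB; exact: bm_phi.
move=> z z1; rewrite -mulrBl Normc.normcM [modulus (K z * z)]Normc.normcM.
have m1 : modulus (1 : C) = 1 by exact: Normc.normc1.
have := FL (disc_pt t01 m1 z1) (disc_pt s01 m1 z1).
have -> : pt s 1 z - pt t 1 z = (s - t)%:C * (z - w).
  by rewrite /pt !(rmorphD, rmorphB) /= !mulr1; ring.
rewrite Normc.normcM normc_real => h.
apply: (@le_trans _ _ ((L * (`|s - t| * modulus (z - w))) * (modulus (K z) * 1))).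
  apply: ler_pM => //; rewrite ?mulr_ge0 ?normc_ge0//.
  by rewrite ler_wpM2l ?normc_ge0// ltW.
rewrite mulr1 mulrA -[leLHS]mulrA -[leRHS]mulr1 ler_wpM2l ?mulr_ge0//.
by rewrite mulrC modulus_cauchy_kernel_le.
Qed.

(** By contradiction, because dominated convergence is sequential: bad increments h_k with |h_k| <
    1/(k+1) would violate [phi_difference_quotient]. *)
Lemma phi_flat (t : R) : 0 < t -> t <= 1 -> forall e : R, 0 < e -> exists2 d : R, 0 < d &
  forall h, `|h| < d -> 0 <= t + h <= 1 -> modulus (phi (t + h) - phi t) <= e * `|h|.
Proof.
move=> t0 t1 e e0; apply: contrapT => Hno.
have ex (k : nat) : exists h : R, [/\ `|h| < k.+1%:R^-1, 0 <= t + h <= 1 &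
    e * `|h| < modulus (phi (t + h) - phi t)].
  apply: contrapT => Hk; apply: Hno; exists k.+1%:R^-1 => // h hk th.
  by rewrite leNgt; apply/negP => lt_; apply: Hk; exists h.
have [h Hh] := choice ex.
have h0 k : h k != 0.
  apply/eqP => hk; have [_ _] := Hh k.
  by rewrite hk addr0 subrr Normc.normc0 normr0 mulr0 ltxx.
have hk k : `|h k| <= k.+1%:R^-1 by have [/ltW] := Hh k.
have th k : 0 <= t + h k <= 1 by have [] := Hh k.
have /cvg0P /(_ _ e0)[N HN] := phi_difference_quotient t0 t1 h0 hk th.
have [_ _] := Hh N; have := HN N (leqnn N).
rewrite ger0_norm ?normc_ge0// Normc.normcM Normc.normcV normc_real.
have hN : 0 < `|h N| by rewrite normr_gt0.
by rewrite mulrC ler_pdivrMr// leNgt => /negP.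
Qed.

(** On a circle dz = i z d(theta), so this is Cauchy's formula averaged over the circles of radius
    between r and 1. The two sides are [phi 1] and [phi 0]. *)
Lemma area_cauchy : I (fun z => F z * (K z * z)) = F w * I (fun z => K z * z).
Proof.
have p1 : phi 1 = I (fun z => F z * (K z * z)).
  by apply: eq_aint => z _; rewrite /pt subrr mul0r add0r !mul1r.
have p0 : phi 0 = F w * I (fun z => K z * z).
  rewrite -aintZ; last by apply: bmM; [exact: bm_cauchy_kernel|exact: bm_id].
  by apply: eq_aint => z _; rewrite /pt subr0 mul0r !mul1r mul0r addr0.
rewrite -p1 -p0; apply/eqP; rewrite -subr_eq0 -normc_eq0 eq_le normc_ge0 andbT.
apply: le0_of_all_le => e e0.
pose c := 2 * L * area0 + 1.
have c0 : 0 < c by rewrite ltr_wpDl// !mulr_ge0// area0_ge0.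
(* [phi_flat] excludes t = 0, so the mean value inequality with slope 0 runs over [s, 1]; the
   Lipschitz bound covers [0, s] at a cost of at most s c <= e. *)
pose s := Num.min 1 (e / c).
have s0 : 0 < s by rewrite lt_min ltr01 divr_gt0.
have s1 : s <= 1 by rewrite ge_min lexx.
have sc : s * c <= e by rewrite -ler_pdivlMr// ge_min lexx orbT.
have fl := @mean_value_ineq _ phi s 1 0 s1 (lexx 0).
rewrite mul0r in fl.
have {}fl : modulus (phi 1 - phi s) <= 0.
  apply: fl => t /andP[st t1] d d0.
  have [d' d'0 H] := phi_flat (lt_le_trans s0 st) t1 d0.
  exists d' => // h hd /andP[sth th1]; rewrite add0r; apply: H => //.
  by rewrite th1 andbT (le_trans (ltW s0)).
rewrite -(subrK (phi s) (phi 1)) -addrA (le_trans (normcD _ _))//.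
rewrite -[leRHS]add0r lerD// (le_trans (phi_lipschitz _ _))//.
- by rewrite (ltW s0).
- by rewrite lexx ler01.
rewrite subr0 ger0_norm ?(ltW s0)// (le_trans _ sc)// /c mulrDr mulr1.
have -> : 2 * (L * s) * area0 = s * (2 * L * area0) by ring.
by rewrite lerDl ltW.
Qed.

End cauchy.
End area_cauchy_formula.

(** * Local Taylor series from the averaged Cauchy formula *)

Section taylor.
Context {R : realType}.
Local Notation C := (Cplx R).
Local Notation modulus := (@Normc.normc R).
Local Notation T := (measurableTypeR R * measurableTypeR R)%type.
Local Notation Dm := (@to_complex R @^-1` disc : set T).
Local Notation I := (@area_integral R).
Local Notation area0 := (@area0 R).
Implicit Types (f : C -> C) (z w : C).

(** The cut-off of z^-k; the inner cut-off makes the base of the power bounded, and the outer one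
    handles k = 0. *)
Definition annulus_power (r : R) (k : nat) z : C := annulus r z * (annulus r z * z^-1) ^+ k.

Lemma bm_annulus_power (r : R) k : 0 < r -> bm (annulus_power r k).
Proof.
move=> r0; apply: bmM; first exact: bm_annulus.
by apply: bmX; apply: (@bm_annulus_inv _ r r id) => //; exact: bm_id.
Qed.

Lemma annulus_power_le (r : R) k z : 0 < r -> modulus (annulus_power r k z) <= r ^- k.
Proof.
move=> r0; rewrite /annulus_power /annulus; case: ifP => rz; last first.
  by rewrite mul0r Normc.normc0 invr_ge0 exprn_ge0// ltW.
rewrite !mul1r exprVn Normc.normcV normcX lef_pV2 ?posrE ?exprn_gt0//.
  by rewrite lerXn2r ?nnegrE ?normc_ge0// ltW.
exact: lt_le_trans rz.
Qed.

Lemma aint_annulus_power (r : R) k : 0 < r ->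
  I (annulus_power r k.+1) = 0.
Proof.
move=> r0; have [u [u1 uN1 uk]] := @unit_not_root_of_unity R.
have bP := bm_annulus_power k.+1 r0.
have u0 : u != 0 by rewrite -normc_eq0 u1 oner_eq0.
have H : I (annulus_power r k.+1) = u ^- k.+1 * I (annulus_power r k.+1).
  rewrite -{1}(aint_rot u1 uN1 bP) -aintZ//; apply: eq_aint => z _.
  rewrite /annulus_power annulusM//.
  have -> : annulus r z * (u * z)^-1 = u^-1 * (annulus r z * z^-1) by rewrite invfM mulrCA.
  by rewrite exprMn exprVn mulrCA.
have /eqP : (1 - u ^- k.+1) * I (annulus_power r k.+1) = 0.
  by rewrite mulrBl mul1r -H subrr.
rewrite mulf_eq0 subr_eq0 => /orP[|/eqP//].
by rewrite eq_sym -(inj_eq invr_inj) invrK invr1 (negbTE (uk k)).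
Qed.

Lemma aint_annulus (r : R) : 0 < r -> r < 1 -> I (annulus r) = ((1 - r ^+ 2) * area0)%:C.
Proof.
move=> r0 r1; rewrite /area_integral; congr (_ +i* _).
  have := moment_split 0 r0 r1; rewrite muln1 moment0 => <-.
  rewrite Rintegral_mkcondr; apply: eq_Rintegral => p _.
  rewrite /annulus /patch; case: ifP => rp.
    by rewrite mem_set// expr0.
  by rewrite memNset// => /= rp'; rewrite rp' in rp.
transitivity (Rintegral (@area R) Dm (fun=> 0)); last first.
  by rewrite Rintegral_cst ?mul0r//; exact: measurable_Dm.
by apply: eq_Rintegral => p _; rewrite /annulus; case: ifP.
Qed.

(** On the annulus z / (z - w) is the geometric series of ratio w / z. Its remainder (w/z)^n z / (z
    - w) is at most q^n / (r - |w|) with q = |w| / r, uniformly in z. *)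
Lemma cauchy_kernel_expansion (H : C -> C) (B r : R) w : bm H ->
  (forall z, disc z -> modulus (H z) <= B) -> modulus w < r ->
  csum_to (fun k => I (fun z => H z * annulus_power r k z) * w ^+ k)
    (I (fun z => H z * (annulus r z * (z - w)^-1 * z))).
Proof.
move=> bH HB wr.
have r0 : 0 < r by exact: le_lt_trans (normc_ge0 w) wr.
pose q := modulus w / r.
have q0 : 0 <= q by rewrite divr_ge0 ?normc_ge0// ltW.
have q1 : q < 1 by rewrite ltr_pdivrMr// mul1r.
have bK : bm (fun z => annulus r z * (z - w)^-1 * z) by apply: bmM; [exact: bm_cauchy_kernel|exact: bm_id].
have bP k := bm_annulus_power k r0.
have bS n : bm (fun z => \sum_(k < n) H z * annulus_power r k z * w ^+ k).
  apply: (@bm_sum _ _ _ _ (fun (k : 'I_n) z => H z * annulus_power r k z * w ^+ k)) => k.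
  by apply: bmM; [exact: bmM|exact: bm_cst].
have IS n : \sum_(k < n) I (fun z => H z * annulus_power r k z) * w ^+ k =
    I (fun z => \sum_(k < n) H z * annulus_power r k z * w ^+ k).
  rewrite (aint_sum _ _ (F := fun (k : 'I_n) z => H z * annulus_power r k z * w ^+ k)).
    apply: eq_bigr => k _; rewrite mulrC -aintZ; last exact: bmM.
    by apply: eq_aint => z _; rewrite mulrC.
  by move=> k; apply: bmM; [exact: bmM|exact: bm_cst].
have rw0 : 0 < r - modulus w by rewrite subr_gt0.
have B0 : 0 <= B by apply: le_trans (HB 0 disc0); exact: normc_ge0.
pose M := 2 * (B / (r - modulus w)) * area0.
have M0 : 0 <= M by rewrite !mulr_ge0// ?invr_ge0 ?(ltW rw0)// area0_ge0.
have err n : modulus (\sum_(k < n) I (fun z => H z * annulus_power r k z) * w ^+ k -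
   I (fun z => H z * (annulus r z * (z - w)^-1 * z))) <= M * q ^+ n.
  rewrite IS -aintB//; last exact: bmM.
  have -> : M * q ^+ n = 2 * (B * (q ^+ n / (r - modulus w))) * area0 by rewrite /M; ring.
  apply: aint_bound; first by apply: bmB => //; exact: bmM.
  move=> z z1.
  have -> : \sum_(k < n) H z * annulus_power r k z * w ^+ k =
      H z * \sum_(k < n) annulus_power r k z * w ^+ k.
    by rewrite mulr_sumr; apply: eq_bigr => k _; rewrite mulrA.
  rewrite -mulrBr Normc.normcM ler_pM ?normc_ge0 ?HB//.
  have [rz|rz] := boolP (r <= modulus z); last first.
    rewrite /annulus_power /annulus (negbTE rz) !mul0r subr0 big1 ?Normc.normc0.
      by rewrite divr_ge0 ?exprn_ge0// ltW.
    by move=> k _; rewrite !mul0r.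
  have z0 : z != 0 by rewrite -normc_gt0; exact: lt_le_trans r0 rz.
  have zw0 : z - w != 0.
    rewrite -normc_gt0; apply: lt_le_trans (normcBr_ge _ _).
    by rewrite subr_gt0 (lt_le_trans wr).
  have -> : \sum_(k < n) annulus_power r k z * w ^+ k - annulus r z * (z - w)^-1 * z =
      - ((w / z) ^+ n * (z - w)^-1 * z).
    rewrite /annulus_power /annulus rz !mul1r.
    have E : z - w = z * (1 - w / z) by rewrite mulrBr mulr1 mulrCA mulfV// mulr1.
    have G : 1 - (w / z) ^+ n = (1 - w / z) * \sum_(k < n) (w / z) ^+ k.
      by rewrite -{1}(expr1n C n) subrXX; under eq_bigr do rewrite expr1n mul1r.
    have d0 : 1 - w / z != 0 by apply: contra zw0 => /eqP d0; rewrite E d0 mulr0.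
    have -> : \sum_(k < n) 1 * z^-1 ^+ k * w ^+ k = (1 - w / z)^-1 * (1 - (w / z) ^+ n).
      rewrite G mulrA mulVf// mul1r; apply: eq_bigr => k _.
      by rewrite mul1r -exprMn mulrC.
    rewrite -[(w / z) ^+ n / (z - w) * z]mulrA.
    have -> : (z - w)^-1 * z = (1 - w / z)^-1 by rewrite E invfM mulrAC mulVf// mul1r.
    by ring.
  rewrite normcN !Normc.normcM normcX !Normc.normcM !Normc.normcV.
  have mz : 0 < modulus z by exact: lt_le_trans rz.
  have wz : modulus w / modulus z <= q.
    by rewrite /q ler_wpM2l ?normc_ge0// lef_pV2 ?posrE.
  have zwr : r - modulus w <= modulus (z - w).
    by apply: le_trans (normcBr_ge _ _); rewrite lerD2r.
  rewrite -[leRHS]mulr1 ler_pM ?mulr_ge0 ?invr_ge0 ?exprn_ge0 ?mulr_ge0 ?invr_ge0 ?normc_ge0 ?(ltW z1)//.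
  rewrite ler_pM ?exprn_ge0 ?mulr_ge0 ?invr_ge0 ?normc_ge0//.
    by apply: lerXn2r => //; rewrite nnegrE // divr_ge0 ?normc_ge0.
  by rewrite lef_pV2 ?posrE// (lt_le_trans rw0).
move=> e e0.
have c0 : M * q ^+ n @[n --> \oo] --> 0.
  rewrite -[X in _ --> X](mulr0 M); apply: cvgM; first exact: cvg_cst.
  by apply: cvg_expr; rewrite ger0_norm.
have /cvg0P /(_ _ e0)[N HN] := c0; exists N => n /HN h.
by apply: le_trans (err n) _; apply: le_trans h; exact: ler_norm.
Qed.

(** [cauchy_kernel_expansion] expands the left side of [area_cauchy]. The factor of F w on the right
    side is the area of the annulus: expanded with H = 1, all its terms but the first vanish by
    rotation. *)
Lemma local_taylor (F F' : C -> C) (B L r : R) : 0 <= L ->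
  (forall z, disc z -> cderiv F z (F' z)) ->
  (forall z, disc z -> modulus (F z) <= B) ->
  (forall x y, disc x -> disc y -> modulus (F y - F x) <= L * modulus (y - x)) ->
  0 < r -> r < 1 ->
  exists (a : nat -> C) (M : R), (forall k, modulus (a k) * r ^+ k <= M) /\
    forall w, modulus w < r -> csum_to (fun k => a k * w ^+ k) (F w).
Proof.
move=> L0 FF' FB FL r0 r1.
have bF : bm F.
  have := @bm_comp_affine _ F B L L0 FB FL 0 1.
  have -> : (fun z => F (0 + 1 * z)) = F by apply/funext => z; rewrite add0r mul1r.
  by apply => z; rewrite add0r mul1r.
pose al : C := I (annulus r).
have al_def : al = ((1 - r ^+ 2) * area0)%:C by exact: aint_annulus.
have r2 : 0 < 1 - r ^+ 2 by rewrite subr_gt0 exprn_ilt1// ltW.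
have al0 : al != 0.
  by rewrite al_def eq_complex /= eqxx andbT mulf_neq0 ?gt_eqF// area0_gt0.
pose G k := I (fun z => F z * annulus_power r k z).
exists (fun k => al^-1 * G k), (modulus al^-1 * (2 * B * area0)); split.
  move=> k; rewrite Normc.normcM -mulrA ler_wpM2l ?normc_ge0//.
  have h : modulus (G k) <= 2 * (B * r ^- k) * area0.
    apply: aint_bound; first by apply: bmM => //; exact: bm_annulus_power.
    by move=> z z1; rewrite Normc.normcM ler_pM ?normc_ge0 ?FB// annulus_power_le.
  apply: le_trans (ler_wpM2r _ h) _; first by rewrite exprn_ge0// ltW.
  have rk : r ^+ k != 0 by rewrite expf_neq0// gt_eqF.
  by rewrite le_eqVlt; apply/orP; left; apply/eqP; field.
move=> w wr.
have S1 := cauchy_kernel_expansion bF FB wr.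
rewrite (@area_cauchy R F F' B L L0 FF' FB FL r w wr r1) in S1.
have E : I (fun z => annulus r z * (z - w)^-1 * z) = al.
  have one : forall z : C, disc z -> modulus (1 : C) <= 1 by move=> z _; rewrite Normc.normc1.
  have S2 := cauchy_kernel_expansion (bm_cst 1) one wr.
  have -> : I (fun z => annulus r z * (z - w)^-1 * z) =
     I (fun z => 1 * (annulus r z * (z - w)^-1 * z)) by apply: eq_aint => z _; rewrite mul1r.
  apply: csum_to_unique S2 _.
  have P0 k : I (fun z => 1 * annulus_power r k z) = if k is 0%N then al else 0.
    transitivity (I (annulus_power r k)); first by apply: eq_aint => z _; rewrite mul1r.
    case: k => [|k]; last exact: aint_annulus_power.
    by apply: eq_aint => z _; rewrite /annulus_power expr0 mulr1.
  have := @csum_to_fin R (fun k => I (fun z => 1 * annulus_power r k z) * w ^+ k) 1.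
  rewrite big_ord1 P0 expr0 mulr1; apply => -[//|k] _.
  by rewrite P0 mul0r.
rewrite E in S1.
have := csum_toZ al^-1 S1; rewrite mulrCA mulVf// mulr1.
by congr csum_to; apply/funext => k; rewrite mulrA.
Qed.

End taylor.

(** * Global Taylor series of Bloch functions *)

Section bloch_taylor.
Context {R : realType}.
Local Notation C := (Cplx R).
Local Notation modulus := (@Normc.normc R).
Implicit Types (f : C -> C) (z w : C) (a b c : nat -> C).

Lemma real_complex_modulus (x : R) : 0 <= x -> modulus (x%:C : C) = x.
Proof. by move=> x0; rewrite normc_real ger0_norm. Qed.

(** If the coefficients before c_k vanish, then at a small x > 0 the term |c_k| x^k is at most the
    tail, which is at most 2 M (x/s)^(k+1); let x tend to 0. *)
Lemma power_series_eq0 c (s M : R) : 0 < s -> (forall k, modulus (c k) * s ^+ k <= M) ->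
  (forall w, modulus w < s -> csum_to (fun k => c k * w ^+ k) 0) -> forall k, c k = 0.
Proof.
move=> s0 cM c0; elim/ltn_ind => k IH.
apply/eqP; rewrite -normc_eq0 eq_le normc_ge0 andbT.
have M0 : 0 <= M by apply: le_trans (cM 0%N); rewrite mulr_ge0 ?normc_ge0 ?exprn_ge0// ltW.
have sk : 0 < s ^+ k.+1 by rewrite exprn_gt0.
pose K := M / s ^+ k.+1 * 2.
have K0 : 0 <= K by rewrite mulr_ge0// divr_ge0// ltW.
suff H (x : R) : 0 < x -> x <= s / 2 -> modulus (c k) <= K * x.
  apply: le0_of_all_le => e e0; pose x := Num.min (s / 2) (e / (K + 1)).
  have K1 : 0 < K + 1 by rewrite ltr_wpDl.
  have x0 : 0 < x by rewrite lt_min !divr_gt0.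
  have xs : x <= s / 2 by rewrite ge_min lexx.
  have xe : x * (K + 1) <= e by rewrite -ler_pdivlMr// ge_min lexx orbT.
  apply: le_trans (H x x0 xs) (le_trans _ xe).
  by rewrite mulrC ler_wpM2l ?(ltW x0)// lerDl.
move=> x0 xs.
have xs' : x < s by apply: le_lt_trans xs _; rewrite ltr_pdivrMr// ltr_pMr// ltr1n.
have mx : modulus (x%:C : C) = x by rewrite real_complex_modulus// ltW.
have := c0 x%:C; rewrite mx => /(_ xs') S.
have q0 : 0 <= x / s by rewrite divr_ge0// ltW.
have q1 : x / s < 1 by rewrite ltr_pdivrMr// mul1r.
have qh : x / s <= 2^-1 by rewrite ler_pdivrMr// mulrC.
have tail m : \sum_(k.+1 <= i < m) modulus (c i * x%:C ^+ i) <= M * (x / s) ^+ k.+1 * 2.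
  apply: (@le_trans _ _ (\sum_(k.+1 <= i < m) M * (x / s) ^+ k.+1 * (x / s) ^+ (i - k.+1))).
    rewrite !big_nat; apply: ler_sum => i /andP[ki _].
    rewrite -mulrA -exprD subnKC// Normc.normcM normcX mx.
    have -> : modulus (c i) * x ^+ i = (modulus (c i) * s ^+ i) * (x / s) ^+ i.
      by rewrite -mulrA -exprMn mulrCA mulfV ?mulr1// gt_eqF.
    by rewrite ler_wpM2r ?exprn_ge0.
  rewrite -mulr_sumr ler_wpM2l ?mulr_ge0 ?exprn_ge0//.
  rewrite -{1}[k.+1]add0n big_addn big_mkord.
  under eq_bigr do rewrite addnK.
  apply: le_trans (geometric_sum_le _ q0 q1) _.
  by rewrite -[leRHS]invrK lef_pV2 ?posrE ?subr_gt0//; lra.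
have := csum_to_tail S tail; rewrite big_ord_recr /= big1 ?add0r ?add0r; last first.
  by move=> i _; rewrite (IH i) ?mul0r.
rewrite normcN Normc.normcM normcX mx expr_div_n => h.
have xk : 0 < x ^+ k by rewrite exprn_gt0.
rewrite -(ler_pM2r xk) (le_trans h)// /K le_eqVlt; apply/orP; left; apply/eqP.
by rewrite exprS; field; rewrite gt_eqF.
Qed.

(** f itself need not be bounded. For rho < s < 1 the dilation f(s z) is bounded and Lipschitz on
    the disc, and the radius rho becomes rho / s. *)
Lemma bloch_local_taylor f (rho : R) : bloch f -> 0 < rho -> rho < 1 ->
  exists a (M : R), (forall k, modulus (a k) * rho ^+ k <= M) /\
    forall w, modulus w < rho -> csum_to (fun k => a k * w ^+ k) (f w).
Proof.
move=> /bloch_iff[_ [f' [M H]]] rho0 rho1.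
pose s : R := (1 + rho) / 2.
have s1 : s < 1 by rewrite /s; lra.
have rs : rho < s by rewrite /s; lra.
have s0 : 0 < s by exact: lt_trans rs.
have sC0 : s%:C != 0 :> C by rewrite eq_complex /= gt_eqF.
have ms : modulus (s%:C : C) = s by rewrite real_complex_modulus// ltW.
have disc_s z : disc z -> modulus (s%:C * z) <= s.
  by move=> z1; rewrite Normc.normcM ms ler_piMr ?(ltW s0)// ltW.
have M0 : 0 <= M.
  have [_] := H 0 disc0.
  by rewrite Normc.normc0 expr0n /= subr0 mul1r; apply: le_trans; exact: normc_ge0.
pose L := M / (1 - s ^+ 2).
have s2 : 0 < 1 - s ^+ 2 by rewrite subr_gt0 exprn_ilt1// ltW.
have L0 : 0 <= L by rewrite divr_ge0// ltW.
have lip := bloch_lipschitz H (ltW s0) s1.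
have [|||||a [N [aN aS]]] := @local_taylor R (fun z => f (s%:C * z)) (fun z => s%:C * f' (s%:C * z))
   (modulus (f 0) + L) L (rho / s) L0.
- move=> z z1; have [fd _] := H _ (le_lt_trans (disc_s z z1) s1).
  move=> e e0; have [d d0 Hd] := fd _ e0.
  exists d => // h hd; rewrite mulrDr.
  have sh : modulus (s%:C * h) <= modulus h.
    by rewrite Normc.normcM ms ler_piMl ?normc_ge0// ltW.
  have := Hd (s%:C * h) (le_lt_trans sh hd).
  rewrite -mulrA [h * (_ * _)]mulrCA mulrA => h1; apply: le_trans h1 _.
  by rewrite ler_wpM2l// ltW.
- move=> z z1; rewrite -(subrK (f 0) (f _)) (le_trans (normcD _ _))// addrC lerD2l.
  have m0 : modulus (0 : C) <= s by rewrite Normc.normc0 ltW.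
  apply: le_trans (lip 0 _ m0 (disc_s z z1)) _; rewrite subr0 -/L.
  by rewrite ler_piMr// (le_trans (disc_s _ z1))// ltW.
- move=> x y x1 y1; apply: le_trans (lip _ _ (disc_s _ x1) (disc_s _ y1)) _.
  rewrite -mulrBr -/L ler_wpM2l// Normc.normcM ms.
  by rewrite ler_piMl ?normc_ge0// ltW.
- by rewrite divr_gt0.
- by rewrite ltr_pdivrMr// mul1r.
exists (fun k => a k * (s%:C)^-1 ^+ k), N; split.
  move=> k; rewrite Normc.normcM normcX Normc.normcV ms -mulrA -exprMn [s^-1 * _]mulrC.
  exact: aN.
move=> w wrho.
have sw : modulus (s%:C^-1 * w) < rho / s.
  by rewrite Normc.normcM Normc.normcV ms mulrC ltr_pM2r// invr_gt0.
have := aS _ sw; rewrite mulrA mulfV// mul1r.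
have -> // : (fun k => a k * s%:C^-1 ^+ k * w ^+ k) = (fun k => a k * (s%:C^-1 * w) ^+ k).
by apply/funext => k; rewrite exprMn mulrA.
Qed.

(** The local expansions for all radii agree with the one for radius 1/2 by [power_series_eq0], so a
    single sequence serves every radius below 1. *)
Lemma bloch_taylor f : bloch f -> exists2 a, tame a & f = psum a.
Proof.
move=> bf; have h0 : 0 < (2^-1 : R) by rewrite invr_gt0.
have h1 : (2^-1 : R) < 1 by lra.
have [a [M [aM aS]]] := bloch_local_taylor bf h0 h1.
have same (rho : R) : 0 < rho -> rho < 1 -> (exists N, forall k, modulus (a k) * rho ^+ k <= N) /\
    forall w, modulus w < rho -> csum_to (fun k => a k * w ^+ k) (f w).
  move=> r0 r1; have [b [N [bN bS]]] := bloch_local_taylor bf r0 r1.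
  suff ab : a = b by rewrite ab; split=> //; exists N.
  pose s := Num.min rho 2^-1.
  have s0 : 0 < s by rewrite lt_min r0.
  have sr : s <= rho by rewrite ge_min lexx.
  have sh : s <= 2^-1 by rewrite ge_min lexx orbT.
  apply/funext => k; apply/eqP; rewrite -subr_eq0; apply/eqP.
  apply: (@power_series_eq0 (fun k => a k - b k) s (M + N) s0).
    move=> j; apply: le_trans (ler_wpM2r _ (normcB _ _)) _.
      by rewrite exprn_ge0// ltW.
    rewrite mulrDl lerD//.
      apply: le_trans (aM j); rewrite ler_wpM2l ?normc_ge0//.
      by apply: lerXn2r; rewrite ?nnegrE ?(ltW s0) ?(ltW h0).
    apply: le_trans (bN j); rewrite ler_wpM2l ?normc_ge0//.
    by apply: lerXn2r; rewrite ?nnegrE ?(ltW s0) ?(ltW r0).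
  move=> w ws; have := csum_toB (aS w (lt_le_trans ws sh)) (bS w (lt_le_trans ws sr)).
  by rewrite subrr; congr csum_to; apply/funext => n; rewrite mulrBl.
have ta : tame a.
  move=> r r0 r1; pose r' : R := (1 + r) / 2.
  have rr : r < r' by rewrite /r'; lra.
  have r'0 : 0 < r' by exact: le_lt_trans r0 rr.
  have r'1 : r' < 1 by rewrite /r'; lra.
  have [[N HN] _] := same r' r'0 r'1; exists N => n.
  apply: le_trans (HN n); rewrite ler_wpM2l ?normc_ge0//.
  by apply: lerXn2r; rewrite ?nnegrE ?(ltW r'0)// ltW.
exists a => //; apply/funext => z; have [z1|z1] := pselect (disc z); last first.
  rewrite psum_out//; have /bloch_iff[f0 _] := bf; exact: f0.
apply/esym/psumE => //.
pose r' : R := (1 + modulus z) / 2.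
have zr : modulus z < r' by move: z1; rewrite /disc /= /r'; lra.
have r'0 : 0 < r' by exact: le_lt_trans (normc_ge0 z) zr.
have r'1 : r' < 1 by move: z1; rewrite /disc /= /r'; lra.
by have [_ +] := same r' r'0 r'1; apply.
Qed.

End bloch_taylor.

(** * Block estimates and the predual *)

Section bloch_blocks.
Context {R : realType}.
Local Notation C := (Cplx R).
Local Notation modulus := (@Normc.normc R).
Local Notation T := (measurableTypeR R * measurableTypeR R)%type.
Local Notation Dm := (@to_complex R @^-1` disc : set T).
Local Notation I := (@area_integral R).
Local Notation area0 := (@area0 R).
Implicit Types (f : C -> C) (z w : C) (a b c u : nat -> C).

Lemma cderiv_unique f z (d d' : C) : cderiv f z d -> cderiv f z d' -> d = d'.
Proof. by move=> /cderivP[_ <-] /cderivP[_ <-]. Qed.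

Lemma csum_to_shift u (s : C) m : csum_to u s ->
  csum_to (fun n => if (n < m)%N then 0 else u (n - m)%N) s.
Proof.
move=> us e e0; have [n0 H] := us _ e0; exists (n0 + m)%N => n nn.
have mn : (m <= n)%N by apply: leq_trans nn; rewrite leq_addl.
rewrite -(big_mkord xpredT (fun n => if (n < m)%N then 0 else u (n - m)%N)).
rewrite (big_cat_nat (leq0n m) mn)/= big_nat big1 ?add0r; last first.
  by move=> i /andP[_ ->].
rewrite -{1}[m]add0n big_addn big_mkord.
under eq_bigr do rewrite ltnNge leq_addl /= addnK.
by apply: H; rewrite leq_subRL// addnC.
Qed.

Lemma sum_le_csum_to (x : nat -> R) (s : C) n : (forall k, 0 <= x k) ->
  csum_to (fun k => (x k)%:C) s -> \sum_(k < n) x k <= modulus s.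
Proof.
move=> x0 xs; apply/ler_addgt0Pr => e e0; have [N H] := xs _ e0.
have := H _ (leq_maxl N n); set m := maxn N n => h.
have nm : (n <= m)%N by rewrite leq_maxr.
apply: (@le_trans _ _ (\sum_(k < m) x k)).
  rewrite -!(big_mkord xpredT x) [leRHS](big_cat_nat (leq0n n) nm)/= lerDl.
  by rewrite sumr_ge0.
have -> : \sum_(k < m) x k = modulus (\sum_(k < m) (x k)%:C).
  rewrite -(rmorph_sum (real_complex R)) real_complex_modulus//.
  by rewrite sumr_ge0.
rewrite -{1}(subrK s (\sum_(k < m) _)) (le_trans (normcD _ _))//.
by rewrite addrC lerD2l.
Qed.

Lemma aint_real_le (k : C -> R) (c : R) m : bm (fun z => (k z)%:C) ->
  (forall z, disc z -> 0 <= k z <= c * modulus z ^+ (2 * m)) ->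
  modulus (I (fun z => (k z)%:C)) <= c * moment m.
Proof.
move=> [b1 b2] kc; rewrite (le_trans (normc_le_ReIm _))//=.
have -> : Rintegral (@area R) Dm (fun p => complex.Im ((k (to_complex p))%:C)) = 0.
  transitivity (Rintegral (@area R) Dm (fun=> 0)); first by apply: eq_Rintegral => p _.
  by rewrite Rintegral_cst ?mul0r//; exact: measurable_Dm.
rewrite normr0 addr0 ger0_norm; last first.
  by apply: Rintegral_ge0 => p Dp /=; have /andP[] := kc _ Dp.
have bN := @bmr_modX R (2 * m).
rewrite /moment -RintegralZl; last 2 first.
- exact: measurable_Dm.
- exact: bmr_integrable.
apply: le_Rintegral.
- exact: measurable_Dm.
- exact: bmr_integrable.
- by apply: bmr_integrable; apply: bmrM => //; exact: bmr_cst.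
- by move=> p Dp /=; have /andP[] := kc _ Dp.
Qed.

(* Parseval's identity for z^m f'(r z). *)
Lemma bloch_weighted_bound a (M : R) : tame a ->
  (forall z, disc z -> (1 - modulus z ^+ 2) * modulus (psum (dcoef a) z) <= M) ->
  forall m n (r : R), 0 < r -> r < 1 ->
  \sum_(k < n) modulus (dcoef a k) ^+ 2 * r ^+ (2 * k) * moment (k + m)
    <= (M / (1 - r ^+ 2)) ^+ 2 * moment m.
Proof.
move=> ta H m n r r0 r1.
pose v k := dcoef a k * (r ^+ k)%:C.
pose u k := if (k < m)%N then 0 else v (k - m)%N.
have r2 : 0 < 1 - r ^+ 2 by rewrite subr_gt0 exprn_ilt1// ltW.
have td := tame_dcoef ta.
have mv k : modulus (v k) = modulus (dcoef a k) * r ^+ k.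
  by rewrite Normc.normcM real_complex_modulus// exprn_ge0// ltW.
have [B HB] := tame_sum_le td (ltW r0) r1.
have uB : asum u B.
  move=> l; apply: (@le_trans _ _ (\sum_(k < m + l) modulus (u k))).
    rewrite -!(big_mkord xpredT (fun k => modulus (u k))).
    rewrite [leRHS](big_cat_nat (leq0n l) (leq_addl m l))/= lerDl.
    by rewrite sumr_ge0// => k _; exact: normc_ge0.
  rewrite big_split_ord /= big1 ?add0r; last first.
    by move=> i _; rewrite /u ltn_ord Normc.normc0.
  apply: le_trans (HB l); apply: ler_sum => i _.
  by rewrite /u ltnNge leq_addr /= addKn mv.
have Uz z : disc z -> psum u z = z ^+ m * psum (dcoef a) (r%:C * z).
  move=> z1; have rz1 : disc (r%:C * z).
    rewrite /disc /mkset Normc.normcM real_complex_modulus ?(ltW r0)//.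
    by rewrite (le_lt_trans _ z1)// ler_piMl ?normc_ge0// ltW.
  apply: psumE => //.
  have := csum_toZ (z ^+ m) (csum_to_shift m (psumP td rz1)).
  have -> // : (fun k => z ^+ m * (if (k < m)%N then 0 else dcoef a (k - m) * (r%:C * z) ^+ (k - m))) =
      (fun n0 => u n0 * z ^+ n0).
  apply/funext => k; rewrite /u /v; case: ltnP => km; first by rewrite mulr0 mul0r.
  have -> : z ^+ k = z ^+ m * z ^+ (k - m) by rewrite -exprD subnKC.
  by rewrite exprMn rmorphXn /=; ring.
have S := aint_psum uB uB.
pose x k := modulus (u k) ^+ 2 * moment k.
have x0 k : 0 <= x k by rewrite mulr_ge0 ?sqr_ge0// ltW// moment_gt0.
have xE : (fun k => u k * conjc (u k) * (moment k)%:C) = (fun k => (x k)%:C).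
  by apply/funext => k; rewrite mulcJ -rmorphM.
rewrite xE in S.
have h1 := sum_le_csum_to (m + n) x0 S.
have E1 : \sum_(k < m + n) x k = \sum_(k < n) modulus (dcoef a k) ^+ 2 * r ^+ (2 * k) * moment (k + m).
  rewrite big_split_ord /= big1 ?add0r; last first.
    by move=> i _; rewrite /x /u ltn_ord Normc.normc0 expr0n /= mul0r.
  apply: eq_bigr => i _.
  rewrite /x /u ltnNge leq_addr /= addKn mv exprMn -exprM [(i * 2)%N]mulnC.
  by rewrite addnC.
rewrite -E1; apply: le_trans h1 _.
pose k z := modulus (psum u z) ^+ 2.
have Ik : I (fun z => psum u z * conjc (psum u z)) = I (fun z => (k z)%:C).
  by apply: eq_aint => z _; rewrite mulcJ.
rewrite Ik; apply: aint_real_le.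
  have := bmM (bm_psum uB) (bm_conj (bm_psum uB)).
  by congr bm; apply/funext => z; rewrite mulcJ.
move=> z z1; rewrite /k sqr_ge0 /= Uz// Normc.normcM normcX.
rewrite exprMn -exprM mulnC mulrC ler_wpM2r ?exprn_ge0 ?normc_ge0//.
have rz : modulus (r%:C * z) <= r.
  rewrite Normc.normcM real_complex_modulus ?(ltW r0)//.
  by rewrite ler_piMr ?(ltW r0)// ltW.
have {}rz1 : disc (r%:C * z) by exact: le_lt_trans rz r1.
have h : modulus (psum (dcoef a) (r%:C * z)) <= M / (1 - r ^+ 2).
  rewrite ler_pdivlMr// mulrC; apply: le_trans (H _ rz1).
  by rewrite ler_wpM2r ?normc_ge0// one_sub_sqr_modulus_ge.
have h0 : 0 <= modulus (psum (dcoef a) (r%:C * z)) by exact: normc_ge0.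
by apply: lerXn2r => //; rewrite nnegrE// (le_trans h0).
Qed.

(** The offset by one makes the blocks cover n = 0 and start at the exponents 4^p - 1 of the
    lacunary series. *)
Definition block_sum (x : nat -> R) p := \sum_((4 ^ p).-1 <= n < (4 ^ p.+1).-1) x n.

Lemma bernoulli_le (x : R) k : 0 <= x -> x <= 1 -> 1 - k%:R * x <= (1 - x) ^+ k.
Proof.
move=> x0 x1; elim: k => [|k IH]; first by rewrite mul0r subr0 expr0.
have x1' : 0 <= 1 - x by rewrite subr_ge0.
rewrite exprS; apply: le_trans (ler_wpM2l x1' IH).
have : 0 <= (k%:R : R) by [].
rewrite -natr1; move: (k%:R : R) => t t0; nra.
Qed.

Lemma block_arith m k : (4 <= m -> m.-1.-1 <= k -> k < 4 * m ->
  [/\ m <= k.+1 * 2, 2 * k <= 8 * m & (k + m).+1 <= 5 * m])%N.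
Proof. by move=> m4 k1 k2; split; lia. Qed.

Lemma block_arith_bounds m : (4 <= m ->
  [/\ 0 < m.-1, m.-1.-1 <= (4 * m).-2 & (4 * m).-2 <= 4 * m])%N.
Proof. by move=> m4; split; lia. Qed.

(** Take m = 4^p with p >= 1 and r = 1 - 1/(16 m) in [bloch_weighted_bound]. On the block (k+1)^2 >=
    (m/2)^2, r^(2k) >= 1/2 and moment (k+m) >= area/(5m), so the left side is at least (m/40) area
    times the block sum; the right side is at most 256 M^2 m area, and 10240 = 40 * 256. The weight
    z^m concentrates the integral near the circle: the moment of order 1/m which it brings to the
    right side makes the bound uniform in m. The block p = 0 is added by hand. *)
Lemma bloch_block_bound a : tame a -> bloch (psum a) ->
  exists K : R, forall p, block_sum (fun n => modulus (a n) ^+ 2) p <= K.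
Proof.
move=> ta /bloch_iff[_ [f' [M HM]]].
have H z : disc z -> (1 - modulus z ^+ 2) * modulus (psum (dcoef a) z) <= M.
  move=> z1; have [fd h] := HM z z1.
  by rewrite (cderiv_unique (psum_cderiv ta z1) fd).
have M2 : 0 <= M ^+ 2 by exact: sqr_ge0.
have s3 : 0 <= \sum_(0 <= n < 3) modulus (a n) ^+ 2.
  by rewrite sumr_ge0// => i _; exact: sqr_ge0.
exists (10240%:R * M ^+ 2 + \sum_(0 <= n < 3) modulus (a n) ^+ 2) => -[|p].
  by rewrite /block_sum /= lerDr mulr_ge0.
apply: (@le_trans _ _ (10240%:R * M ^+ 2)); last by rewrite lerDl.
pose m := (4 ^ p.+1)%N.
have m4 : (4 <= m)%N by rewrite /m expnS leq_pmulr// expn_gt0.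
have mR : 4%:R <= (m%:R : R) by rewrite ler_nat.
have mR0 : 0 < (m%:R : R) by apply: lt_le_trans mR.
pose r : R := 1 - (16%:R * m%:R)^-1.
have d0 : 0 < (16%:R * m%:R : R)^-1 by rewrite invr_gt0 mulr_gt0.
have d1 : (16%:R * m%:R : R)^-1 < 1 by rewrite invf_lt1 ?mulr_gt0//; lra.
have r0 : 0 < r by rewrite subr_gt0.
have r1 : r < 1 by rewrite /r; lra.
have := bloch_weighted_bound ta H m (4 * m) r0 r1.
have A0 := @area0_gt0 R.
have r2 : (16%:R * m%:R)^-1 <= 1 - r ^+ 2.
  have : r ^+ 2 <= r by rewrite expr2 ler_piMr// ltW.
  by rewrite /r; lra.
have r8 : 2^-1 <= r ^+ (8 * m).
  apply: le_trans (bernoulli_le (8 * m) (ltW d0) (ltW d1)).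
  rewrite natrM invfM.
  have -> : 8%:R * m%:R * (16%:R^-1 * m%:R^-1) = 2^-1 :> R by field; rewrite gt_eqF.
  by lra.
have rhs : (M / (1 - r ^+ 2)) ^+ 2 * moment m <= 256%:R * M ^+ 2 * m%:R * area0.
  rewrite moment_eq exprMn.
  have r20 : 0 < 1 - r ^+ 2 by apply: lt_le_trans r2.
  have h1 : (1 - r ^+ 2)^-1 ^+ 2 <= (16%:R * m%:R) ^+ 2.
    apply: lerXn2r; rewrite ?nnegrE ?invr_ge0 ?(ltW r20) ?mulr_ge0//.
    by rewrite -[leRHS]invrK lef_pV2 ?posrE.
  have h2 : area0 / m.+1%:R <= area0 / m%:R.
    by rewrite ler_wpM2l ?(ltW A0)// lef_pV2 ?posrE// ler_nat.
  apply: (@le_trans _ _ (M ^+ 2 * (16%:R * m%:R) ^+ 2 * (area0 / m%:R))).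
    apply: ler_pM => //; first by rewrite mulr_ge0// sqr_ge0.
      by rewrite divr_ge0// ltW.
    by rewrite ler_wpM2l.
  rewrite le_eqVlt; apply/orP; left; apply/eqP; field; by rewrite gt_eqF.
move=> /le_trans /(_ rhs) bnd.
have term k : ((m.-1).-1 <= k)%N -> (k < 4 * m)%N ->
    modulus (a k.+1) ^+ 2 * (m%:R / 40%:R * area0) <=
    modulus (dcoef a k) ^+ 2 * r ^+ (2 * k) * moment (k + m).
  move=> k1 k2.
  have [u1 u2 u3] := block_arith m4 k1 k2.
  rewrite /dcoef Normc.normcM modulus_nat moment_eq exprMn.
  have t1 : (m%:R / 2 : R) ^+ 2 <= k.+1%:R ^+ 2.
    apply: lerXn2r; rewrite ?nnegrE ?divr_ge0//.
    by rewrite ler_pdivrMr// -natrM ler_nat.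
  have t2 : 2^-1 <= r ^+ (2 * k).
    by apply: le_trans r8 _; apply: ler_wiXn2l; rewrite ?(ltW r0) ?(ltW r1).
  have t3 : area0 / (5%:R * m%:R) <= area0 / (k + m).+1%:R.
    by rewrite ler_wpM2l ?(ltW A0)// lef_pV2 ?posrE ?mulr_gt0// -natrM ler_nat.
  apply: (@le_trans _ _ ((m%:R / 2) ^+ 2 * modulus (a k.+1) ^+ 2 * 2^-1 * (area0 / (5%:R * m%:R)))).
    rewrite le_eqVlt; apply/orP; left; apply/eqP; field; by rewrite gt_eqF.
  have i2 : 0 <= (2^-1 : R) by rewrite invr_ge0.
  have P0 : 0 <= (m%:R / 2 : R) ^+ 2 * modulus (a k.+1) ^+ 2.
    exact: mulr_ge0 (sqr_ge0 _) (sqr_ge0 _).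
  apply: ler_pM => //; first exact: mulr_ge0.
    by rewrite divr_ge0 ?(ltW A0)// mulr_ge0.
  apply: ler_pM => //.
  by rewrite ler_wpM2r ?sqr_ge0.
have c0 : 0 < m%:R / 40%:R * area0 :> R by rewrite !mulr_gt0// invr_gt0.
rewrite -(ler_pM2r c0) /block_sum mulr_suml.
have [m1 l1 l2] := block_arith_bounds m4.
have bE : \sum_((4 ^ p.+1).-1 <= n < (4 ^ p.+2).-1) modulus (a n) ^+ 2 * (m%:R / 40%:R * area0) =
   \sum_((m.-1).-1 <= k < (4 ^ p.+2).-2) modulus (a k.+1) ^+ 2 * (m%:R / 40%:R * area0).
  rewrite -/m -{1}(prednK m1) -[X in \sum_(_ <= n < X) _ = _]prednK; last first.
    by rewrite -subn1 subn_gt0 -[X in (X < _)%N](expn0 4) ltn_exp2l.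
  by rewrite big_add1 /=.
rewrite bE.
have mm : (4 ^ p.+2).-2 = (4 * m).-2 by rewrite expnS.
rewrite mm.
apply: (@le_trans _ _ (\sum_(k < 4 * m) modulus (dcoef a k) ^+ 2 * r ^+ (2 * k) * moment (k + m))).
  rewrite -(big_mkord xpredT (fun k => modulus (dcoef a k) ^+ 2 * r ^+ (2 * k) * moment (k + m))).
  have nn k : 0 <= modulus (dcoef a k) ^+ 2 * r ^+ (2 * k) * moment (k + m).
    apply: mulr_ge0; last by rewrite ltW// moment_gt0.
    by apply: mulr_ge0; [exact: sqr_ge0|rewrite exprn_ge0// ltW].

  rewrite [leRHS](big_cat_nat (leq0n m.-1.-1) (leq_trans l1 l2))/=.
  rewrite [X in _ <= _ + X](big_cat_nat l1 l2)/=.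
  apply: ler_wpDl; first by rewrite sumr_ge0.
  apply: ler_wpDr; first by rewrite sumr_ge0.
  rewrite !big_nat; apply: ler_sum => k /andP[k1 k2]; apply: term => //.
  exact: leq_trans k2 l2.
apply: le_trans bnd _.
rewrite le_eqVlt; apply/orP; left; apply/eqP; by field.
Qed.

End bloch_blocks.

(** * Block-summable sequences and their pairing with Bloch functions *)

Section predual.
Context {R : realType}.
Local Notation C := (Cplx R).
Local Notation modulus := (@Normc.normc R).
Local Notation area0 := (@area0 R).
Implicit Types (z w : C) (a b c u y : nat -> C).

Lemma pow4_pred_le p : ((4 ^ p).-1 <= (4 ^ p.+1).-1)%N.
Proof. by rewrite -!subn1 leq_sub2r// leq_exp2l. Qed.

Lemma sum_block_sum (x : nat -> R) P :
  \sum_(p < P) block_sum x p = \sum_(0 <= n < (4 ^ P).-1) x n.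
Proof.
elim: P => [|P IH]; first by rewrite big_ord0 expn0 big_geq.
by rewrite big_ord_recr /= IH /block_sum -big_cat_nat ?pow4_pred_le.
Qed.

Lemma sum_cauchy_schwarz (r : seq nat) (x t : nat -> R) :
  \sum_(n <- r) x n * t n <=
  Num.sqrt (\sum_(n <- r) x n ^+ 2) * Num.sqrt (\sum_(n <- r) t n ^+ 2).
Proof.
set X := \sum_(n <- r) x n ^+ 2; set Y := \sum_(n <- r) t n ^+ 2.
set Z := \sum_(n <- r) x n * t n.
have X0 : 0 <= X by rewrite sumr_ge0// => i _; exact: sqr_ge0.
have Y0 : 0 <= Y by rewrite sumr_ge0// => i _; exact: sqr_ge0.
have E l : 0 <= X - 2 * l * Z + l ^+ 2 * Y.
  have -> : X - 2 * l * Z + l ^+ 2 * Y = \sum_(n <- r) (x n - l * t n) ^+ 2.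
    rewrite /X /Y /Z !mulr_sumr -sumrB -big_split /=; apply: eq_bigr => n _; ring.
  by rewrite sumr_ge0// => i _; exact: sqr_ge0.
have ZXY : Z ^+ 2 <= X * Y.
  have [Y00|Yn0] := eqVneq Y 0.
    have Z0 : Z = 0.
      rewrite /Z big_seq big1// => n nr.
      have : t n ^+ 2 == 0.
        have /eqP := Y00; rewrite /Y psumr_eq0; last by move=> i _; exact: sqr_ge0.
        by move=> /allP /(_ n nr).
      by rewrite sqrf_eq0 => /eqP ->; rewrite mulr0.
    by rewrite Z0 Y00 mulr0 expr0n.
  have Yp : 0 < Y by rewrite lt_neqAle eq_sym Yn0.
  have := E (Z / Y).
  have -> : X - 2 * (Z / Y) * Z + (Z / Y) ^+ 2 * Y = (X * Y - Z ^+ 2) / Y by field.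
  by rewrite pmulr_lge0 ?invr_gt0// subr_ge0.
rewrite -sqrtrM// (le_trans (ler_norm _))// -sqrtr_sqr ler_sqrt// mulr_ge0//.
Qed.

Definition block_norm y p : R := Num.sqrt (block_sum (fun n => modulus (y n) ^+ 2) p).

(* The predual of the sequences with uniformly bounded block norms. *)
Definition block_summable y : Prop := exists B : R, forall P, \sum_(p < P) block_norm y p <= B.

Lemma block_norm_ge0 y p : 0 <= block_norm y p. Proof. exact: sqrtr_ge0. Qed.

Lemma block_sqr_ge0 y p : 0 <= block_sum (fun n => modulus (y n) ^+ 2) p.
Proof. by rewrite sumr_ge0// => i _; exact: sqr_ge0. Qed.

Lemma in_block n : exists p, ((4 ^ p).-1 <= n < (4 ^ p.+1).-1)%N.
Proof.
exists (trunc_log 4 n.+1).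
have /andP[h1 h2] := @trunc_log_bounds 4 n.+1 isT isT.
have e1 : (0 < 4 ^ trunc_log 4 n.+1)%N by rewrite expn_gt0.
by move: h1 h2 e1; move: (4 ^ trunc_log 4 n.+1)%N (4 ^ (trunc_log 4 n.+1).+1)%N => A B; lia.
Qed.

Lemma modulus_le_block_norm y p n : ((4 ^ p).-1 <= n < (4 ^ p.+1).-1)%N ->
  modulus (y n) <= block_norm y p.
Proof.
move=> np; rewrite -[leLHS]ger0_norm ?normc_ge0// -sqrtr_sqr ler_sqrt ?block_sqr_ge0//.
rewrite /block_sum (big_rem n) ?mem_index_iota//= lerDl sumr_ge0// => i _.
exact: sqr_ge0.
Qed.

Lemma block_summable_bounded y : block_summable y -> exists B, forall n, modulus (y n) <= B.
Proof.
move=> [B HB]; exists B => n; have [p np] := in_block n.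
apply: le_trans (modulus_le_block_norm y np) (le_trans _ (HB p.+1)).
by rewrite big_ord_recr /= lerDr sumr_ge0// => i _; exact: block_norm_ge0.
Qed.

(** Cauchy-Schwarz inside each block, then the duality of l^1 and l^oo across the blocks. *)
Lemma block_duality y b (K : R) : block_summable y ->
  (forall p, block_sum (fun n => modulus (b n) ^+ 2) p <= K) ->
  exists B, asum (fun n => y n * conjc (b n)) B.
Proof.
move=> [B HB] HK; exists (B * Num.sqrt K) => n.
have nP : (n <= (4 ^ n).-1)%N by rewrite -ltnS prednK ?expn_gt0// ltn_expl.
rewrite -(big_mkord xpredT (fun k => modulus (y k * conjc (b k)))).
apply: (@le_trans _ _ (\sum_(0 <= k < (4 ^ n).-1) modulus (y k * conjc (b k)))).
  rewrite [leRHS](big_cat_nat (leq0n n) nP)/= lerDl sumr_ge0// => k _.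
  exact: normc_ge0.
rewrite -sum_block_sum.
apply: (@le_trans _ _ (\sum_(p < n) block_norm y p * Num.sqrt K)); last first.
  by rewrite -mulr_suml ler_wpM2r// sqrtr_ge0.
apply: ler_sum => p _; rewrite /block_sum.
under eq_bigr do rewrite Normc.normcM normc_conj.
apply: le_trans (sum_cauchy_schwarz _ _ _) _.
rewrite ler_wpM2l ?sqrtr_ge0// ler_sqrt; first exact: HK.
by apply: le_trans (HK p); exact: block_sqr_ge0.
Qed.

(** The shifted block p takes its entries from the blocks p and p+1, so its norm is at most the sum
    of theirs. *)
Lemma block_summable_shift y : block_summable y -> block_summable (fun n => y n.+1).
Proof.
move=> [B HB]; exists (B + B) => P.
apply: (@le_trans _ _ (\sum_(p < P) (block_norm y p + block_norm y p.+1))).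
  apply: ler_sum => p _; rewrite -[leRHS]ger0_norm ?addr_ge0 ?block_norm_ge0//.
  rewrite -sqrtr_sqr ler_sqrt ?sqr_ge0//.
  apply: (@le_trans _ _ (block_norm y p ^+ 2 + block_norm y p.+1 ^+ 2)); last first.
    by rewrite sqrrD addrAC lerDl mulrn_wge0// mulr_ge0// block_norm_ge0.
  rewrite /block_norm !sqr_sqrtr ?block_sqr_ge0// /block_sum.
  have l1 := pow4_pred_le p; have l2 := pow4_pred_le p.+1.
  have l3 : ((4 ^ p.+1).-1.+1 <= (4 ^ p.+2).-1)%N.
    by rewrite prednK ?expn_gt0// -ltnS prednK ?expn_gt0// ltn_exp2l.
  rewrite -(big_cat_nat l1 l2) -(big_add1 _ _ _ _ xpredT (fun n => modulus (y n) ^+ 2)).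
  rewrite [leRHS](big_cat_nat (n := (4 ^ p.+1).-1.+1))//=; last exact: leqW.
  apply: ler_wpDr; first by rewrite sumr_ge0// => i _; exact: sqr_ge0.
  have e1 : (4 ^ p.+1).-1.+1 = (4 ^ p.+1)%N by rewrite prednK ?expn_gt0.
  have l0 : ((4 ^ p).-1 < 4 ^ p.+1)%N by rewrite prednK ?expn_gt0// leq_exp2l.
  by rewrite e1 [leRHS]big_ltn// lerDr sqr_ge0.
rewrite big_split /=; apply: lerD; first exact: HB.
apply: le_trans (HB P.+1).
have -> : \sum_(p < P.+1) block_norm y p =
    block_norm y 0 + \sum_(p < P) block_norm y p.+1 by rewrite big_ord_recl.
by rewrite lerDr; exact: block_norm_ge0.
Qed.

Definition predual_coef y : nat -> C := fun n => y n * ((moment n)^-1)%:C.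

Lemma tame_predual_coef y : block_summable y -> tame (predual_coef y).
Proof.
move=> /block_summable_bounded[B HB].
have ty := tame_bounded HB.
have := tameZ (area0^-1)%:C (tameD (tame_natmul ty) ty).
congr tame; apply/funext => n; rewrite /predual_coef moment_eq invfM invrK rmorphM /=.
rewrite -natr1 rmorphD rmorph1 rmorph_nat; ring.
Qed.

Lemma pairing_predual y b : block_summable y -> tame b -> bloch (psum b) ->
  csum_to (fun n => y n * conjc (b n)) (pairing (psum (predual_coef y)) (psum b)).
Proof.
move=> sy tb bb; have [K HK] := bloch_block_bound tb bb.
have [B HB] := block_duality sy HK.
have [S HS] := csum_to_ex HB.
have E : (fun n => predual_coef y n * conjc (b n) * (moment n)%:C) =
    (fun n => y n * conjc (b n)).
  apply/funext => n; rewrite /predual_coef mulrAC -[_ * _ * (moment n)%:C]mulrA -rmorphM.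
  by rewrite mulVf ?gt_eqF ?moment_gt0// rmorph1 mulr1.
by rewrite (@pairing_psum _ _ _ B S) ?E//; exact: tame_predual_coef.
Qed.

End predual.

(** * Membership in the Bergman space *)

Section bergman_membership.
Context {R : realType}.
Local Notation C := (Cplx R).
Local Notation modulus := (@Normc.normc R).
Local Notation T := (measurableTypeR R * measurableTypeR R)%type.
Local Notation Dm := (@to_complex R @^-1` disc : set T).
Local Notation area0 := (@area0 R).
Local Notation area := (@area R).
Implicit Types (z w : C) (a b c u y : nat -> C).

Lemma big_nat_window (V : nmodType) (F : nat -> V) (a k : nat) :
  \sum_(a <= n < a + k) F n = \sum_(j < k) F (a + j)%N.
Proof.
rewrite -{1}[a]add0n [(a + k)%N]addnC big_addn addnK big_mkord.
by apply: eq_bigr => j _; rewrite addnC.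
Qed.

Lemma normc_dist_le (z w : C) : `|modulus z - modulus w| <= modulus (z - w).
Proof. by rewrite ler_norml lerNl opprB {1}normc_distC !normcBr_ge. Qed.

Definition mod_integral (h : C -> C) : R :=
  Rintegral area Dm (fun p => modulus (h (to_complex p))).

Lemma bmr_modulus (h : C -> C) : bm h -> bmr (fun p : T => modulus (h (to_complex p))).
Proof.
move=> /bmE[m1 m2 [M HM]]; split; last first.
  by exists M => p Dp; rewrite ger0_norm ?normc_ge0// HM.
have -> : (fun p : T => modulus (h (to_complex p))) =
   (fun p : T => (complex.Re (h (to_complex p)) ^+ 2 + complex.Im (h (to_complex p)) ^+ 2) `^ 2^-1).
  apply/funext => p; rewrite powR12_sqrt ?addr_ge0 ?sqr_ge0//.
  by rewrite -normc_sq sqrtr_sqr ger0_norm ?normc_ge0.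
apply: (@measurableT_comp _ _ _ _ _ _ (fun x : R => x `^ 2^-1)).
  exact: measurable_powR.
by apply: measurable_funD; exact: measurable_funX.
Qed.

Lemma mod_integral_poly_sq c J s :
  Rintegral area Dm (fun p => modulus (\sum_(j < J) c j * to_complex p ^+ (j + s)) ^+ 2) =
  \sum_(j < J) modulus (c j) ^+ 2 * moment (j + s).
Proof.
pose u k := if (k < s)%N then 0 else c (k - s)%N.
have E (z : C) : \sum_(j < J) c j * z ^+ (j + s) = \sum_(k < s + J) u k * z ^+ k.
  rewrite big_split_ord /= [X in _ = X + _]big1 ?add0r; last first.
    by move=> i _; rewrite /u ltn_ord mul0r.
  by apply: eq_bigr => i _; rewrite /u ltnNge leq_addr /= addKn addnC.
have := aint_poly u u (s + J).
have -> : \sum_(k < s + J) u k * conjc (u k) * (moment k)%:C =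
    (\sum_(j < J) modulus (c j) ^+ 2 * moment (j + s))%:C.
  rewrite [RHS]rmorph_sum [LHS]big_split_ord /= [X in X + _]big1 ?add0r; last first.
    by move=> i _; rewrite /u ltn_ord !mul0r.
  apply: eq_bigr => i _.
  by rewrite mulcJ -rmorphM /u ltnNge leq_addr /= addKn addnC.
move=> /(congr1 (@complex.Re R)) /= <-; apply: eq_Rintegral => p _.
by rewrite E mulcJ.
Qed.

(* AM-GM; L will be about half the lowest degree of a block, and t balances the
   two terms. *)
Lemma mod_integral_poly_le c J L s (t : R) : 0 < t ->
  mod_integral (fun z => z ^+ L * \sum_(j < J) c j * z ^+ (j + s)) <=
  2^-1 * (t * moment L + t^-1 * \sum_(j < J) modulus (c j) ^+ 2 * moment (j + s)).
Proof.
move=> t0.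
have bG : bm (fun z : C => \sum_(j < J) c j * z ^+ (j + s)).
  apply: (@bm_sum _ 'I_J _ _ (fun (j : 'I_J) z => c j * z ^+ (j + s))) => j.
  by apply: bmM; [exact: bm_cst|apply: bmX; exact: bm_id].
have mG := bmr_modulus bG.
have bG2 : bmr (fun p : T => modulus (\sum_(j < J) c j * to_complex p ^+ (j + s)) ^+ 2).
  by have := bmrM mG mG; congr bmr; apply/funext => p; rewrite expr2.
have bL := @bmr_modX R (2 * L).
rewrite -mod_integral_poly_sq /moment -!RintegralZl; last first.
- by apply: bmr_integrable.
- exact: measurable_Dm.
- by apply: bmr_integrable.
- exact: measurable_Dm.
rewrite -RintegralD; last first.
- by apply: bmr_integrable; apply: bmrM => //; exact: bmr_cst.
- by apply: bmr_integrable; apply: bmrM => //; exact: bmr_cst.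
- exact: measurable_Dm.
have bs : bmr (fun p : T => t * modulus (to_complex p) ^+ (2 * L) +
    t^-1 * modulus (\sum_(j < J) c j * to_complex p ^+ (j + s)) ^+ 2).
  by apply: bmrD; apply: bmrM => //; exact: bmr_cst.
rewrite -RintegralZl; last first.
- exact: bmr_integrable.
- exact: measurable_Dm.
apply: le_Rintegral.
- exact: measurable_Dm.
- apply: bmr_integrable.
  apply: (@bmr_modulus (fun z => z ^+ L * \sum_(j < J) c j * z ^+ (j + s))).
  apply: bmM => //.
  by apply: bmX; exact: bm_id.
- by apply: bmr_integrable; apply: bmrM => //; exact: bmr_cst.
move=> p Dp; rewrite Normc.normcM normcX [(2 * L)%N]mulnC exprM.
move: (modulus (to_complex p) ^+ L) (modulus (\sum_(j < J) _)) => x v.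
rewrite -subr_ge0.
have -> : 2^-1 * (t * x ^+ 2 + t^-1 * v ^+ 2) - x * v = 2^-1 * t^-1 * (t * x - v) ^+ 2.
  by field; rewrite gt_eqF.
by apply: mulr_ge0 (sqr_ge0 _); rewrite mulr_ge0 ?invr_ge0 ?(ltW t0).
Qed.

Definition block_poly u p z : C := \sum_((4 ^ p).-1 <= n < (4 ^ p.+1).-1) u n * z ^+ n.

Lemma bm_block_poly u p : bm (block_poly u p).
Proof.
apply: (@bm_sum _ nat _ _ (fun n z => u n * z ^+ n)) => n.
by apply: bmM; [exact: bm_cst|apply: bmX; exact: bm_id].
Qed.

Lemma block_moment_bounds m j : (0 < m)%N -> (j < 3 * m)%N ->
  [/\ (m.-1)./2 <= m.-1, m <= (m.-1)./2.+1 * 2,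
      m <= (j + (m.-1 - (m.-1)./2)).+1 * 2 & (m.-1 + j).+1 <= 4 * m]%N.
Proof. by move=> m0 jm; split; lia. Qed.

(** With m = 4^p and L about m/2, moment L and the moments under the sum are at most 2 area/m, while
    1 / moment n <= 4m / area on the block. In [mod_integral_poly_le] the choice t = m eta gives
    (area + 16/area) eta. The e > 0 in eta = [block_norm y p] + e keeps t positive when the block
    vanishes. *)
Lemma mod_integral_block y p :
  mod_integral (block_poly (predual_coef y) p) <= (area0 + 16%:R / area0) * block_norm y p.
Proof.
have A0 := @area0_gt0 R; set A := area0 in A0 *.
pose Kc := A + 16%:R / A.
have K0 : 0 < Kc by rewrite addr_gt0// divr_gt0.
suff H (e : R) : 0 < e -> mod_integral (block_poly (predual_coef y) p) <= Kc * (block_norm y p + e).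
  apply/ler_addgt0Pr => e e0; apply: le_trans (H _ (divr_gt0 e0 K0)) _.
  by rewrite mulrDr lerD2l mulrCA mulfV ?mulr1// gt_eqF.
move=> e0.
pose m := (4 ^ p)%N; have m0 : (0 < m)%N by rewrite expn_gt0.
have mR0 : 0 < (m%:R : R) by rewrite ltr0n.
pose L := (m.-1)./2; pose s := (m.-1 - L)%N.
pose c j := predual_coef y (m.-1 + j).
have m3 : (4 ^ p.+1).-1 = (m.-1 + 3 * m)%N by rewrite expnS -/m; lia.
have E z : block_poly (predual_coef y) p z = z ^+ L * \sum_(j < 3 * m) c j * z ^+ (j + s).
  rewrite /block_poly -/m m3 big_nat_window mulr_sumr.
  apply: eq_bigr => j _; rewrite /c mulrCA -exprD.
  congr (_ * _ ^+ _); have [h1 _ _ _] := block_moment_bounds m0 (ltn_ord j).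
  by rewrite addnCA /s subnKC// addnC.
pose eta := block_norm y p + e.
have eta0 : 0 < eta by rewrite ltr_wpDl// block_norm_ge0.
have Y2 : block_sum (fun n => modulus (y n) ^+ 2) p <= eta ^+ 2.
  rewrite -[leLHS]sqr_sqrtr ?block_sqr_ge0//.
  apply: lerXn2r; rewrite ?nnegrE ?(ltW eta0) ?sqrtr_ge0//.
  by rewrite lerDl ltW.
have S2 : \sum_(j < 3 * m) modulus (c j) ^+ 2 * moment (j + s) <= 32%:R * m%:R / A * eta ^+ 2.
  apply: (@le_trans _ _ (\sum_(j < 3 * m) modulus (y (m.-1 + j)%N) ^+ 2 * (32%:R * m%:R / A))).
    apply: ler_sum => j _; have [h1 h2 h3 h4] := block_moment_bounds m0 (ltn_ord j).
    rewrite /c /predual_coef Normc.normcM exprMn real_complex_modulus; last first.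
      by rewrite invr_ge0 ltW// moment_gt0.
    rewrite -[leLHS]mulrA; apply: ler_wpM2l; first exact: sqr_ge0.
    rewrite !moment_eq -/A invfM invrK exprMn.
    have q1 : ((m.-1 + j).+1%:R : R) ^+ 2 <= (4%:R * m%:R) ^+ 2.
      by apply: lerXn2r; rewrite ?nnegrE ?mulr_ge0// -natrM ler_nat.
    have q2 : A / (j + s).+1%:R <= A * (2 / m%:R).
      rewrite ler_wpM2l ?(ltW A0)// ler_pdivlMr// mulrC ler_pdivrMr//.
      by rewrite mulrC -natrM ler_nat.
    apply: (@le_trans _ _ (A^-1 ^+ 2 * (4%:R * m%:R) ^+ 2 * (A * (2 / m%:R)))).
      apply: ler_pM => //.
      - by apply: mulr_ge0; exact: sqr_ge0.
      - by rewrite divr_ge0// ltW.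
      - by rewrite ler_wpM2l ?sqr_ge0.
    by rewrite le_eqVlt; apply/orP; left; apply/eqP; field; rewrite !gt_eqF.
  rewrite -mulr_suml mulrC ler_wpM2l ?divr_ge0 ?mulr_ge0 ?(ltW A0)//.
  by apply: le_trans Y2; rewrite /block_sum -/m m3 big_nat_window.
have mL : moment L <= 2 * A / m%:R.
  have m30 : (0 < 3 * m)%N by rewrite muln_gt0.
  have [h1 h2 _ _] := block_moment_bounds m0 m30.
  have h3 : (m%:R : R) <= L.+1%:R * 2 by rewrite -natrM ler_nat.
  rewrite moment_eq -/A ler_pdivrMr// mulrAC ler_pdivlMr// -[2 * A]mulrC -mulrA.
  by rewrite ler_wpM2l ?(ltW A0)// mulrC.
have t0 : 0 < m%:R * eta by rewrite mulr_gt0.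
have -> : mod_integral (block_poly (predual_coef y) p) =
    mod_integral (fun z => z ^+ L * \sum_(j < 3 * m) c j * z ^+ (j + s)).
  by congr mod_integral; apply/funext => z; rewrite E.
apply: le_trans (mod_integral_poly_le _ _ _ _ t0) _.
apply: (@le_trans _ _ (2^-1 * (m%:R * eta * (2 * A / m%:R) +
    (m%:R * eta)^-1 * (32%:R * m%:R / A * eta ^+ 2)))).
  rewrite ler_wpM2l ?invr_ge0//; apply: lerD; first by rewrite ler_wpM2l ?(ltW t0).
  by rewrite ler_wpM2l ?invr_ge0 ?(ltW t0).
rewrite le_eqVlt; apply/orP; left; apply/eqP; rewrite /Kc -/eta; field.
by rewrite !gt_eqF.
Qed.

Definition partial_poly u P z : C := \sum_(n < (4 ^ P).-1) u n * z ^+ n.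

Lemma mod_integral_partial_poly y (B : R) : (forall P, \sum_(p < P) block_norm y p <= B) ->
  forall P, mod_integral (partial_poly (predual_coef y) P) <= (area0 + 16%:R / area0) * B.
Proof.
move=> HB P; have A0 := @area0_gt0 R.
have K0 : 0 <= area0 + 16%:R / area0 by rewrite addr_ge0 ?(ltW A0)// divr_ge0// ltW.
apply: le_trans (ler_wpM2l K0 (HB P)).
have pE Q z : partial_poly (predual_coef y) Q.+1 z =
    partial_poly (predual_coef y) Q z + block_poly (predual_coef y) Q z.
  rewrite /partial_poly /block_poly -!(big_mkord xpredT (fun n => predual_coef y n * z ^+ n)).
  by rewrite -big_cat_nat// pow4_pred_le.
elim: P => [|P IH].
  rewrite big_ord0 mulr0 /mod_integral.
  have -> : (fun p : T => modulus (partial_poly (predual_coef y) 0 (to_complex p))) = cst 0.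
    by apply/funext => p; rewrite /partial_poly big_ord0 Normc.normc0.
  by rewrite Rintegral_cst ?mul0r//; exact: measurable_Dm.
rewrite big_ord_recr /= mulrDr.
apply: le_trans (lerD IH (mod_integral_block y P)).
have b1 := bmr_modulus (bm_poly (predual_coef y) (4 ^ P).-1).
have b2 := bmr_modulus (bm_block_poly (predual_coef y) P).
have b3 := bmr_modulus (bm_poly (predual_coef y) (4 ^ P.+1).-1).
rewrite /mod_integral -RintegralD; last first.
- exact: bmr_integrable.
- exact: bmr_integrable.
- exact: measurable_Dm.
apply: le_Rintegral.
- exact: measurable_Dm.
- exact: bmr_integrable.
- by apply: bmr_integrable; exact: bmrD.
by move=> p _; rewrite pE normcD.
Qed.

Lemma partial_poly_cvg u z : tame u -> disc z ->
  (fun P => (modulus (partial_poly u P z))%:E) @ \oo --> (modulus (psum u z))%:E.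
Proof.
move=> tu z1; apply: cvg_EFin; first by near=> n.
apply/cvgrPdist_le => e e0; have [n0 H] := psumP tu z1 e0.
near=> P; rewrite distrC; apply: le_trans (normc_dist_le _ _) (H _ _).
apply: (@leq_trans P); first by near: P; exists n0.
by rewrite -ltnS prednK ?expn_gt0// ltn_expl.
Unshelve. all: by end_near. Qed.

Lemma analytic_psum u : tame u -> analytic_disc (psum u).
Proof.
move=> tu; split; last by move=> z; exact: psum_out.
by move=> z z1; have [] := (cderivP _ _ _).1 (psum_cderiv tu z1).
Qed.

(** The partial sums up to the ends of the blocks converge pointwise and are bounded in L^1 by
    [mod_integral_partial_poly]; Fatou's lemma concludes. *)
Lemma bergman_psum_predual y : block_summable y -> bergman (psum (predual_coef y)).
Proof.
move=> sy; have tu := tame_predual_coef sy; have [B HB] := sy.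
split; first exact: analytic_psum.
have mM : measurable_fun Dm (fun p : T => modulus (psum (predual_coef y) (to_complex p))).
  apply: (@measurable_fun_cont_disc _ (fun z => modulus (psum (predual_coef y) z))) => z z1 e e0.
  have [d d0 H] := cderiv_continuous (psum_cderiv tu z1) e0.
  by exists d => // w _ /H; apply: le_lt_trans; exact: normc_dist_le.
apply/integrableP; split; first exact/measurable_EFinP.
pose f P (p : T) : \bar R := (modulus (partial_poly (predual_coef y) P (to_complex p)))%:E.
have bf P := bmr_modulus (bm_poly (predual_coef y) (4 ^ P).-1).
have fat := @fatou _ _ _ area Dm (@measurable_Dm R) f.
have intf P : (\int[area]_(x in Dm) f P x)%E = (mod_integral (partial_poly (predual_coef y) P))%:E.
  rewrite /mod_integral /Rintegral fineK//.
  exact: (integrable_fin_num (@measurable_Dm R) (bmr_integrable (bf P))).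
have E : (\int[area]_(x in Dm) `|(modulus (psum (predual_coef y) (to_complex x)))%:E|)%E =
    (\int[area]_(x in Dm) limn_einf (f^~ x))%E.
  apply: eq_integral => p; rewrite inE => Dp.
  have [-> _] := cvg_limn_einf_sup (partial_poly_cvg tu Dp).
  by rewrite abse_EFin ger0_norm// normc_ge0.
rewrite E; apply: le_lt_trans (fat _ _) _.
- by move=> P; apply/measurable_EFinP; have [] := bf P.
- by move=> P p _; rewrite lee_fin normc_ge0.
apply: (@le_lt_trans _ _ ((area0 + 16%:R / area0) * B)%:E); last exact: ltry.
rewrite limn_einf_lim; apply: lime_le; first exact: is_cvg_einfs.
near=> P; apply: (@le_trans _ _ (\int[area]_(x in Dm) f P x)%E).
  by apply: ereal_inf_lbound; exists P => /=.
by rewrite intf lee_fin mod_integral_partial_poly.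
Unshelve. all: by end_near. Qed.

End bergman_membership.

(** * The biorthogonal sequences *)

Section square_summable.
Context {R : realType}.
Implicit Types (x y : nat -> R).

Definition l2sq x (B : R) : Prop := forall M, \sum_(n < M) x n ^+ 2 <= B.

Definition l2le x (c : R) : Prop := 0 <= c /\ l2sq x (c ^+ 2).

Lemma l2sq_ge0 x (B : R) : l2sq x B -> 0 <= B.
Proof. by move=> /(_ 0%N); rewrite big_ord0. Qed.

Lemma l2leD x y (c d : R) : l2le x c -> l2le y d -> l2le (fun n => x n + y n) (c + d).
Proof.
move=> [c0 xc] [d0 yd]; split; first exact: addr_ge0.
move=> M.
have -> : \sum_(n < M) (x n + y n) ^+ 2 =
    \sum_(n < M) x n ^+ 2 + \sum_(n < M) y n ^+ 2 + 2 * \sum_(n < M) x n * y n.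
  by rewrite mulr_sumr -!big_split /=; apply: eq_bigr => n _; ring.
have sx : Num.sqrt (\sum_(n < M) x n ^+ 2) <= c.
  by rewrite -[leRHS]ger0_norm// -sqrtr_sqr ler_sqrt ?sqr_ge0.
have sy : Num.sqrt (\sum_(n < M) y n ^+ 2) <= d.
  by rewrite -[leRHS]ger0_norm// -sqrtr_sqr ler_sqrt ?sqr_ge0.
have xy : \sum_(n < M) x n * y n <= c * d.
  rewrite -(big_mkord xpredT (fun n => x n * y n)).
  apply: le_trans (sum_cauchy_schwarz _ _ _) _.
  by rewrite !big_mkord; apply: ler_pM => //; exact: sqrtr_ge0.
rewrite sqrrD; have := xc M; have := yd M; move: xy.
rewrite -mulr_natl; set X := \sum_(n < M) x n ^+ 2; set Y := \sum_(n < M) y n ^+ 2.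
by lra.
Qed.

Lemma l2leZ (a : R) x (c : R) : l2le x c -> l2le (fun n => a * x n) (`|a| * c).
Proof.
move=> [c0 xc]; split; first by rewrite mulr_ge0.
move=> M; under eq_bigr do rewrite exprMn.
by rewrite -mulr_sumr exprMn real_normK ?num_real// ler_wpM2l ?sqr_ge0.
Qed.

Lemma l2leB x y (c d : R) : l2le x c -> l2le y d -> l2le (fun n => x n - y n) (c + d).
Proof.
move=> xc /(l2leZ (-1)); rewrite normrN1 mul1r => /(l2leD xc).
by congr l2le; apply/funext => n; rewrite mulN1r.
Qed.

Lemma l2le0 : l2le (fun=> 0) 0.
Proof. by split=> // M; rewrite big1 ?expr0n// => i _; rewrite expr0n. Qed.

Lemma l2le_sum (I : eqType) (r : seq I) (P : pred I) (t : I -> nat -> R) (c : I -> R) :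
  (forall i, i \in r -> P i -> l2le (t i) (c i)) ->
  l2le (fun n => \sum_(i <- r | P i) t i n) (\sum_(i <- r | P i) c i).
Proof.
elim: r => [_|i r IH H].
  have -> : (fun n => \sum_(i <- [::] | P i) t i n) = fun=> 0.
    by apply/funext => n; rewrite big_nil.
  by rewrite big_nil; exact: l2le0.
have -> : (fun n => \sum_(i <- i :: r | P i) t i n) =
    fun n => (if P i then t i n else 0) + \sum_(i <- r | P i) t i n.
  by apply/funext => n; rewrite big_cons; case: ifP => //; rewrite add0r.
have {}IH := IH (fun k kr => H k (mem_behead (s := i :: r) kr)).
rewrite big_cons; case: ifP => Pi; first by apply: l2leD => //; apply: H => //; exact: mem_head.
have -> // : (fun n => 0 + \sum_(i <- r | P i) t i n) = fun n => \sum_(i <- r | P i) t i n.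
by apply/funext => n; rewrite add0r.
Qed.

(** Pythagoras for disjoint supports: squared norms add up, whereas [l2le_sum] adds the norms
    themselves. The gain over the triangle inequality drives the construction. *)
Lemma l2sq_orthogonal (I : eqType) (r : seq I) (t : I -> nat -> R) (B : I -> R) :
  uniq r ->
  (forall i j, i \in r -> j \in r -> i != j -> forall n, t i n * t j n = 0) ->
  (forall i, i \in r -> l2sq (t i) (B i)) ->
  l2sq (fun n => \sum_(i <- r) t i n) (\sum_(i <- r) B i).
Proof.
elim: r => [|i r IH] /=.
  by move=> _ _ _ M; rewrite big_nil big1// => n _; rewrite big_nil expr0n.
move=> /andP[ir ur] ort H M; rewrite big_cons.
have -> : \sum_(n < M) (\sum_(j <- i :: r) t j n) ^+ 2 =
    \sum_(n < M) t i n ^+ 2 + \sum_(n < M) (\sum_(j <- r) t j n) ^+ 2.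
  rewrite -big_split /=; apply: eq_bigr => n _; rewrite big_cons sqrrD.
  rewrite mulr_sumr big1_seq ?mul0rn ?addr0// => j /= jr.
  apply: ort; [exact: mem_head|by rewrite inE jr orbT|].
  by apply/eqP => ij; rewrite ij jr in ir.
apply: lerD; first by apply: H; rewrite mem_head.
apply: IH => // [j k jr kr|j jr]; last by apply: H; rewrite inE jr orbT.
by apply: ort; rewrite inE ?jr ?kr orbT.
Qed.

Lemma l2sq_shift x (B : R) d : l2sq x B -> l2sq (fun n => if (d <= n)%N then x (n - d)%N else 0) B.
Proof.
move=> xB M; have [Md|dM] := leqP M d.
  rewrite big1 ?(l2sq_ge0 xB)// => n _.
  by rewrite leqNgt (leq_trans (ltn_ord n) Md) expr0n.
rewrite -(big_mkord xpredT (fun n => (if (d <= n)%N then x (n - d)%N else 0) ^+ 2)).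
rewrite (big_cat_nat (leq0n d) (ltnW dM))/= big_nat big1 ?add0r; last first.
  by move=> n /andP[_ nd]; rewrite leqNgt nd expr0n.
rewrite -{1}[d]add0n big_addn big_mkord.
under eq_bigr do rewrite leq_addl addnK.
exact: xB.
Qed.

End square_summable.

(** * Stages, slots and classes *)

Section stages.
Local Open Scope nat_scope.

(* Stage s owns the slots q with stage_start s <= q < stage_start s.+1; its length
   K is such that stage_start s / sqrt K <= 1 / 8. *)
Definition stage_step m := (64 * m ^ 2).+1.

Definition stage_start s := iter s (fun m => m + stage_step m) 0.

Definition stage_len s := stage_step (stage_start s).

Lemma stage_startS s : stage_start s.+1 = stage_start s + stage_len s.
Proof. by []. Qed.

Lemma stage_start_ltS s : stage_start s < stage_start s.+1.
Proof. by rewrite stage_startS -addn1 leq_add2l. Qed.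

Lemma stage_start_mono s t : s <= t -> stage_start s <= stage_start t.
Proof.
apply: (@homo_leq _ stage_start (fun a b => a <= b)) => [//|x y z xy /(leq_trans xy)//|i].
exact: ltnW (stage_start_ltS i).
Qed.

Lemma stage_start_ge s : s <= stage_start s.
Proof. by elim: s => // s /leq_ltn_trans; apply; exact: stage_start_ltS. Qed.

Lemma stage_ex p : exists s, p < stage_start s.+1.
Proof. by exists p; exact: stage_start_ge. Qed.

Definition stage p := ex_minn (stage_ex p).

Lemma stageP p : stage_start (stage p) <= p < stage_start (stage p).+1.
Proof.
rewrite /stage; case: ex_minnP => s ps H; rewrite ps andbT.
case: s ps H => // s ps H; rewrite leqNgt; apply/negP => /H.
by rewrite ltnn.
Qed.

Lemma stageE s p : stage_start s <= p < stage_start s.+1 -> stage p = s.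
Proof.
move=> /andP[sp ps]; have /andP[tp pt] := stageP p.
apply/eqP; rewrite eqn_leq; apply/andP; split; rewrite leqNgt; apply/negP => /stage_start_mono h.
  by have := leq_ltn_trans (leq_trans h tp) ps; rewrite ltnn.
by have := leq_ltn_trans (leq_trans h sp) pt; rewrite ltnn.
Qed.

(** The 2-adic valuation takes every value infinitely often, so every class is treated again and
    again; it is at most s, so finitely many stages involve finitely many classes. *)
Definition stage_class s := logn 2 s.+1.

Lemma stage_class_lt s : stage_class s < s.+1.
Proof.
have h : 2 ^ stage_class s <= s.+1 by apply: dvdn_leq => //; exact: pfactor_dvdnn.
exact: leq_trans (ltn_expl _ (isT : 1 < 2)) h.
Qed.

Lemma stage_class_infinite i s : exists2 t, s <= t & stage_class t = i.
Proof.
have p0 : 0 < 2 ^ i * s.*2.+1 by rewrite muln_gt0 expn_gt0.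
exists (2 ^ i * s.*2.+1).-1.
  rewrite -ltnS prednK// (@leq_trans s.*2.+1)//; first by rewrite ltnS -addnn leq_addr.
  by rewrite leq_pmull// expn_gt0.
rewrite /stage_class prednK// lognM ?expn_gt0// pfactorK//.
by rewrite logn_coprime ?addn0// prime_coprime// dvdn2 /= odd_double.
Qed.

Definition slot i q := stage_class (stage q) == i.

Lemma pow4_sep p q : p < q -> 4 * 4 ^ p <= 4 ^ q.
Proof. by rewrite -expnS => pq; rewrite leq_exp2l. Qed.

Lemma pow4_mono p q : p <= q -> 4 ^ p <= 4 ^ q.
Proof. by move=> pq; rewrite leq_exp2l. Qed.

End stages.

(** * Translates with separated supports *)

Section backward_shift.
Context {R : realType}.
Implicit Types (x : nat -> R).

(* The coefficients of the backward shift by 4^q - 1 of z^(4^p - 1) x. *)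
Definition translate x p q n : R :=
  if (4 ^ p <= n + 4 ^ q)%N then x (n + 4 ^ q - 4 ^ p)%N else 0.

Lemma translate_id x p n : translate x p p n = x n.
Proof. by rewrite /translate leq_addl addnK. Qed.

Lemma l2sq_translate x (B : R) p q : (q <= p)%N -> l2sq x B -> l2sq (translate x p q) B.
Proof.
move=> qp xB; have := l2sq_shift (4 ^ p - 4 ^ q) xB; congr l2sq; apply/funext => n.
rewrite /translate; have := pow4_mono qp; move: (4 ^ p)%N (4 ^ q)%N => a b ba.
by rewrite leq_subLR addnC subnBA.
Qed.

Section separated.
Variables (x : nat -> R) (m : nat).
Hypothesis xm : forall n, (4 ^ m <= n)%N -> x n = 0.

(** Here n + 4^q - 4^p >= 3 * 4^p >= 4^m, beyond the support of x. *)
Lemma translate_gt p q n : (m <= p)%N -> (p < q)%N -> translate x p q n = 0.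
Proof.
move=> mp pq; rewrite /translate; case: ifP => // h; apply: xm.
have := pow4_mono mp; have := pow4_sep pq; move: h.
by move: (4 ^ p)%N (4 ^ q)%N (4 ^ m)%N => a b c; lia.
Qed.

Lemma translate_far p q n : (m <= p)%N -> (4 ^ p.+1 <= n)%N -> translate x p q n = 0.
Proof.
move=> mp; rewrite /translate => pn; case: ifP => // h; apply: xm.
have := pow4_mono mp; move: h pn; rewrite expnS.
by move: (4 ^ p)%N (4 ^ q)%N (4 ^ m)%N => a b c; lia.
Qed.

(** If the first factor is nonzero then n < 4^p + 4^m <= 2 * 4^p, while the second forces n >= 4^p'
    - 4^q' >= 3 * 4^p. The base 4 provides this room. *)
Lemma translate_mul0_lt p q p' q' n : (m <= p)%N -> (p < p')%N -> (q' < p')%N ->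
  translate x p q n * translate x p' q' n = 0.
Proof.
move=> mp pp qp; rewrite /translate; case: ifP => h; last by rewrite mul0r.
case: ifP => h'; last by rewrite mulr0.
have -> : x (n + 4 ^ q - 4 ^ p)%N = 0; last by rewrite mul0r.
apply: xm; have := pow4_mono mp; have := pow4_sep pp; have := pow4_sep qp; move: h h'.
by move: (4 ^ p)%N (4 ^ q)%N (4 ^ p')%N (4 ^ q')%N (4 ^ m)%N => a b c d e; lia.
Qed.

(** If the first factor is nonzero then 4^p <= n + 4^q, so the second evaluates x at an index of at
    least 4^q' - 4^q >= 3 * 4^q >= 4^m. *)
Lemma translate_mul0_same p q q' n : (m <= q)%N -> (q < q')%N ->
  translate x p q n * translate x p q' n = 0.
Proof.
move=> mq qq; rewrite /translate; case: ifP => h; last by rewrite mul0r.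
have -> : x (n + 4 ^ q' - 4 ^ p)%N = 0; last by rewrite if_same mulr0.
apply: xm; have := pow4_mono mq; have := pow4_sep qq; move: h.
by move: (4 ^ p)%N (4 ^ q)%N (4 ^ q')%N (4 ^ m)%N => a b c d; lia.
Qed.

(** After division by K the norm is that of x divided by sqrt K. *)
Lemma l2sq_translate_old (B : R) q K : (q < m)%N -> l2sq x B ->
  l2sq (fun n => \sum_(m <= p < m + K) translate x p q n) (K%:R * B).
Proof.
move=> qm xB.
have -> : K%:R * B = \sum_(m <= p < m + K) B.
  by rewrite big_const_nat addKn iter_addr_0 mulr_natl.
apply: l2sq_orthogonal; first exact: iota_uniq.
  move=> p p'; rewrite !mem_index_iota => /andP[mp _] /andP[mp' _].
  rewrite neq_ltn => /orP[pp|pp] n.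
    by apply: translate_mul0_lt => //; exact: leq_trans qm mp'.
  by rewrite mulrC; apply: translate_mul0_lt => //; exact: leq_trans qm mp.
move=> p; rewrite mem_index_iota => /andP[mp _]; apply: l2sq_translate => //.
exact: leq_trans (ltnW qm) mp.
Qed.

(** There are K(K-1)/2 pairs q < p, and their translates are disjoint: by [translate_mul0_lt] for
    different p, by [translate_mul0_same] for equal p. *)
Lemma l2sq_translate_new (B : R) K : l2sq x B ->
  l2sq (fun n => \sum_(m <= p < m + K) \sum_(m <= q < p) translate x p q n)
    (K%:R ^+ 2 / 2 * B).
Proof.
move=> xB; have B0 := l2sq_ge0 xB.
suff H : l2sq (fun n => \sum_(m <= p < m + K) \sum_(m <= q < p) translate x p q n)
    (\sum_(m <= p < m + K) (p - m)%:R * B).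
  move=> M; apply: le_trans (H M) _; rewrite -mulr_suml ler_wpM2r//.
  elim: K {H} => [|K IH]; first by rewrite addn0 big_geq// divr_ge0// sqr_ge0.
  rewrite addnS big_nat_recr ?leq_addr//= addKn; apply: le_trans (lerD IH (lexx _)) _.
  by rewrite -[K.+1%:R]natr1; move: (K%:R : R) => t; lra.
apply: l2sq_orthogonal; first exact: iota_uniq.
  move=> p p'; rewrite !mem_index_iota => /andP[mp _] /andP[mp' _].
  move=> pp n; rewrite mulr_suml big_nat big1// => q /andP[mq qp].
  rewrite mulr_sumr big_nat big1// => q' /andP[mq' qp'].
  move: pp; rewrite neq_ltn => /orP[pp|pp]; first exact: translate_mul0_lt.
  by rewrite mulrC; apply: translate_mul0_lt.
move=> p; rewrite mem_index_iota => /andP[mp _].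
have -> : (p - m)%:R * B = \sum_(m <= q < p) B.
  by rewrite big_const_nat iter_addr_0 mulr_natl.
apply: l2sq_orthogonal; first exact: iota_uniq.
  move=> q q'; rewrite !mem_index_iota => /andP[mq _] /andP[mq' _].
  rewrite neq_ltn => /orP[qq|qq] n; first exact: translate_mul0_same.
  by rewrite mulrC; exact: translate_mul0_same.
move=> q; rewrite mem_index_iota => /andP[_ qp]; apply: l2sq_translate => //.
exact: ltnW.
Qed.

End separated.
End backward_shift.

(** * The errors of the construction *)

Section residuals.
Context {R : realType}.
Variable j : nat.
Implicit Types (x : nat -> R).

Lemma stage_len_gt0 s : 0 < (stage_len s)%:R :> R.
Proof. by rewrite ltr0n. Qed.

Lemma stage_len_neq0 s : (stage_len s)%:R != 0 :> R.
Proof. by rewrite gt_eqF// stage_len_gt0. Qed.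

(** The argument is one more than the exponent: the value at n+1 is the coefficient of z^n in K^-1
    times the sum of the z^(4^p - 1) x. Pairing B^n a with the exponent 4^q - 1 therefore reads the
    value at n + 4^q. *)
Definition stage_filter s x n : R := (stage_len s)%:R^-1 *
  \sum_(stage_start s <= p < stage_start s.+1) (if (4 ^ p <= n)%N then x (n - 4 ^ p)%N else 0).

(* The error delta_ij delta_n0 - <B^n a, f_i> left after the first s stages, where
   stage t contributes to a the error of class [stage_class t] at that time. *)
Fixpoint residual s : nat -> nat -> R :=
  if s is t.+1 then fun i n => residual t i n -
    \sum_(0 <= q < stage_start t.+1 | slot i q)
       stage_filter t (residual t (stage_class t)) (n + 4 ^ q)
  else fun i n => ((i == j) && (n == 0%N))%:R.

Definition stage_input s := residual s (stage_class s).

Lemma stage_filterE s x n q : stage_filter s x (n + 4 ^ q) =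
  (stage_len s)%:R^-1 * \sum_(stage_start s <= p < stage_start s.+1) translate x p q n.
Proof. by []. Qed.

(** This is the separation that the lemmas on translates require, with m = [stage_start s]: the
    slots of the next stage lie beyond the current errors. *)
Lemma residual_support s i n : (4 ^ stage_start s <= n)%N -> residual s i n = 0.
Proof.
elim: s i n => [|s IH] i n sn /=.
  have n0 : (0 < n)%N by apply: leq_trans sn; rewrite expn_gt0.
  by rewrite (gtn_eqF n0) andbF.
rewrite IH; last by apply: leq_trans sn; apply: pow4_mono; exact: ltnW (stage_start_ltS s).
rewrite big1 ?subrr// => q _; rewrite stage_filterE big_nat big1 ?mulr0// => p /andP[sp ps].
apply: (@translate_far _ _ (stage_start s)) => //; first exact: IH.
by apply: leq_trans sn; apply: pow4_mono.
Qed.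

Definition old_slots s i : R := \sum_(0 <= q < stage_start s | slot i q) 1.

Definition stage_weight s : R := (Num.sqrt (stage_len s)%:R)^-1.

(* Upper bounds of the l^2 norms of the errors: the slots of the stage itself leave
   disjoint translates of total norm at most 1 / sqrt 2 <= 3 / 4 times the input,
   and each old slot leaves stage_len s disjoint translates. *)
Fixpoint residual_bound s : nat -> R :=
  if s is t.+1 then fun i =>
    (if i == stage_class t then 3%:R / 4%:R * residual_bound t i else residual_bound t i) +
    old_slots t i * stage_weight t * residual_bound t (stage_class t)
  else fun i => (i == j)%:R.

Lemma old_slots_ge0 s i : 0 <= old_slots s i.
Proof. by rewrite sumr_ge0. Qed.

Lemma stage_weight_ge0 s : 0 <= stage_weight s.
Proof. by rewrite invr_ge0 sqrtr_ge0. Qed.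

Lemma residual_bound_ge0 s i : 0 <= residual_bound s i.
Proof.
elim: s i => [|s IH] i //=; apply: addr_ge0.
  by case: ifP => _ //; rewrite mulr_ge0// divr_ge0.
by rewrite mulr_ge0// mulr_ge0// ?old_slots_ge0// stage_weight_ge0.
Qed.

(* In the pairing of slot p with slot q, q > p gives 0 and q = p gives the input
   itself, so that the input of the stage is cancelled in its own class. *)
Lemma residual_step s i n : residual s.+1 i n = residual s i n -
  \sum_(0 <= q < stage_start s | slot i q) ((stage_len s)%:R^-1 *
     \sum_(stage_start s <= p < stage_start s + stage_len s) translate (stage_input s) p q n) -
  (if i == stage_class s then stage_input s n + (stage_len s)%:R^-1 *
     \sum_(stage_start s <= p < stage_start s + stage_len s)
       \sum_(stage_start s <= q < p) translate (stage_input s) p q n else 0).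
Proof.
rewrite [LHS]/= -addrA; congr (_ + _); rewrite -opprD; congr (- _).
have l := stage_start_ltS s.
rewrite (big_cat_nat (leq0n _) (ltnW l)) /=; congr (_ + _).
have K0 := stage_len_neq0 s.
have slotE q : (stage_start s <= q < stage_start s.+1)%N -> slot i q = (i == stage_class s).
  by move=> sq; rewrite /slot (stageE sq) eq_sym.
rewrite big_mkcond; under eq_big_nat => q /slotE -> do over.
case: eqP => _; last by rewrite big1.
under eq_bigr do rewrite stage_filterE -/(stage_input s).
(* After the exchange, for each p the sum over the slots q of the stage is cut at q = p. *)
rewrite -mulr_sumr exchange_big /=.
rewrite big_nat; under eq_bigr => p /andP[sp ps].
  rewrite (big_cat_nat sp (ltnW ps))/= [X in _ + X]big_ltn// translate_id.
  rewrite [X in _ + (_ + X)]big1_seq ?addr0; last first.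
    move=> q /=; rewrite mem_index_iota => /andP[pq _].
    by apply: (@translate_gt _ _ (stage_start s)) => // m; exact: residual_support.
  over.
rewrite -big_nat big_split /= addrC mulrDr; congr (_ + _).
by rewrite big_const_nat addKn iter_addr_0 -[X in _ * X]mulr_natl mulrA mulVf ?mul1r.
Qed.

Lemma sqrt_stage_len_inv s : (stage_len s)%:R^-1 * Num.sqrt (stage_len s)%:R = stage_weight s :> R.
Proof.
rewrite /stage_weight -{1}[(stage_len s)%:R]sqr_sqrtr// expr2 invfM mulfVK//.
by rewrite gt_eqF// sqrtr_gt0 stage_len_gt0.
Qed.

Lemma residual_l2 s i : l2le (residual s i) (residual_bound s i).
Proof.
elim: s i => [|s IH] i.
  split=> // M /=; case: M => [|M]; first by rewrite big_ord0 sqr_ge0.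
  rewrite big_ord_recl /= andbT big1 ?addr0// => n _.
  by rewrite andbF expr0n.
have xs n : (4 ^ stage_start s <= n)%N -> stage_input s n = 0 by exact: residual_support.
have [c0 xB] : l2le (stage_input s) (residual_bound s (stage_class s)) by exact: IH.
set c := residual_bound s _ in c0 xB; set x := stage_input s in xs xB *.
have K0 := stage_len_neq0 s; set K := stage_len s in K0 *.
have Kinv : 0 <= (K%:R^-1 : R) by rewrite invr_ge0.
have old : l2le (fun n => \sum_(0 <= q < stage_start s | slot i q) (K%:R^-1 *
     \sum_(stage_start s <= p < stage_start s + K) translate x p q n))
   (old_slots s i * stage_weight s * c).
  rewrite /old_slots -mulrA mulr_suml.
  apply: l2le_sum => q; rewrite mem_index_iota => /andP[_ qs] _; rewrite mul1r.
  have := @l2leZ R K%:R^-1 _ (Num.sqrt K%:R * c) (conj (mulr_ge0 (sqrtr_ge0 _) c0) _).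
  rewrite ger0_norm// mulrA sqrt_stage_len_inv; apply.
  by rewrite exprMn sqr_sqrtr//; exact: l2sq_translate_old.
have [ii|ni] := eqVneq i (stage_class s); last first.
  have := l2leB (IH i) old; rewrite [X in _ -> l2le _ X]/= (negbTE ni).
  by congr l2le; apply/funext => n; rewrite residual_step (negbTE ni) subr0.
have new : l2le (fun n => K%:R^-1 * \sum_(stage_start s <= p < stage_start s + K)
       \sum_(stage_start s <= q < p) translate x p q n) (3%:R / 4%:R * c).
  have h : 0 <= K%:R * (3%:R / 4%:R) * c by rewrite mulr_ge0// mulr_ge0// divr_ge0.
  have {}h : l2le (fun n => \sum_(stage_start s <= p < stage_start s + K)
       \sum_(stage_start s <= q < p) translate x p q n) (K%:R * (3%:R / 4%:R) * c).
    split=> // M; have hn := @l2sq_translate_new R x _ xs _ K xB; apply: le_trans (hn M) _.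
    rewrite 2!exprMn; apply: ler_wpM2r; first exact: sqr_ge0.
    apply: ler_wpM2l; first exact: sqr_ge0.
    by lra.
  by have := l2leZ K%:R^-1 h; rewrite ger0_norm// !mulrA mulVf// mul1r.
(* In the class of the stage the previous error is the input itself and cancels, so 0 takes the
   place of the induction hypothesis and only the two leftovers remain. *)
have := l2leB (l2leB l2le0 new) old.
have -> : residual_bound s.+1 i = 0 + 3%:R / 4%:R * c + old_slots s i * stage_weight s * c.
  by rewrite /= ii eqxx add0r.
congr l2le; apply/funext => n; rewrite residual_step ii eqxx -/(stage_input s) -/x -/K.
by ring.
Qed.

End residuals.

(** * Decay of the errors *)

Section potential.
Context {R : realType}.
Variable j : nat.
Local Notation old_slots := (@old_slots R).
Local Notation stage_weight := (@stage_weight R).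
Local Notation residual_bound := (@residual_bound R j).
Local Notation residual := (@residual R j).
Implicit Types (x : nat -> R).

Definition input_bound s : R := residual_bound s (stage_class s).

Lemma input_bound_ge0 s : 0 <= input_bound s.
Proof. exact: residual_bound_ge0. Qed.

(** Every slot belongs to exactly one class. *)
Lemma sum_old_slots_le s M : \sum_(i < M) old_slots s i <= (stage_start s)%:R.
Proof.
rewrite /old_slots; under eq_bigr do rewrite big_mkcond.
have -> : (stage_start s)%:R = \sum_(0 <= q < stage_start s) 1 :> R.
  by rewrite big_const_nat subn0 iter_addr_0.
rewrite exchange_big /=; apply: ler_sum => q _; rewrite /slot.
set c := stage_class _; have [cM|Mc] := ltnP c M.
  by rewrite (bigD1 (Ordinal cM))//= eqxx big1 ?addr0// => i /negbTE; rewrite eq_sym -val_eqE /= => ->.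
rewrite big1 ?ler01// => i _; rewrite ifF//; apply/negbTE; rewrite gtn_eqF//.
exact: leq_trans (ltn_ord i) Mc.
Qed.

Lemma stage_start_weight_le s : (stage_start s)%:R * stage_weight s <= 8%:R^-1.
Proof.
have s0 : 0 < Num.sqrt (stage_len s)%:R :> R by rewrite sqrtr_gt0 stage_len_gt0.
rewrite ler_pdivrMr// mulrC ler_pdivlMr// -[leLHS]ger0_norm ?mulr_ge0// -sqrtr_sqr.
rewrite ler_sqrt ?(ltW (stage_len_gt0 _))// -natrM -natrX ler_nat.
by rewrite /stage_len /stage_step expnMn mulnC leqnSn.
Qed.

Lemma old_slots_weight_le s i : old_slots s i * stage_weight s <= 8%:R^-1.
Proof.
apply: le_trans (stage_start_weight_le s); rewrite ler_wpM2r ?stage_weight_ge0//.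
apply: le_trans (sum_old_slots_le s i.+1).
by rewrite big_ord_recr /= lerDr sumr_ge0// => k _; exact: old_slots_ge0.
Qed.

(** The contraction by 3/4 in the class of the stage saves 1/4 of the input; the old slots of all
    classes together return at most 1/8 of it. *)
Lemma potential_step s M : (stage_class s < M)%N ->
  \sum_(i < M) residual_bound s.+1 i <= \sum_(i < M) residual_bound s i - input_bound s / 8%:R.
Proof.
move=> cM; rewrite /= big_split /= -!mulr_suml -/(input_bound s).
have h1 : \sum_(i < M) (if i == stage_class s :> nat then 3%:R / 4%:R * residual_bound s i
      else residual_bound s i) =
    \sum_(i < M) residual_bound s i - 4%:R^-1 * input_bound s.
  rewrite (bigD1 (Ordinal cM))//= [in RHS](bigD1 (Ordinal cM))//= eqxx.
  rewrite [X in _ + X = _](eq_bigr (fun i : 'I_M => residual_bound s i)); last first.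
    by move=> i; rewrite -val_eqE /= => /negbTE ->.
  by rewrite /input_bound; lra.
have h2 : (\sum_(i < M) old_slots s i) * stage_weight s * input_bound s <= 8%:R^-1 * input_bound s.
  rewrite ler_wpM2r ?input_bound_ge0//; apply: le_trans (stage_start_weight_le s).
  by rewrite ler_wpM2r ?stage_weight_ge0// sum_old_slots_le.
by rewrite h1; move: h2; set a := _ * _ * _; lra.
Qed.

(** The potential starts at 1, stays nonnegative, and loses 1/8 of the input at each stage. *)
Lemma sum_input_bound_le S : \sum_(s < S) input_bound s <= 8%:R.
Proof.
(* Large enough to include j, the class of the initial error, and every class treated in the first S
   stages. *)
pose M := (maxn S j).+1.
have H T : (T <= S)%N ->
    \sum_(i < M) residual_bound T i + (\sum_(s < T) input_bound s) / 8%:R <= 1.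
  elim: T => [|T IH] TS.
    have jM : (j < M)%N by rewrite ltnS leq_maxr.
    rewrite big_ord0 mul0r addr0 (bigD1 (Ordinal jM))//= eqxx big1 ?addr0//.
    by move=> i; rewrite -val_eqE /= => /negbTE ->.
  apply: le_trans (IH (ltnW TS)).
  have -> : \sum_(s < T.+1) input_bound s = \sum_(s < T) input_bound s + input_bound T.
    by rewrite big_ord_recr.
  have cM : (stage_class T < M)%N.
    by apply: leq_trans (stage_class_lt T) _; rewrite leqW// (leq_trans TS)// leq_maxl.
  by have := potential_step cM; lra.
have := H S (leqnn S); have : 0 <= \sum_(i < M) residual_bound S i.
  by rewrite sumr_ge0// => i _; exact: residual_bound_ge0.
by lra.
Qed.

Lemma residual_bound_growth i s d : residual_bound (s + d) i <=
  residual_bound s i + \sum_(s <= t < s + d) input_bound t.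
Proof.
elim: d => [|d IH]; first by rewrite addn0 big_geq// addr0.
rewrite addnS big_nat_recr ?leq_addr//= addrA; apply: lerD.
  apply: le_trans IH; case: ifP => // _; rewrite ler_piMl ?residual_bound_ge0//.
  by lra.
rewrite -/(input_bound _) ler_piMl ?input_bound_ge0//.
by apply: le_trans (old_slots_weight_le _ _) _; lra.
Qed.

Lemma nneg_series_tail (c : nat -> R) (B : R) : (forall n, 0 <= c n) ->
  (forall n, \sum_(k < n) c k <= B) ->
  forall e : R, 0 < e -> exists n0, forall n m, (n0 <= n)%N -> \sum_(n <= k < m) c k <= e.
Proof.
move=> c0 cB e e0.
have cC : asum (fun n => (c n)%:C) B.
  by move=> n; apply: le_trans (cB n); apply: ler_sum => k _; rewrite real_complex_modulus.
have [n0 H] := asum_tail cC e0; exists n0 => n m /(H n m).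
by under eq_bigr do rewrite real_complex_modulus//.
Qed.

(** Wait until the remaining inputs sum to at most e/2 and class i is treated again, at stage t. Its
    bound is then the input bound of t, hence at most e/2, and afterwards it grows by no more than
    the inputs from t on. *)
Lemma residual_bound_cvg0 i (e : R) : 0 < e ->
  exists s0, forall s, (s0 <= s)%N -> residual_bound s i <= e.
Proof.
move=> e0; have e20 : 0 < e / 2 by rewrite divr_gt0.
have [n0 H] := nneg_series_tail input_bound_ge0 sum_input_bound_le e20.
have [t nt ti] := stage_class_infinite i n0.
exists t => s ts; rewrite -(subnKC ts); apply: le_trans (residual_bound_growth _ _ _) _.
rewrite [leRHS]splitr; apply: lerD; last exact: H.
have := H t t.+1 nt; rewrite big_nat1 /input_bound ti; exact.
Qed.

Lemma residual_cvg0 i n (e : R) : 0 < e ->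
  exists s0, forall s, (s0 <= s)%N -> `|residual s i n| <= e.
Proof.
move=> e0; have [s0 H] := residual_bound_cvg0 i e0; exists s0 => s /H; apply: le_trans.
have [c0 xc] := @residual_l2 R j s i.
rewrite -(ger0_norm c0) -[leLHS]sqrtr_sqr -[leRHS]sqrtr_sqr ler_sqrt ?sqr_ge0//.
apply: le_trans (xc n.+1); rewrite big_ord_recr /= lerDr sumr_ge0// => k _.
exact: sqr_ge0.
Qed.

End potential.

(** * Each block meets a single slot *)

Section filter_blocks.
Context {R : realType}.
Implicit Types (x : nat -> R).
Local Notation stage_filter := (@stage_filter R).

(** The copy of x placed at slot p' lives on 4^p' <= N < 4^p' + 4^m <= 2 * 4^p', inside block p'. *)
Lemma filter_term0 x m p p' N : (forall n, (4 ^ m <= n)%N -> x n = 0) -> (m <= p')%N ->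
  p' != p -> (4 ^ p <= N < 4 ^ p.+1)%N -> (if (4 ^ p' <= N)%N then x (N - 4 ^ p')%N else 0) = 0.
Proof.
move=> xm mp; rewrite neq_ltn => /orP[pp|pp] /andP[pN Np]; case: ifP => // h.
  apply: xm; have := pow4_sep pp; have := pow4_mono mp; move: h pN.
  by move: (4 ^ p')%N (4 ^ p)%N (4 ^ m)%N => a b c; lia.
by have := leq_ltn_trans (leq_trans (pow4_mono pp) h) Np; rewrite ltnn.
Qed.

Lemma stage_filter_block s x p N : (forall n, (4 ^ stage_start s <= n)%N -> x n = 0) ->
  (4 ^ p <= N < 4 ^ p.+1)%N -> stage p = s ->
  stage_filter s x N = (stage_len s)%:R^-1 * x (N - 4 ^ p)%N.
Proof.
move=> xs Np ps; have := stageP p; rewrite ps => /andP[sp pS].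
rewrite /stage_filter; congr (_ * _).
rewrite (bigD1_seq p)/= ?mem_index_iota ?sp ?pS ?iota_uniq//.
have /andP[-> _] := Np; rewrite big_nat_cond big1 ?addr0// => p' /andP[/andP[sp' _] pp].
exact: filter_term0 xs sp' pp Np.
Qed.

Lemma stage_filter_out s x p N : (forall n, (4 ^ stage_start s <= n)%N -> x n = 0) ->
  (4 ^ p <= N < 4 ^ p.+1)%N -> stage p != s -> stage_filter s x N = 0.
Proof.
move=> xs Np ps; rewrite /stage_filter big_nat big1 ?mulr0// => p' sp'.
apply: (@filter_term0 _ _ p) xs _ _ Np; first by case/andP: sp'.
by apply: contraNneq ps => <-; rewrite (stageE sp').
Qed.

End filter_blocks.

Lemma block_first p n : ((4 ^ p).-1 <= n < (4 ^ p.+1).-1)%N -> (4 ^ p <= n.+1 < 4 ^ p.+1)%N.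
Proof.
have : (0 < 4 ^ p)%N by rewrite expn_gt0.
have : (0 < 4 ^ p.+1)%N by rewrite expn_gt0.
by move: (4 ^ p)%N (4 ^ p.+1)%N => a b; lia.
Qed.

Lemma block_end p : (4 ^ p.+1).-1 = ((4 ^ p).-1 + 3 * 4 ^ p)%N.
Proof.
have : (0 < 4 ^ p)%N by rewrite expn_gt0.
by rewrite expnS; move: (4 ^ p)%N => a; lia.
Qed.

(** * The dual sequences and their block norms *)

Section dual_sequence.
Context {R : realType}.
Local Notation C := (Cplx R).
Variable j : nat.
Local Notation residual := (@residual R j).
Local Notation stage_input := (@stage_input R j).
Local Notation input_bound := (@input_bound R j).

(** The sum of the contributions of all stages, without an infinite sum: n lies in the block of one
    slot, and only the stage that owns this slot contributes at n. *)
Definition dual_seq n : R :=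
  let s := stage (trunc_log 4 n.+1) in stage_filter s (stage_input s) n.+1.

Lemma stage_input_support s n : (4 ^ stage_start s <= n)%N -> stage_input s n = 0.
Proof. exact: residual_support. Qed.

Lemma dual_seq_block p n : ((4 ^ p).-1 <= n < (4 ^ p.+1).-1)%N ->
  dual_seq n = (stage_len (stage p))%:R^-1 * stage_input (stage p) (n - (4 ^ p).-1)%N.
Proof.
move=> /block_first np; rewrite /dual_seq (@trunc_log_eq 4 p)//.
rewrite (stage_filter_block (p := p))//; last exact: stage_input_support.
congr (_ * stage_input _ _).
have : (0 < 4 ^ p)%N by rewrite expn_gt0.
by move: (4 ^ p)%N => a; lia.
Qed.

Definition dual_coef n : C := (dual_seq n)%:C.

Lemma dual_block_norm p : block_norm dual_coef p <= (stage_len (stage p))%:R^-1 * input_bound (stage p).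
Proof.
set s := stage p; have K0 := @stage_len_gt0 R s.
have c0 : 0 <= (stage_len s)%:R^-1 * input_bound s.
  by rewrite mulr_ge0 ?input_bound_ge0// invr_ge0 ltW.
rewrite -(ger0_norm c0) -sqrtr_sqr ler_sqrt ?sqr_ge0// /block_sum block_end big_nat_window.
have [_ xc] := @residual_l2 R j s (stage_class s).
rewrite exprMn; apply: le_trans (ler_wpM2l (sqr_ge0 _) (xc (3 * 4 ^ p)%N)).
rewrite mulr_sumr; apply: ler_sum => n _.
rewrite /dual_coef normc_real real_normK ?num_real// (@dual_seq_block p).
  by rewrite addKn exprMn.
by rewrite leq_addr /= block_end ltn_add2l.
Qed.

(** Each of the K slots of a stage costs at most 1/K of the input bound, so a stage costs its input
    bound, and these sum to at most 8. *)
Lemma dual_coef_block_summable : block_summable dual_coef.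
Proof.
exists 8%:R => P.
apply: (@le_trans _ _ (\sum_(0 <= p < stage_start P) block_norm dual_coef p)).
  rewrite -(big_mkord xpredT (block_norm dual_coef)).
  rewrite [leRHS](big_cat_nat (leq0n P) (stage_start_ge P))/= lerDl sumr_ge0// => p _.
  exact: block_norm_ge0.
apply: le_trans (@sum_input_bound_le R j P); elim: P => [|P IH].
  by rewrite big_ord0 big_geq.
rewrite big_ord_recr /= (big_cat_nat (leq0n _) (ltnW (stage_start_ltS P)))/=.
apply: lerD => //.
apply: (@le_trans _ _ (\sum_(stage_start P <= p < stage_start P.+1) (stage_len P)%:R^-1 * input_bound P)).
  rewrite big_nat [leRHS]big_nat; apply: ler_sum => p pP.
  by have := dual_block_norm p; rewrite (stageE pP).
by rewrite big_const_nat stage_startS addKn iter_addr_0 -mulrnAl -mulr_natr mulVf ?mul1r// stage_len_neq0.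
Qed.

Lemma residual_sum s i n : residual s i n = ((i == j) && (n == 0%N))%:R -
  \sum_(t < s) \sum_(0 <= q < stage_start t.+1 | slot i q) stage_filter t (stage_input t) (n + 4 ^ q).
Proof.
elim: s => [|s IH]; first by rewrite big_ord0 subr0.
by rewrite big_ord_recr /= IH opprD addrA.
Qed.

Lemma small_index q s n : (n <= s)%N -> (q < stage_start s)%N -> (n + 4 ^ q < 4 ^ stage_start s)%N.
Proof.
move=> ns; have := leq_trans ns (stage_start_ge s); case: (stage_start s) => // k nk.
rewrite ltnS expnS => /pow4_mono qk; have := ltn_expl k (isT : 1 < 4)%N.
by move: qk; move: (4 ^ q)%N (4 ^ k)%N => a b; lia.
Qed.

(** For n <= s and a slot q below [stage_start s], [small_index] puts n + 4^q in a block of one of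
    the first s stages, so later stages do not reach it. Conversely, stage t contributes nothing at
    slots q from [stage_start t.+1] on, so all sums may run over the same range of q. *)
Lemma residual_dual s i n : (n <= s)%N -> residual s i n = ((i == j) && (n == 0%N))%:R -
  \sum_(0 <= q < stage_start s | slot i q) dual_seq (n + (4 ^ q).-1).
Proof.
move=> ns; rewrite residual_sum; congr (_ - _).
have E q : (n + (4 ^ q).-1).+1 = (n + 4 ^ q)%N by rewrite -addnS prednK// expn_gt0.
have tl q : (4 ^ trunc_log 4 (n + 4 ^ q) <= n + 4 ^ q < 4 ^ (trunc_log 4 (n + 4 ^ q)).+1)%N.
  by apply: trunc_log_bounds => //; rewrite addn_gt0 expn_gt0 orbT.
have qtl q : (q <= trunc_log 4 (n + 4 ^ q))%N by rewrite trunc_log_max// leq_addl.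
transitivity (\sum_(t < s) \sum_(0 <= q < stage_start s | slot i q)
    stage_filter t (stage_input t) (n + 4 ^ q)).
  apply: eq_bigr => t _.
  rewrite [RHS](big_cat_nat (leq0n _) (stage_start_mono (ltn_ord t)))/=.
  rewrite [X in _ = _ + X]big1_seq ?addr0// => q /andP[_].
  rewrite mem_index_iota => /andP[tq _].
  apply: stage_filter_out (tl q) _; first exact: stage_input_support.
  apply/eqP => tE; have := stageP (trunc_log 4 (n + 4 ^ q)); rewrite tE => /andP[_].
  by rewrite ltnNge (leq_trans tq (qtl q)).
rewrite exchange_big /= big_seq_cond [RHS]big_seq_cond; apply: eq_bigr => q.
rewrite mem_index_iota => /andP[/andP[_ qs] _].
rewrite /dual_seq E; set p := trunc_log _ _.
have ps : (p < stage_start s)%N.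
  have := leq_ltn_trans (andP (tl q)).1 (small_index ns qs).
  by rewrite ltn_exp2l.
have sp : (stage p < s)%N.
  rewrite ltnNge; apply/negP => /stage_start_mono h.
  by have /andP[/(leq_trans h)] := stageP p; rewrite leqNgt ps.
rewrite (bigD1 (Ordinal sp))//= big1 ?addr0// => t ts.
apply: stage_filter_out (tl q) _; first exact: stage_input_support.
by rewrite eq_sym; move: ts; rewrite -val_eqE.
Qed.

End dual_sequence.

(** Stage 0 has the single slot 0, of class 0, and there are no old slots. For j = 0 its input is
    the whole initial error, which it cancels exactly, so every later input vanishes. This is what
    makes a_0 the unit sequence. *)
Lemma residual0_succ (R : realType) s i m : @residual R 0 s.+1 i m = 0.
Proof.
elim: s i m => [|s IH] i m; last first.
  move: (s.+1) IH => t IH.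
  rewrite /= IH big1 ?subrr// => q _; rewrite /stage_filter big1 ?mulr0// => p' _.
  by rewrite IH if_same.
rewrite residual_step big_geq// subr0.
rewrite [X in _ + _ * X]big1_seq ?mulr0 ?addr0; last first.
  move=> p /=; rewrite mem_index_iota => /andP[_ p1].
  by rewrite big_geq//; move: p1; rewrite ltnS leqn0 => /eqP ->.
have c0 : stage_class 0 = 0%N by [].
rewrite /stage_input c0; case: (i =P 0%N) => [->|/eqP/negbTE i0]; first by rewrite subrr.
by rewrite subr0 /= i0.
Qed.

Lemma dual_seq0 (R : realType) n : @dual_seq R 0 n = (n == 0%N)%:R.
Proof.
have [p np] := in_block n; rewrite (dual_seq_block 0 np).
case sp : (stage p) => [|s].
  have p0 : p = 0%N.
    have := stageP p; rewrite sp => /andP[_]; rewrite ltnS leqn0 => /eqP; exact.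
  have l1 : stage_len 0 = 1%N by [].
  by rewrite l1 invr1 mul1r p0 subn0.
rewrite /stage_input residual0_succ mulr0; case: n np => // /andP[p0 _].
have {}p0 : p = 0%N.
  apply/eqP; rewrite -leqn0 leqNgt; apply/negP => /pow4_mono; move: p0; rewrite leqn0 expn1.
  by move: (4 ^ p)%N => a; lia.
by move: sp; rewrite p0 (@stageE 0).
Qed.

(** * The lacunary series *)

Section lacunary.
Context {R : realType}.
Local Notation C := (Cplx R).
Local Notation modulus := (@Normc.normc R).

Definition slot_coef i n : C :=
  ((n.+1 == 4 ^ trunc_log 4 n.+1)%N && slot i (trunc_log 4 n.+1))%:R.

Lemma slot_coef_block i p n : ((4 ^ p).-1 <= n < (4 ^ p.+1).-1)%N ->
  slot_coef i n = ((n == (4 ^ p).-1) && slot i p)%:R.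
Proof.
move=> np; rewrite /slot_coef (@trunc_log_eq 4 p)//; last exact: block_first.
by rewrite -[n == _](inj_eq succn_inj) prednK// expn_gt0.
Qed.

Lemma modulus_bool (b : bool) : modulus (b%:R : C) = b%:R.
Proof. by rewrite modulus_nat. Qed.

Lemma slot_coef_le1 i n : modulus (slot_coef i n) <= 1.
Proof. by rewrite modulus_bool lern1 leq_b1. Qed.

Lemma tame_slot_coef i : tame (slot_coef i).
Proof. exact: tame_bounded (slot_coef_le1 i). Qed.

Lemma conjc_slot_coef i n : conjc (slot_coef i n) = slot_coef i n.
Proof. exact: rmorph_nat. Qed.

Lemma block_sum_slot (u : nat -> C) i p :
  \sum_((4 ^ p).-1 <= n < (4 ^ p.+1).-1) u n * slot_coef i n =
  if slot i p then u (4 ^ p).-1 else 0.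
Proof.
have lt : ((4 ^ p).-1 < (4 ^ p.+1).-1)%N.
  by rewrite block_end -[X in (X < _)%N]addn0 ltn_add2l muln_gt0 expn_gt0.
rewrite big_ltn// (@slot_coef_block i p) ?leqnn ?lt// eqxx /=.
rewrite big_nat big1 ?addr0; last first.
  move=> n /andP[pn np]; rewrite (@slot_coef_block i p) ?np ?(ltnW pn)//.
  by rewrite gtn_eqF ?mulr0.
by case: ifP; rewrite ?mulr1 ?mulr0.
Qed.

Lemma sum_slot_coef (u : nat -> C) i P :
  \sum_(n < (4 ^ P).-1) u n * slot_coef i n = \sum_(0 <= q < P | slot i q) u (4 ^ q).-1.
Proof.
rewrite -(big_mkord xpredT (fun n => u n * slot_coef i n)).
elim: P => [|P IH]; first by rewrite expn0 !big_geq.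
rewrite (big_cat_nat (leq0n _) (pow4_pred_le P))/= IH block_sum_slot.
by rewrite [RHS]big_mkcond [in RHS]big_nat_recr//= -big_mkcond.
Qed.

(** The derivative shifts the exponent 4^(p+1) - 1 to the last index of block p. Its coefficient is
    at most 4^(p+1), that is 4/3 of the length 3 * 4^p of the block, and r^n is smallest at this
    index. *)
Lemma block_sum_dcoef_slot i p (r : R) : 0 <= r -> r <= 1 ->
  block_sum (fun n => modulus (dcoef (slot_coef i) n) * r ^+ n) p <=
  4%:R / 3%:R * block_sum (fun n => r ^+ n) p.
Proof.
move=> r0 r1; rewrite /block_sum block_end.
have e : (3 * 4 ^ p = (3 * 4 ^ p).-1.+1)%N by rewrite prednK// muln_gt0 expn_gt0.
set a := (4 ^ p).-1; set b := (3 * 4 ^ p).-1 in e *.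
rewrite [in leLHS]e addnS big_nat_recr ?leq_addr//= big_nat big1 ?add0r; last first.
  move=> n /andP[an nb]; rewrite /dcoef.
  rewrite (@slot_coef_block i p); last first.
    by rewrite block_end -/a e addnS ltnS nb (leq_trans an).
  by rewrite gtn_eqF// mulr0 Normc.normc0 mul0r.
apply: (@le_trans _ _ ((4 ^ p.+1)%:R * r ^+ (a + b))).
  rewrite ler_wpM2r ?exprn_ge0// /dcoef Normc.normcM modulus_nat.
  apply: (@le_trans _ _ ((a + b).+1%:R * 1)); first by rewrite ler_wpM2l ?slot_coef_le1.
  by rewrite mulr1 ler_nat -addnS -e -block_end leq_pred.
apply: (@le_trans _ _ (4%:R / 3%:R * \sum_(a <= n < a + 3 * 4 ^ p) r ^+ (a + b))).
  rewrite big_const_nat addKn iter_addr_0 -mulr_natr expnS !natrM.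
  by rewrite le_eqVlt; apply/orP; left; apply/eqP; field.
rewrite ler_wpM2l ?divr_ge0//; apply: ler_sum_nat => n /andP[_ na].
by apply: ler_wiXn2l => //; move: na; rewrite e addnS ltnS.
Qed.

(** Summing over the blocks, |f'(z)| <= (4/3) / (1 - |z|), and (1 - r^2)/(1 - r) = 1 + r <= 2 gives
    8/3. *)
Lemma bloch_slot i : bloch (psum (slot_coef i)).
Proof.
have tf := tame_slot_coef i.
apply/bloch_iff; split; first by move=> z; exact: psum_out.
exists (psum (dcoef (slot_coef i))), (8%:R / 3%:R) => z z1; split; first exact: psum_cderiv.
have r0 := normc_ge0 z; have r1 : modulus z < 1 by [].
set r := modulus z in r0 r1 *.
have h : modulus (psum (dcoef (slot_coef i)) z) <= 4%:R / 3%:R * (1 - r)^-1.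
  apply: psum_le => // [|n]; first exact: tame_dcoef.
  have nP : (n <= (4 ^ n).-1)%N by rewrite -ltnS prednK ?expn_gt0// ltn_expl.
  rewrite -(big_mkord xpredT (fun k => modulus (dcoef (slot_coef i) k) * r ^+ k)).
  apply: (@le_trans _ _ (\sum_(0 <= k < (4 ^ n).-1) modulus (dcoef (slot_coef i) k) * r ^+ k)).
    rewrite [leRHS](big_cat_nat (leq0n n) nP)/= lerDl sumr_ge0// => k _.
    by rewrite mulr_ge0 ?normc_ge0// exprn_ge0.
  rewrite -sum_block_sum.
  apply: (@le_trans _ _ (\sum_(p < n) 4%:R / 3%:R * block_sum (fun n => r ^+ n) p)).
    by apply: ler_sum => p _; apply: block_sum_dcoef_slot => //; exact: ltW.
  rewrite -mulr_sumr sum_block_sum ler_wpM2l ?divr_ge0// big_mkord.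
  exact: geometric_sum_le.
have r2 : 0 <= 1 - r ^+ 2 by rewrite subr_ge0 exprn_ile1// ltW.
apply: le_trans (ler_wpM2l r2 h) _.
have -> : (1 - r ^+ 2) * (4%:R / 3%:R * (1 - r)^-1) = 4%:R / 3%:R * (1 + r).
  by field; rewrite subr_eq0 gt_eqF.
by lra.
Qed.

(** By [residual_dual] the partial sums up to the ends of stages differ from the claimed value by
    the error at (i, n), which tends to 0. *)
Lemma csum_to_dual j i n s : csum_to (fun k => dual_coef j (n + k) * conjc (slot_coef i k)) s ->
  s = ((i == j) && (n == 0%N))%:R :> C.
Proof.
move=> hs; apply/eqP; rewrite -subr_eq0 -normc_eq0 eq_le normc_ge0 andbT.
apply: le0_of_all_le => e e0; have e20 : 0 < e / 2 by rewrite divr_gt0.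
have [n0 H0] := hs _ e20; have [s0 H1] := residual_cvg0 j i n e20.
pose S := maxn n (maxn n0 s0).
have Sn0 : (n0 <= (4 ^ stage_start S).-1)%N.
  rewrite -ltnS prednK ?expn_gt0//; apply: leq_ltn_trans (ltn_expl _ (isT : 1 < 4)%N).
  by apply: leq_trans (stage_start_ge S); rewrite /S !leq_max leqnn orbT.
have h0 := H0 _ Sn0.
have h1 : `|residual j S i n| <= e / 2 by apply: H1; rewrite /S !leq_max leqnn !orbT.
rewrite residual_dual ?leq_maxl// in h1.
have E : \sum_(k < (4 ^ stage_start S).-1) dual_coef j (n + k) * conjc (slot_coef i k) =
    (\sum_(0 <= q < stage_start S | slot i q) dual_seq j (n + (4 ^ q).-1))%:C.
  under eq_bigr do rewrite conjc_slot_coef.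
  by rewrite (sum_slot_coef (fun k => dual_coef j (n + k))) rmorph_sum.
rewrite E in h0; move: h0 h1; set X := \sum_(0 <= q < _ | _) _; set d := (_ && _) => h0 h1.
have -> : s - d%:R = (s - X%:C) - (d%:R - X%:C) by ring.
rewrite (le_trans (normcB _ _))// (splitr e) lerD//; first by rewrite normc_distC.
by rewrite -(rmorph_nat (real_complex R)) -rmorphB normc_real.
Qed.

End lacunary.

(** * The invariant subspaces *)

Section bloch_operations.
Context {R : realType}.
Local Notation C := (Cplx R).
Local Notation modulus := (@Normc.normc R).
Implicit Types (f g : C -> C) (a b : nat -> C) (z : C).

Lemma bloch_psumP b : tame b -> bloch (psum b) <->
  exists M : R, forall z, disc z -> (1 - modulus z ^+ 2) * modulus (psum (dcoef b) z) <= M.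
Proof.
move=> tb; split=> [/bloch_iff[_ [f' [M H]]]|[M H]].
  by exists M => z z1; have [fd] := H z z1; rewrite (cderiv_unique (psum_cderiv tb z1) fd).
apply/bloch_iff; split; first by move=> z; exact: psum_out.
by exists (psum (dcoef b)), M => z z1; split; [exact: psum_cderiv|exact: H].
Qed.

Lemma one_sub_sqr_modulus_gt0 z : disc z -> 0 < 1 - modulus z ^+ 2.
Proof. by move=> z1; rewrite subr_gt0 exprn_ilt1// normc_ge0. Qed.

(** Controls the undifferentiated term of (z f)' = f + z f'. *)
Lemma bloch_growth b : tame b -> bloch (psum b) ->
  exists M : R, forall z, disc z -> (1 - modulus z ^+ 2) * modulus (psum b z) <= M.
Proof.
move=> tb /bloch_iff[_ [f' [M H]]]; exists (modulus (psum b 0) + M) => z z1.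
have r0 := normc_ge0 z; have r2 := one_sub_sqr_modulus_gt0 z1.
have M0 : 0 <= M.
  by have [_] := H _ (@disc0 R); apply: le_trans; rewrite Normc.normc0 expr0n subr0 mul1r normc_ge0.
have z0 : modulus (0 : C) <= modulus z by rewrite Normc.normc0.
have := bloch_lipschitz H r0 z1 z0 (lexx _); rewrite subr0 => h.
have h1 : modulus (psum b z) <= modulus (psum b 0) + M / (1 - modulus z ^+ 2).
  rewrite -{1}(subrK (psum b 0) (psum b z)) addrC (le_trans (normcD _ _))// lerD2l.
  apply: le_trans h _; rewrite -[leRHS]mulr1 ler_wpM2l ?divr_ge0 ?(ltW r2)//.
  exact: ltW.
apply: le_trans (ler_wpM2l (ltW r2) h1) _.
rewrite mulrDr mulrCA mulfV ?gt_eqF// mulr1 lerD2r ler_piMl ?normc_ge0//.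
by rewrite lerBlDr lerDl sqr_ge0.
Qed.

Lemma psum_comb (c : C) a b : tame a -> tame b ->
  c *: psum a + psum b = psum (fun n => c * a n + b n).
Proof. by move=> ta tb; apply/funext => z; rewrite psumD ?psumZ//; exact: tameZ. Qed.

Lemma bloch_comb (c : C) f g : bloch f -> bloch g -> bloch (c *: f + g).
Proof.
move=> bf bg; have [a ta fa] := bloch_taylor bf; have [b tb gb] := bloch_taylor bg.
rewrite fa in bf *; rewrite gb in bg *.
rewrite (psum_comb c ta tb); have tc := tameD (tameZ c ta) tb.
have [M HM] := (bloch_psumP ta).1 bf; have [K HK] := (bloch_psumP tb).1 bg.
apply/bloch_psumP => //; exists (modulus c * M + K) => z z1.
have -> : psum (dcoef (fun n => c * a n + b n)) z = c * psum (dcoef a) z + psum (dcoef b) z.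
  rewrite -(psumZ c z (tame_dcoef ta)) -(psumD z (tameZ c (tame_dcoef ta)) (tame_dcoef tb)).
  by congr (psum _ z); apply/funext => n; rewrite /dcoef; ring.
have r2 := one_sub_sqr_modulus_gt0 z1.
apply: le_trans (ler_wpM2l (ltW r2) (normcD _ _)) _.
rewrite mulrDr lerD ?HK// Normc.normcM mulrCA ler_wpM2l ?normc_ge0//; exact: HM.
Qed.

Lemma shift_psum b : tame b ->
  shift_operator (psum b) = psum (fun n => if n is m.+1 then b m else 0).
Proof.
move=> tb; apply/funext => z; rewrite /shift_operator.
have [z1|z1] := pselect (disc z); last by rewrite !psum_out// mulr0.
by rewrite psum_cons// add0r.
Qed.

Lemma psum_dcoef_shift b z : tame b -> disc z ->
  psum (dcoef (fun n => if n is m.+1 then b m else 0)) z = psum b z + z * psum (dcoef b) z.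
Proof.
move=> tb z1; have td := tame_dcoef tb.
have := psum_cons 0 td z1; rewrite add0r => <-.
rewrite -(psumD z tb (tame_cons 0 td)).
by congr (psum _ z); apply/funext => -[|n]; rewrite /dcoef ?addr0 ?mul1r// -[n.+2%:R]natr1; ring.
Qed.

Lemma bloch_shift f : bloch f -> bloch (shift_operator f).
Proof.
move=> bf; have [b tb fb] := bloch_taylor bf; rewrite fb in bf *.
rewrite (shift_psum tb); apply/bloch_psumP; first exact: tame_cons.
have [M HM] := (bloch_psumP tb).1 bf; have [K HK] := bloch_growth tb bf.
exists (K + M) => z z1; rewrite (psum_dcoef_shift tb z1).
have r2 := one_sub_sqr_modulus_gt0 z1.
apply: le_trans (ler_wpM2l (ltW r2) (normcD _ _)) _.
rewrite mulrDr lerD ?HK// Normc.normcM mulrCA; apply: le_trans (HM z z1).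
by rewrite ler_piMl ?mulr_ge0 ?normc_ge0 ?(ltW r2)// ltW.
Qed.

(** Let q be the quotient and s = z q. For |z| <= 1/2 the power series bounds q' by B. Otherwise z
    q' = s' - q and z q = s, and each division by z costs a factor 2, whence 2 (M + 2 K). *)
Lemma bloch_unshift b : tame b -> bloch (psum (fun n => if n is m.+1 then b m else 0)) ->
  bloch (psum b).
Proof.
move=> tb bs; set s := (fun n : nat => _) in bs.
have ts : tame s by exact: tame_cons.
have td := tame_dcoef tb.
have [M HM] := (bloch_psumP ts).1 bs; have [K HK] := bloch_growth ts bs.
have h0 : 0 <= (2^-1 : R) by rewrite invr_ge0.
have h1 : (2^-1 : R) < 1 by rewrite invf_lt1// ltr1n.
have [B HB] := tame_sum_le td h0 h1.
have B0 : 0 <= B by have := HB 0%N; rewrite big_ord0.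
have M0 : 0 <= M.
  apply: le_trans (HM _ (@disc0 R)); rewrite mulr_ge0 ?normc_ge0// ltW//.
  exact: one_sub_sqr_modulus_gt0 (@disc0 R).
have K0 : 0 <= K.
  apply: le_trans (HK _ (@disc0 R)); rewrite mulr_ge0 ?normc_ge0// ltW//.
  exact: one_sub_sqr_modulus_gt0 (@disc0 R).
apply/bloch_psumP => //; exists (B + 2 * (M + 2 * K)) => z z1.
have r2 := one_sub_sqr_modulus_gt0 z1; have r0 := normc_ge0 z.
have [zh|zh] := leP (modulus z) 2^-1.
  have h : modulus (psum (dcoef b) z) <= B.
    apply: psum_le => // n; apply: le_trans (HB n); apply: ler_sum => k _.
    by rewrite ler_wpM2l ?normc_ge0// lerXn2r ?nnegrE.
  apply: (@le_trans _ _ B); last by rewrite lerDl mulr_ge0// addr_ge0// mulr_ge0.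
  apply: le_trans h; rewrite ler_piMl ?normc_ge0//.
  by rewrite lerBlDr lerDl sqr_ge0.
have qz : psum s z = z * psum b z by rewrite /s (psum_cons 0 tb z1) add0r.
have dq : z * psum (dcoef b) z = psum (dcoef s) z - psum b z.
  by rewrite /s (psum_dcoef_shift tb z1) addrC addKr.
have double w : modulus w <= 2 * modulus (z * w).
  rewrite Normc.normcM mulrA ler_peMl ?normc_ge0//.
  by move: zh; lra.
apply: (@le_trans _ _ (2 * (M + 2 * K))); last by rewrite lerDr.
apply: le_trans (ler_wpM2l (ltW r2) (double _)) _.
rewrite mulrCA ler_wpM2l// dq; apply: le_trans (ler_wpM2l (ltW r2) (normcB _ _)) _.
rewrite mulrDr lerD ?HM//; apply: le_trans (ler_wpM2l (ltW r2) (double _)) _.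
by rewrite mulrCA ler_wpM2l// -qz HK.
Qed.

End bloch_operations.

(** * The annihilators and their images under the shift *)

Section annihilator.
Context {R : realType}.
Local Notation C := (Cplx R).
Implicit Types (f g : C -> C) (a b : nat -> C) (z : C) (J : set nat).

Definition predual_fun j n : C -> C := psum (predual_coef (fun k => dual_coef j (n + k)%N)).

Lemma dual_shift_block_summable j n :
  block_summable (fun k => @dual_coef R j (n + k)%N).
Proof.
elim: n => [|n IH]; first exact: dual_coef_block_summable.
have := block_summable_shift IH.
by have -> : (fun k => @dual_coef R j (n + k.+1)%N) = fun k => dual_coef j (n.+1 + k)%N
  by apply/funext => k; rewrite addnS.
Qed.

Lemma bergman_predual_fun j n : bergman (predual_fun j n).
Proof. by apply: bergman_psum_predual; exact: dual_shift_block_summable. Qed.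

Definition functional j n f : C := pairing (predual_fun j n) f.

Lemma functional_series j n b : tame b -> bloch (psum b) ->
  csum_to (fun k => dual_coef j (n + k)%N * conjc (b k)) (functional j n (psum b)).
Proof. by move=> tb bb; apply: pairing_predual => //; exact: dual_shift_block_summable. Qed.

Lemma functional_comb j n (c : C) f g : bloch f -> bloch g ->
  functional j n (c *: f + g) = conjc c * functional j n f + functional j n g.
Proof.
move=> bf bg; have bc := bloch_comb c bf bg; move: bc.
have [a ta fa] := bloch_taylor bf; have [b tb gb] := bloch_taylor bg.
rewrite fa in bf *; rewrite gb in bg *.
rewrite (psum_comb c ta tb) => bc; have tc := tameD (tameZ c ta) tb.
have h1 := functional_series j n tc bc.
have h2 := csum_toD (csum_toZ (conjc c) (functional_series j n ta bf)) (functional_series j n tb bg).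
apply: csum_to_unique h1 _.
have -> // : (fun k => dual_coef j (n + k)%N * conjc (c * a k + b k)) =
  (fun k => conjc c * (dual_coef j (n + k)%N * conjc (a k)) + dual_coef j (n + k)%N * conjc (b k)).
by apply/funext => k; rewrite rmorphD rmorphM; ring.
Qed.

(** Multiplication by z is adjoint to the backward shift: the constant coefficient of z f is 0, and
    dropping it moves the index of the functional by one. *)
Lemma functional_shift j n f : bloch f ->
  functional j n (shift_operator f) = functional j n.+1 f.
Proof.
move=> bf; have bs := bloch_shift bf; move: bs.
have [b tb fb] := bloch_taylor bf; rewrite fb in bf *.
rewrite (shift_psum tb) => bs.
have := csum_toS_inv (functional_series j n (tame_cons 0 tb) bs).
rewrite rmorph0 mulr0 subr0 => h1.
apply: csum_to_unique h1 _; have := functional_series j n.+1 tb bf.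
by have -> : (fun k => @dual_coef R j (n.+1 + k)%N * conjc (b k)) =
   (fun k => dual_coef j (n + k.+1)%N * conjc (b k)) by apply/funext => k; rewrite addnS.
Qed.

Lemma functional_slot j n i : functional j n (psum (slot_coef i)) = ((i == j) && (n == 0%N))%:R.
Proof. exact: csum_to_dual (functional_series j n (tame_slot_coef i) (bloch_slot i)). Qed.

Lemma functional_origin b : tame b -> bloch (psum b) -> functional 0 0 (psum b) = conjc (b 0%N).
Proof.
move=> tb bb; apply: csum_to_unique (functional_series 0 0 tb bb) _.
have := @csum_to_fin R (fun k => dual_coef 0 (0 + k) * conjc (b k)) 1.
rewrite big_ord1 /dual_coef dual_seq0 mul1r; apply => k k0.
by rewrite dual_seq0 add0n gtn_eqF// mul0r.
Qed.

Definition annihilator J : set (C -> C) :=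
  [set f | bloch f /\ forall j, J j -> forall n, functional j n.+1 f = 0].

Lemma bloch0 : bloch (0 : C -> C).
Proof.
have -> : (0 : C -> C) = (-1) *: psum (slot_coef 0) + psum (slot_coef 0).
  by rewrite scaleN1r addNr.
by apply: bloch_comb; exact: bloch_slot.
Qed.

Lemma functional0 j n : functional j n (0 : C -> C) = 0.
Proof.
have := functional_comb j n 1 bloch0 bloch0; rewrite scale1r addr0 rmorph1 mul1r.
by move=> /eqP; rewrite -subr_eq0 opprD addrA subrr add0r oppr_eq0 => /eqP.
Qed.

Lemma annihilator_linear J : linear_subspace (annihilator J).
Proof.
split; first by split=> [|j Jj n]; [exact: bloch0|exact: functional0].
move=> c f g [bf fJ] [bg gJ]; split; first exact: bloch_comb.
by move=> j Jj n; rewrite functional_comb// fJ// gJ// mulr0 addr0.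
Qed.

Lemma annihilator_shift J : shift_operator @` annihilator J `<=` annihilator J.
Proof.
move=> _ [f [bf fJ] <-]; split; first exact: bloch_shift.
by move=> j Jj n; rewrite functional_shift// fJ.
Qed.

(** An intersection of kernels. Each functional pairs with a fixed g in the predual, that is,
    evaluates at g the map defining the initial topology, and is therefore continuous. *)
Lemma annihilator_weak_star_closed J : weak_star_closed (annihilator J).
Proof.
split; first by move=> f [].
have -> : [set f : @bloch R | annihilator J (val f)] =
    \bigcap_(p in [set p : nat * nat | J p.1])
      [set f : @bloch R | functional p.1 p.2.+1 (val f) = 0].
  apply/seteqP; split=> [f [_ fJ] [j n] /= Jj|f fJ]; first exact: fJ.
  by split; [exact: set_valP|move=> j Jj n; exact: (fJ (j, n))].
apply: closed_bigI => -[j n] /= _.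
pose g : @bergman R := exist _ (predual_fun j n.+1) (mem_set (bergman_predual_fun j n.+1)).
pose F (f : @weak_star R) : C := pairing (val g) (val f).
have cF : continuous F.
  pose Phi (f : @weak_star R) : {ptws @bergman R -> C} := fun h => pairing (val h) (val f).
  have cPhi : continuous Phi by exact: initial_continuous.
  move=> f; apply: (@continuous_comp _ _ _ Phi (fun u : {ptws @bergman R -> C} => u g)).
    exact: cPhi.
  exact: (@proj_continuous _ (fun=> C) g).
have -> : [set f : @bloch R | functional j n.+1 (val f) = 0] = F @^-1` [set 0] by [].
apply: preimage_closed; first by move=> ? _; exact: cF.
by apply: accessible_closed_set1; apply: hausdorff_accessible; exact: norm_hausdorff.
Qed.

(** The functional of index (0, 0) forces the constant coefficient of f to vanish, so f = z q. By
    [functional_shift] the conditions on q for n >= 1 are those on f for n >= 0, the case n = 0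
    being the extra hypothesis. *)
Lemma annihilator_divide J f : J 0%N -> annihilator J f ->
  (forall j, J j -> functional j 0 f = 0) -> (shift_operator @` annihilator J) f.
Proof.
move=> J0 [bf fJ] f0; have [b tb fb] := bloch_taylor bf.
have b0 : b 0%N = 0.
  have := f0 _ J0; rewrite fb functional_origin -?fb// => /(congr1 conjc).
  by rewrite conjcK rmorph0.
have tq : tame (fun n => b n.+1).
  by have := tame_shift 1 tb; congr tame; apply/funext => n; rewrite addn1.
have bE : b = fun n => if n is m.+1 then b m.+1 else 0 by apply/funext => -[|n].
have fq : f = shift_operator (psum (fun n => b n.+1)) by rewrite (shift_psum tq) -bE.
have bq : bloch (psum (fun n => b n.+1)).
  by apply: (bloch_unshift tq); rewrite -bE -fb.
exists (psum (fun n => b n.+1)); last exact: esym fq.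
split; first exact: bq.
move=> j Jj [|n]; rewrite -(functional_shift j _ bq) -fq; first exact: f0.
exact: fJ.
Qed.

Lemma shift_annihilator_functional J f j : (shift_operator @` annihilator J) f -> J j ->
  functional j 0 f = 0.
Proof. by move=> [g [bg gJ] <-] Jj; rewrite functional_shift// gJ. Qed.

Lemma slot_annihilator J i : annihilator J (psum (slot_coef i)).
Proof. by split; [exact: bloch_slot|move=> j _ n; rewrite functional_slot andbF]. Qed.

Lemma functional_sum j m n (c : 'I_m -> C) (e : 'I_m -> C -> C) : (forall i, bloch (e i)) ->
  bloch (\sum_(i < m) c i *: e i) /\
  functional j n (\sum_(i < m) c i *: e i) = \sum_(i < m) conjc (c i) * functional j n (e i).
Proof.
move=> be; elim: (index_enum _) => [|i r [br fr]].
  by rewrite !big_nil; split; [exact: bloch0|exact: functional0].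
rewrite !big_cons; split; first exact: (bloch_comb (c i) (be i) br).
by rewrite (functional_comb j n (c i) (be i) br) fr.
Qed.

Lemma functional_sub_sum j m n (c : 'I_m -> C) (e : 'I_m -> C -> C) f : (forall i, bloch (e i)) ->
  bloch f ->
  functional j n (f - \sum_(i < m) c i *: e i) =
  functional j n f - \sum_(i < m) conjc (c i) * functional j n (e i).
Proof.
move=> be bf; have [bs sE] := functional_sum j n c be.
by rewrite addrC -scaleN1r (functional_comb j n (-1) bs bf) sE rmorphN rmorph1 mulN1r addrC.
Qed.

End annihilator.

(** * The index of the annihilators *)

Section index.
Context {R : realType}.
Local Notation C := (Cplx R).

Lemma annihilator_index_fin n : (0 < n)%N ->
  quotient_dim (@annihilator R [set j | (j < n)%N])
    (shift_operator @` annihilator [set j | (j < n)%N]) (Some n).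
Proof.
move=> n0; set J := [set j | (j < n)%N].
pose e (i : 'I_n) : C -> C := psum (slot_coef i).
have be i : bloch (e i) by exact: bloch_slot.
have fe i k : functional k 0 (e i) = ((i : nat) == k)%:R by rewrite functional_slot andbT.
have sumE (c : 'I_n -> C) (k : 'I_n) : \sum_(i < n) conjc (c i) * functional k 0 (e i) = conjc (c k).
  rewrite (bigD1 k)//= fe eqxx mulr1 big1 ?addr0// => i ik.
  by rewrite fe (negbTE (ik : (i != k :> nat))) mulr0.
exists e; split.
- by move=> i; exact: slot_annihilator.
- move=> c Fc k; have h := shift_annihilator_functional Fc (ltn_ord k : J k).
  have [_ sE] := functional_sum k 0 c be; rewrite sE sumE in h.
  by rewrite -[c k]conjcK h rmorph0.
(* The functionals are conjugate linear, hence the conjugates in the coordinates of x. *)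
move=> x [bx xJ]; pose c (i : 'I_n) : C := conjc (functional i 0 x); exists c.
have hx j m : functional j m (x - \sum_(i < n) c i *: e i) =
    functional j m x - \sum_(i < n) conjc (c i) * functional j m (e i).
  exact: functional_sub_sum.
have [bs _] := functional_sum 0 0 c be.
apply: annihilator_divide; first exact: n0.
- split.
    have := bloch_comb (-1) bs bx; rewrite scaleN1r addrC; exact.
  move=> j Jj m; rewrite hx xJ// big1 ?subr0// => i _.
  by rewrite functional_slot andbF mulr0.
move=> j Jj; rewrite hx (sumE c (Ordinal Jj)) /c /= conjcK.
exact: subrr.
Qed.

(** If n cosets spanned the quotient, expanding the n+1 slot functions in them and applying the n+1
    biorthogonal functionals would factor the identity matrix of size n+1 through dimension n. *)
Lemma annihilator_index_inf :
  quotient_dim (@annihilator R setT) (shift_operator @` annihilator setT) None.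
Proof.
move=> n e [Ee _ span].
have be i : bloch (e i) by have [] := Ee i.
have /choice[c Hc] : forall k : 'I_n.+1, exists c : 'I_n -> C,
    (shift_operator @` @annihilator R setT) (psum (slot_coef k) - \sum_(i < n) c i *: e i).
  by move=> k; apply: span; exact: slot_annihilator.
pose A : 'M[R[i]]_(n.+1, n) := \matrix_(k, i) conjc (c k i).
pose B : 'M[R[i]]_(n, n.+1) := \matrix_(i, j) functional j 0 (e i).
have AB : A *m B = 1%:M.
  apply/matrixP => k j; rewrite !mxE.
  under eq_bigr do rewrite !mxE.
  have := shift_annihilator_functional (Hc k) (I : [set: nat] (j : nat)).
  rewrite functional_sub_sum//; last exact: bloch_slot.
  by rewrite functional_slot andbT => /eqP; rewrite subr_eq0 => /eqP <-.
have := mxrankM_maxl A B; rewrite AB mxrank1 => /leq_trans /(_ (rank_leq_col A)).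
by rewrite ltnn.
Qed.

End index.

Theorem theorem1p7 (R : realType) (N : option nat) (N_neq0 : N <> Some 0%N) :
  exists E : set (Cplx R -> Cplx R),
    weak_star_closed_invariant_subspace E /\ index_eq E N.
Proof.
have inv J : weak_star_closed_invariant_subspace (@annihilator R J).
  split; [exact: annihilator_linear|exact: annihilator_weak_star_closed|].
  exact: annihilator_shift.
case: N N_neq0 => [n nN|_]; last first.
  by exists (annihilator setT); split; [exact: inv|exact: annihilator_index_inf].
exists (annihilator [set j | (j < n)%N]); split; first exact: inv.
by apply: annihilator_index_fin; case: n nN.
Qed.
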